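(* Let $\beta_b>1$, $\beta_g>0$ and $d>4\beta_b$, and let $\widetilde\sigma^2_{n,\mathrm{PE}}$ and $\widehat\sigma^2_{n,\mathrm{PE}}$ be the unclipped and clipped all-pairs ridge estimators defined in the context, with parameters $N_{\max},\kappa,v_0,\lambda,h_n$. There are fixed choices of $N_{\max}\ge q+2$, $\kappa>0$ and $v_0>0$ such that, for every fixed $\lambda>0$ and every deterministic sequence $h_n\in(0,1]$ with $h_n\to0$ and $nh_n^d\to\infty$, there are constants $C,c>0$, not depending on $n$ or $\theta$, with $$\sup_{\theta\in\Theta(\beta_b,\beta_g,d)}\mathbb E_\theta\bigl(\widehat\sigma^2_{n,\mathrm{PE}}-\sigma^2\bigr)^2\le C\Bigl\{\frac1{nh_n^d}+H_n^{4\beta_b}h_n^4+\exp(-c\,nh_n^d)\Bigr\}.$$ Consequently, if $h_n\asymp n^{-(d-4\beta_b)/\{d(d+4)\}}$, then, for some constant $C$ not depending on $n$ or $\theta$, $$\sup_{\theta\in\Theta(\beta_b,\beta_g,d)}\mathbb E_\theta\bigl(\widehat\sigma^2_{n,\mathrm{PE}}-\sigma^2\bigr)^2\le C\,n^{-4(\beta_b+1)/(d+4)} .$$ The same bounds hold with $\widehat\sigma^2_{n,\mathrm{PE}}$ replaced by the unclipped estimator $\widetilde\sigma^2_{n,\mathrm{PE}}$.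
   Context: **Hölder balls.** Fix an open set $U\subset\mathbb R^d$ containing $[0,1]^d$. For $s>0$ put $\ell_s=\lceil s\rceil-1$, $\alpha_s=s-\ell_s\in(0,1]$, and $\|g\|_{C^s(U)}=\sum_{|\nu|\le\ell_s}\|\partial^\nu g\|_{L^\infty(U)}+\max_{|\nu|=\ell_s}\sup_{x\ne y\in U}\frac{|\partial^\nu g(x)-\partial^\nu g(y)|}{\|x-y\|^{\alpha_s}}$. Let $\mathcal H^s(L;U)=\{g:U\to\mathbb R:\|g\|_{C^s(U)}\le L\}$. **Model.** Fix $0<\underline p<1<\overline p<\infty$, $L\ge1$, $0<\underline v\le\overline v<\infty$, $M_4>\overline v^{2}$. A parameter is $\theta=(p,f,\sigma^2,Q)$ with $p$ a density on $[0,1]^d$, $f$ a regression function, $\sigma^2>0$, $Q=(Q_x)_{x\in[0,1]^d}$ a Markov kernel. $\Theta(\beta_b,\beta_g,d)$ is the set of $\theta$ with: (i) $p$ is the restriction to $[0,1]^d$ of a function in $\mathcal H^{\beta_g}(L;U)$ and $\underline p\le p\le\overline p$ on $[0,1]^d$; (ii) $f$ is the restriction to $[0,1]^d$ of a function in $\mathcal H^{\beta_b}(L;U)$; (iii) for $p(x)dx$-a.e. $x$, $\int u\,Q_x(du)=0$, $\int u^2Q_x(du)=\sigma^2$, $\int u^4Q_x(du)\le M_4$, with $\underline v\le\sigma^2\le\overline v$. One observes $n$ i.i.d. copies $(X_i,Y_i)$ with $X_i\sim p$, $Y_i=f(X_i)+\varepsilon_i$, $\varepsilon_i\mid X_i=x\sim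 Q_x$. Constants may depend on the model-class constants, $d,\beta_b,\beta_g,\lambda_0$, the fixed screening and ridge parameters and the polynomial basis. **Partition.** Fix $\lambda_0>0$; $r_n=\max\{0,\operatorname{round}(\log_2(n/\lambda_0))\}$, $J_n=2^{r_n}$, $H_n=J_n^{-1/d}$. Choose nonnegative integers $s_{n,1},\dots,s_{n,d}$ with sum $r_n$, pairwise differing by at most one; split coordinate $j$ of $[0,1]^d$ into $2^{s_{n,j}}$ equal intervals. The resulting partition $\mathcal Q_n$ has $J_n$ axis-aligned rectangular cells of volume $J_n^{-1}$ (boundaries assigned by a fixed half-open convention). Write $\overline Q=b_Q+A_Q[0,1]^d$ with $A_Q$ diagonal, and for $X_i\in Q$ let $U_i=A_Q^{-1}(X_i-b_Q)\in[0,1]^d$. **Estimator.** $\ell=\lceil\beta_b\rceil-1$, $q=\binom{d+\ell}{\ell}$; $\psi=(\psi_1,\dots,\psi_q)^\top$ is a fixed basis of polynomials on $\mathbb R^d$ of total degree at most $\ell$. For a cell $Q$: $I_Q=\{i:X_i\in Q\}$, $N_Q=|I_Q|$, $\Phi_Q=(\psi(U_i)^\top)_{i\in I_Q}$ (rows in increasing order of index), $Y_Q=(Y_i)_{i\in I_Q}$, $G_Q=\Phi_Q^\top\Phi_Q$. Retain $Q$ when $q<N_Q\le N_{\max}$ and $\lambda_{\min}(N_Q^{-1}G_Q)\ge\kappa$; in a retained cell $R_Q=I_{N_Q}-\Phi_QG_Q^{-1}\Phi_Q^\top$. For an unordered pair $e=(i,j)$ of distinct indices in a retained cell, $d_e=e_i-e_j\in\mathbb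 R^{N_Q}$ (coordinate vectors in the local ordering) and $v_e=d_e^\top R_Qd_e$; retain the pair when $\|U_i-U_j\|_\infty\le h_n$ and $v_e\ge v_0$. For retained pairs set $Z_e=(d_e^\top R_QY_Q)^2/v_e$ and $s_e=\|U_i-U_j\|_2^2/h_n^2$. Let $\mathcal E_n$ be the set of all retained pairs over all retained cells, $M_n=|\mathcal E_n|$; when $M_n\ge1$, $\bar s=M_n^{-1}\sum_{e\in\mathcal E_n}s_e$, $S_s=\sum_{e\in\mathcal E_n}(s_e-\bar s)^2$, and $w_e=\frac1{M_n}-\frac{\bar s(s_e-\bar s)}{S_s+\lambda M_n}$. Define $\widetilde\sigma^2_{n,\mathrm{PE}}=\sum_{e\in\mathcal E_n}w_eZ_e$ if $M_n\ge1$, $\widetilde\sigma^2_{n,\mathrm{PE}}=\underline v$ if $M_n=0$, and $\widehat\sigma^2_{n,\mathrm{PE}}=\min\{\overline v,\max\{\underline v,\widetilde\sigma^2_{n,\mathrm{PE}}\}\}$. *)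

(* Defs.v *)
From HB Require Import structures.
From mathcomp Require Import all_boot all_order all_algebra.
From mathcomp Require Import all_classical all_reals all_analysis.
From mathcomp Require Import(canonicals, coercions) mpoly.

Set Implicit Arguments.
Unset Strict Implicit.
Unset Printing Implicit Defensive.

Import Order.TTheory GRing.Theory Num.Theory.
Import numFieldNormedType.Exports.

Local Open Scope classical_set_scope.
Local Open Scope ring_scope.

Section pack_sigma_finite.
Context (disp : measure_display) (T : measurableType disp) (R : realType).
Variables (m : {measure set T -> \bar R}) (m_sf : sigma_finite [set: T] m).

Definition sf_fun : set T -> \bar R := m.
HB.instance Definition _ := Measure.on sf_fun.
HB.instance Definition _ := Measure_isSigmaFinite.Build _ _ _ sf_fun m_sf.
Definition pack_sigma_finite : {sigma_finite_measure set T -> \bar R} := sf_fun.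

End pack_sigma_finite.

Section power_measure.
Context (R : realType) (disp : measure_display) (T : measurableType disp).
Variable mu : {sigma_finite_measure set T -> \bar R}.

Definition cons_pair n (z : T * n.-tuple T) : n.+1.-tuple T :=
  [tuple of z.1 :: z.2].

Lemma measurable_cons_pair n : measurable_fun [set: _] (@cons_pair n).
Proof. exact: measurable_cons. Qed.

(* The n-fold product measure on n-tuples. *)
Fixpoint power_measure (n : nat) : set (n.-tuple T) -> \bar R :=
  match n return set (n.-tuple T) -> \bar R with
  | 0 => dirac ([tuple] : 0.-tuple T)
  | n'.+1 => fun A => (mu \x @power_measure n')%E (@cons_pair n' @^-1` A)
  end.

Lemma power_measureP n :
  exists m : {sigma_finite_measure set (n.-tuple T) -> \bar R},
    (m : set _ -> \bar R) = @power_measure n.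
Proof.
elim: n => [|n [m mE]].
  by exists (dirac ([tuple] : 0.-tuple T)).
pose prod : {measure set (T * n.-tuple T)%type -> \bar R} := (mu \x m)%E.
have prod_sf : sigma_finite [set: _] prod.
  have /sigma_finiteP[F [TF ndF Foo]] := sigma_finiteT mu.
  have /sigma_finiteP[G [TG ndG Goo]] := sigma_finiteT m.
  exists (fun i => F i `*` G i).
    rewrite -setXTT TF TG predeqE => -[x y]; split.
      move=> [/= [i _ Fix] [k _ Gky]]; exists (maxn i k) => //; split.
      - by move: x Fix; exact/subsetPset/ndF/leq_maxl.
      - by move: y Gky; exact/subsetPset/ndG/leq_maxr.
    by move=> [i _ []/= ? ?]; split; exists i.
  move=> k; have [? ?] := Foo k; have [? ?] := Goo k.
  split; first exact: measurableX.
  by rewrite /prod/= product_measure1E// lte_mul_pinfty// ge0_fin_numE.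
pose nu : set (n.+1.-tuple T) -> \bar R := fun A => prod (@cons_pair n @^-1` A).
have mpre A : measurable A -> measurable (@cons_pair n @^-1` A).
  move=> mA; rewrite -[X in measurable X]setTI.
  exact: measurable_cons_pair.
have nu0 : nu set0 = 0%E by rewrite /nu preimage_set0; exact: measure0.
have nu_ge0 A : (0 <= nu A)%E by exact: measure_ge0.
have nu_sigma : semi_sigma_additive nu.
  move=> F mF tF mUF; rewrite /nu preimage_bigcup.
  apply: measure_semi_sigma_additive.
  - by move=> i; exact: mpre.
  - apply/trivIsetP => /= i j _ _ ij; rewrite -preimage_setI.
    by move/trivIsetP : tF => /(_ _ _ _ _ ij) ->//; rewrite preimage_set0.
  - by rewrite -preimage_bigcup; exact: mpre.
pose nuM := isMeasure.Build _ _ _ nu nu0 nu_ge0 nu_sigma.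
pose uncons (x : n.+1.-tuple T) : T * n.-tuple T :=
  (tnth x ord0, [tuple of behead x]).
have consK : cancel (@cons_pair n) uncons.
  move=> [a b]; rewrite /uncons /cons_pair; congr (_, _).
  exact: val_inj.
have muncons : measurable_fun [set: _] uncons.
  apply/measurable_fun_pairP; split.
  - exact: measurable_tnth.
  - exact: measurable_behead.
have nu_sf : sigma_finite [set: _] nu.
  have [F FT Foo] := prod_sf.
  exists (fun i => uncons @^-1` F i).
    by rewrite -preimage_bigcup -FT preimage_setT.
  move=> i; have [mF Fi] := Foo i; split.
    by rewrite -[X in measurable X]setTI; exact: muncons.
  rewrite /nu -comp_preimage.
  by rewrite (_ : uncons \o _ = id)// funeqE => z /=; exact: consK.
pose nuMeas : {measure set (n.+1.-tuple T) -> \bar R} := HB.pack nu nuM.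
exists (@pack_sigma_finite _ _ _ nuMeas nu_sf).
by rewrite /pack_sigma_finite /= /sf_fun /= /nu /prod /= -mE.
Qed.

Lemma power_measure0 n : @power_measure n set0 = 0%E.
Proof. by have [m <-] := power_measureP n; exact: measure0. Qed.

Lemma power_measure_ge0 n A : (0 <= @power_measure n A)%E.
Proof. by have [m <-] := power_measureP n; exact: measure_ge0. Qed.

Lemma power_measure_sigma_additive n : semi_sigma_additive (@power_measure n).
Proof.
by have [m <-] := power_measureP n; exact: measure_semi_sigma_additive.
Qed.

HB.instance Definition _ n := isMeasure.Build _ _ _ (@power_measure n)
  (@power_measure0 n) (@power_measure_ge0 n) (@power_measure_sigma_additive n).

Lemma power_measure_sigma_finite n : sigma_finite [set: _] (@power_measure n).
Proof. by have [m <-] := power_measureP n; exact: sigma_finiteT. Qed.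

HB.instance Definition _ n := Measure_isSigmaFinite.Build _ _ _
  (@power_measure n) (@power_measure_sigma_finite n).

End power_measure.

(* Points of R^d come in two guises: [Rd R d], which carries the product
   sigma-algebra (measures, kernels, random variables), and ['rV[R]_d], which
   carries the topology and the derivatives; [pt] identifies them. *)
Notation Rd R d := (d.-tuple (measurableTypeR R)).

Definition pt (R : realType) (d : nat) (x : Rd R d) : 'rV[R]_d :=
  \row_j tnth x j.

Definition leb (R : realType) (d : nat) :
    {sigma_finite_measure set (Rd R d) -> \bar R} :=
  @power_measure R _ (measurableTypeR R) (@lebesgue_measure R) d.

Lemma leb_box (R : realType) (d : nat) (B : 'I_d -> set (measurableTypeR R)) :
  (forall i, measurable (B i)) ->
  leb R d [set x | forall i, B i (tnth x i)] =
  (\prod_(i < d) lebesgue_measure (B i))%E.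
Proof.
rewrite /leb /=; elim: d B => [|n IH] B mB.
  by rewrite big_ord0 /= diracE mem_set//= => -[].
pose nu : {sigma_finite_measure set (Rd R n) -> \bar R} :=
  @power_measure R _ (measurableTypeR R) (@lebesgue_measure R) n.
pose C : set (Rd R n) := [set x | forall i, B (lift ord0 i) (tnth x i)].
transitivity ((@lebesgue_measure R \x nu)%E (B ord0 `*` C)).
  rewrite /=; congr (product_measure1 _ _ _); apply/seteqP; split => -[a b] /=.
    move=> H; split; first by have := H ord0; rewrite tnth0.
    by move=> i; have := H (lift ord0 i); rewrite tnthS.
  move=> [Ha Hb] i; case: (unliftP ord0 i) => [j ->|->]; last by rewrite tnth0.
  by rewrite tnthS; exact: Hb.
have mC : measurable C.
  have -> : C = \bigcap_(i in [set: 'I_n])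
      ((fun x : Rd R n => tnth x i) @^-1` B (lift ord0 i)).
    by apply/seteqP; split => x /= H i; [move=> _|]; exact: H.
  apply: fin_bigcap_measurable; first exact: finite_finset.
  move=> i _; rewrite -[X in measurable X]setTI.
  by apply: measurable_tnth.
rewrite big_ord_recl product_measure1E//=.
by congr (_ * _)%E; exact: (IH (fun i => B (lift ord0 i))).
Qed.

Definition unit_cube (R : realType) (d : nat) : set 'rV[R]_d :=
  [set x | forall j, 0 <= x 0 j <= 1].

Section hoelder_balls.
Context (R : realType) (d : nat).
Implicit Types (g : 'rV[R]_d -> R) (U : set 'rV[R]_d) (s : R).

Definition hoelder_ell s : nat := (`|Num.ceil s|%N).-1.
Definition hoelder_alpha s : R := s - (hoelder_ell s)%:R.

Definition enorm (x : 'rV[R]_d) : R := Num.sqrt (\sum_j x 0 j ^+ 2).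

Definition partial (j : 'I_d) g : 'rV[R]_d -> R := 'D_(delta_mx 0 j) g.

Definition partials (js : seq 'I_d) g : 'rV[R]_d -> R := foldr partial g js.

Definition partial_multi (nu : 'I_d -> nat) g : 'rV[R]_d -> R :=
  partials (flatten [seq nseq (nu j) j | j <- enum 'I_d]) g.

(* Derivatives are total functions, so that their existence has to be asked
   for: this is g \in C^l(U). *)
Definition continuously_derivable U (l : nat) g : Prop :=
  (forall js j x, (size js < l)%N -> U x ->
     derivable (partials js g) x (delta_mx 0 j)) /\
  (forall js x, (size js <= l)%N -> U x -> {for x, continuous (partials js g)}).

(* Multi-indices of order at most l range over {ffun 'I_d -> 'I_l.+1}; the
   L^oo(U) norm is the one on R^d of the extension by 0 outside U. *)
Definition hoelder_norm U s g : \bar R :=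
  (\sum_(nu : {ffun 'I_d -> 'I_(hoelder_ell s).+1}
          | (\sum_j nu j <= hoelder_ell s)%N)
      'N[@leb R d]_+oo[ (fun x =>
         (if pt x \in U then partial_multi (fun j => nu j) g (pt x)
          else 0)%:E) ]
   + \big[maxe/0]_(nu : {ffun 'I_d -> 'I_(hoelder_ell s).+1}
          | (\sum_j nu j == hoelder_ell s)%N)
      ereal_sup [set r | exists x y, [/\ U x, U y, x <> y &
        r = (`|partial_multi (fun j => nu j) g x
               - partial_multi (fun j => nu j) g y|
             / enorm (x - y) `^ hoelder_alpha s)%:E]])%E.

Definition hoelder_ball U s (L : R) : set ('rV[R]_d -> R) :=
  [set g | continuously_derivable U (hoelder_ell s) g /\
           (hoelder_norm U s g <= L%:E)%E].

End hoelder_balls.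

Section model.
Context (R : realType) (d : nat).

(* Only the restrictions of [dens], [reg] and [noise] to the unit cube matter
   below. *)
Record param := Param {
  dens : 'rV[R]_d -> R;
  reg : 'rV[R]_d -> R;
  var : R;
  noise : R.-pker (Rd R d) ~> (measurableTypeR R) }.

Definition cube_Rd : set (Rd R d) := [set x | unit_cube (pt x)].

Definition is_density (p : 'rV[R]_d -> R) : Prop :=
  (forall x, unit_cube x -> 0 <= p x) /\
  (\int[@leb R d]_(x in cube_Rd) (p (pt x))%:E = 1)%E.

Definition density_ae (p : 'rV[R]_d -> R) (A : Rd R d -> Prop) : Prop :=
  exists N : set (Rd R d), [/\ measurable N,
    (\int[@leb R d]_(x in cube_Rd `&` N) (p (pt x))%:E = 0)%E &
    forall x, cube_Rd x -> ~ N x -> A x].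

Definition Theta (U : set 'rV[R]_d) (plow phigh L vlow vhigh M4 : R)
    (betab betag : R) : set param :=
  [set theta |
    [/\ is_density (dens theta),
        0 < var theta,
        (exists2 g, hoelder_ball U betag L g &
           forall x, unit_cube x -> dens theta x = g x) /\
        (forall x, unit_cube x -> plow <= dens theta x <= phigh),
        (exists2 g, hoelder_ball U betab L g &
           forall x, unit_cube x -> reg theta x = g x) &
        density_ae (dens theta) (fun x =>
          [/\ (\int[noise theta x]_u u%:E = 0)%E,
              (\int[noise theta x]_u (u ^+ 2)%:E = (var theta)%:E)%E &
              (\int[noise theta x]_u (u ^+ 4)%:E <= M4%:E)%E]) /\
        vlow <= var theta <= vhigh]].

(* Z i = (X_i, Y_i) are n i.i.d. observations: mutual independence, and the
   common law of (X, f(X) + eps) with X ~ p and eps | X = x ~ Q_x. *)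
Definition iid_sample (theta : param) (n : nat) (disp : measure_display)
    (Omega : measurableType disp) (P : probability Omega R)
    (Z : 'I_n -> {RV P >-> (Rd R d * measurableTypeR R)%type}) : Prop :=
  (forall A : 'I_n -> set (Rd R d * measurableTypeR R),
     (forall i, measurable (A i)) ->
     P [set w | forall i, A i (Z i w)] = (\prod_(i < n) P (Z i @^-1` A i))%E) /\
  (forall i (A : set (Rd R d * measurableTypeR R)), measurable A ->
     P (Z i @^-1` A) =
     (\int[@leb R d]_(x in cube_Rd)
        ((dens theta (pt x))%:E *
         noise theta x [set u | A (x, reg theta (pt x) + u)%R]))%E).

Definition worst_risk (n : nat) (Th : set param)
    (est : ('I_n -> 'rV[R]_d) -> ('I_n -> R) -> R) : \bar R :=
  ereal_sup [set r | exists2 theta, Th theta &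
    exists (disp : measure_display) (Omega : measurableType disp)
      (P : probability Omega R)
      (Z : 'I_n -> {RV P >-> (Rd R d * measurableTypeR R)%type}),
      iid_sample theta Z /\
      r = ('E_P[ (fun w => (est (fun i => pt (Z i w).1) (fun i => (Z i w).2)
                            - var theta) ^+ 2)%R ])%E].

End model.

Section partition.
Context (R : realType).

(* Ties are rounded upwards. *)
Definition round (t : R) : int := Num.floor (t + 2^-1).

Definition log2 (t : R) : R := ln t / ln 2.

Definition rn (lambda0 : R) (n : nat) : nat :=
  absz (Num.max 0 (round (log2 (n%:R / lambda0)))).

Definition Jn (lambda0 : R) (n : nat) : nat := (2 ^ rn lambda0 n)%N.

Definition Hn (d : nat) (lambda0 : R) (n : nat) : R :=
  (Jn lambda0 n)%:R `^ (- (d%:R^-1)).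

Definition balanced_split (d r : nat) (s : 'I_d -> nat) : Prop :=
  (\sum_j s j = r)%N /\ (forall i j, (s i <= (s j).+1)%N).

End partition.

Definition qdim (d ell : nat) : nat := 'C(d + ell, ell).

(* [msize p <= ell.+1] says that p has total degree at most ell. *)
Definition polynomial_basis (R : realType) (d ell : nat)
    (psi : 'I_(qdim d ell) -> mpoly.mpoly d R) : Prop :=
  (forall k, (mpoly.msize (psi k) <= ell.+1)%N) /\
  (forall p : mpoly.mpoly d R, (mpoly.msize p <= ell.+1)%N ->
     exists! c : 'rV[R]_(qdim d ell), p = \sum_k c 0 k *: psi k).

(* Used only for symmetric matrices of positive size, where the set of
   eigenvalues is finite and nonempty, so that inf is a minimum. *)
Definition lambda_min (R : realType) (m : nat) (A : 'M[R]_m) : R :=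
  inf [set a | eigenvalue A a].

Section estimator.
Context (R : realType) (d ell : nat).
Variables (psi : 'I_(qdim d ell) -> mpoly.mpoly d R) (s : 'I_d -> nat).
Variables (Nmax : nat) (kappa v0 lambda h vlow vhigh : R).
Context (n : nat).
Variables (x : 'I_n -> 'rV[R]_d) (y : 'I_n -> R).

Definition cell : finType := {dffun forall j : 'I_d, 'I_(2 ^ s j)}.

Definition corner (Q : cell) (j : 'I_d) : R := (Q j)%:R / 2 ^+ s j.
Definition side (j : 'I_d) : R := (2 ^+ s j)^-1.

(* Intervals are closed on the left and open on the right, except that the
   last one of each coordinate contains 1. *)
Definition in_cell (Q : cell) (z : 'rV[R]_d) : bool :=
  [forall j, (corner Q j <= z 0 j) &&
     ((z 0 j < corner Q j + side j) || (z 0 j == 1) && ((Q j).+1 == 2 ^ s j)%N)].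

Definition members (Q : cell) : {set 'I_n} := [set i | in_cell Q (x i)].

Local Notation NQ Q := #|members Q|.

Definition local_coord (Q : cell) (i : 'I_n) : 'rV[R]_d :=
  \row_j ((x i 0 j - corner Q j) / side j).

(* [enum_val] lists the members of Q in increasing order. *)
Definition design (Q : cell) : 'M[R]_(NQ Q, qdim d ell) :=
  \matrix_(a, k) mpoly.meval (fun j => local_coord Q (enum_val a) 0 j) (psi k).

Definition response (Q : cell) : 'cV[R]_(NQ Q) := \col_a y (enum_val a).

Definition gram (Q : cell) : 'M[R]_(qdim d ell) :=
  (design Q)^T *m design Q.

Definition retained_cell (Q : cell) : bool :=
  (qdim d ell < NQ Q <= Nmax)%N &&
  (kappa <= lambda_min ((NQ Q)%:R^-1 *: gram Q)).

Definition residual_maker (Q : cell) : 'M[R]_(NQ Q) :=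
  1%:M - design Q *m invmx (gram Q) *m (design Q)^T.

(* A pair e = (i, j), i < j, is recorded together with the cell it lies in. *)
Local Notation pair := (cell * ('I_n * 'I_n))%type.

Definition pair_vec (e : pair) : 'cV[R]_(NQ e.1) :=
  \col_a ((enum_val a == e.2.1)%:R - (enum_val a == e.2.2)%:R).

Definition pair_v (e : pair) : R :=
  ((pair_vec e)^T *m residual_maker e.1 *m pair_vec e) 0 0.

Definition pair_diff (e : pair) : 'rV[R]_d :=
  local_coord e.1 e.2.1 - local_coord e.1 e.2.2.

(* The norm of the library on row vectors is the sup norm. *)
Definition edges : {set pair} :=
  [set e : pair | [&& retained_cell e.1,
    e.2.1 \in members e.1, e.2.2 \in members e.1, (e.2.1 < e.2.2)%N,
    `|pair_diff e| <= h & v0 <= pair_v e]].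

Definition pair_Z (e : pair) : R :=
  ((pair_vec e)^T *m residual_maker e.1 *m response e.1) 0 0 ^+ 2 / pair_v e.

Definition pair_s (e : pair) : R := enorm (pair_diff e) ^+ 2 / h ^+ 2.

Definition nedges : R := #|edges|%:R.
Definition sbar : R := nedges^-1 * \sum_(e in edges) pair_s e.
Definition Ssum : R := \sum_(e in edges) (pair_s e - sbar) ^+ 2.
Definition weight (e : pair) : R :=
  nedges^-1 - sbar * (pair_s e - sbar) / (Ssum + lambda * nedges).

Definition sigma2_unclipped : R :=
  if (0 < #|edges|)%N then \sum_(e in edges) weight e * pair_Z e else vlow.

Definition sigma2_clipped : R :=
  Num.min vhigh (Num.max vlow sigma2_unclipped).

End estimator.

(* Main.v *)
Require Import Defs.
From HB Require Import structures.
From mathcomp Require Import all_boot all_order all_algebra.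
From mathcomp Require Import all_classical all_reals all_analysis.
From mathcomp Require Import(canonicals, coercions) mpoly.
From mathcomp Require Import measurable_realfun zify ring lra.

Set Implicit Arguments.
Unset Strict Implicit.
Unset Printing Implicit Defensive.

Import Order.TTheory GRing.Theory Num.Theory.
Import numFieldNormedType.Exports.

Local Open Scope classical_set_scope.
Local Open Scope ring_scope.

(** Freeze the design. The residual contrast of a retained pair is orthogonal to
    the polynomials on its cell, so it only sees the noise and the remainder of
    a Taylor expansion of f. Expanding about the second point of the pair, this
    remainder is of order H^beta on the cell and of order H^beta h at the first
    point, while the other entries of the residual vector are of order h: the
    bias of every pair is of order H^beta h. The error of the weighted average
    is then a multilinear form of degree at most 2 in the noises plus a linear
    form in their centered squares [chaos_decomposition]. The weights sum to
    one, which removes sigma^2, and are of order 1/M; a point belongs to boundedly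
    many pairs. Hence the squared coefficients sum to order H^(4 beta) h^4 + 1/M
    [coefT_le, coefB_le, chaos_coef_le]. The noises are centered and independent
    given the design, so this sum bounds the conditional mean squared error; the
    conditioning is replaced by resampling the responses one after the other
    from their kernels [integral_step, chaos_expectation].

    It remains to see that M is of order at least n h^d except with probability
    of order 1/(n h^d). Fix anchor points of the unit cube at which polynomials
    are determined, found on a Kronecker curve [anchors]. A cell whose points are
    one near each anchor, and two more in a common small box of side of order h,
    passes all the screens [configuration_edge]. For a well chosen family of such
    configurations, the events that a given cell contains exactly given points
    in a given configuration are nearly independent for distinct cells, because
    the design points are independent and a cell has probability of order 1/n;
    their number has mean of order n h^d and Chebyshev's inequality applies
    [arranged_indep, count_lower_tail, edges_lower_tail]. This fixes N_max, kappa
    and v_0 = 1.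

    For bounded n the risk is bounded, and n h^d is bounded as well, so the
    estimate holds for all n >= 1 and all bandwidths in (0, 1] [uniform_risk].
    Clipping to an interval that contains sigma^2 decreases the error
    [clip_contraction], and the bandwidth of the last claim balances the two
    terms [rate_balance]. *)

(** * Quadratic forms *)

Section quadratic_forms.
Context (R : realType).

Definition dotp m (x y : 'rV[R]_m) : R := \sum_j x 0 j * y 0 j.

Lemma dotpC m (x y : 'rV[R]_m) : dotp x y = dotp y x.
Proof. by apply: eq_bigr => j _; rewrite mulrC. Qed.

Lemma dotpDr m (x y z : 'rV[R]_m) : dotp x (y + z) = dotp x y + dotp x z.
Proof. by rewrite -big_split; apply: eq_bigr => j _; rewrite mxE mulrDr. Qed.

Lemma dotpZr m a (x y : 'rV[R]_m) : dotp x (a *: y) = a * dotp x y.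
Proof. by rewrite mulr_sumr; apply: eq_bigr => j _; rewrite mxE mulrCA. Qed.

Lemma dotpDl m (x y z : 'rV[R]_m) : dotp (x + y) z = dotp x z + dotp y z.
Proof. by rewrite ![dotp _ z]dotpC dotpDr. Qed.

Lemma dotpZl m a (x y : 'rV[R]_m) : dotp (a *: x) y = a * dotp x y.
Proof. by rewrite ![dotp _ y]dotpC dotpZr. Qed.

Lemma dotpNr m (x y : 'rV[R]_m) : dotp x (- y) = - dotp x y.
Proof. by rewrite -scaleN1r dotpZr mulN1r. Qed.

Lemma dotp0r m (x : 'rV[R]_m) : dotp x 0 = 0.
Proof. by rewrite -(scale0r (0 : 'rV[R]_m)) dotpZr mul0r. Qed.

Lemma dotp_ge0 m (x : 'rV[R]_m) : 0 <= dotp x x.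
Proof. by apply: sumr_ge0 => j _; rewrite -expr2 sqr_ge0. Qed.

Lemma dotp_eq0 m (x : 'rV[R]_m) : (dotp x x == 0) = (x == 0).
Proof.
apply/eqP/eqP => [/eqP|->]; last by rewrite dotp0r.
rewrite psumr_eq0; last by move=> j _; rewrite -expr2 sqr_ge0.
move=> /allP x0; apply/rowP => j; rewrite mxE.
by have := x0 j (mem_index_enum _); rewrite mulf_eq0 orbb => /eqP.
Qed.

Lemma dotp_gt0 m (x : 'rV[R]_m) : x != 0 -> 0 < dotp x x.
Proof. by move=> x0; rewrite lt0r dotp_eq0 x0 dotp_ge0. Qed.

Lemma dotp_mulmx m (A : 'M[R]_m) (x y : 'rV[R]_m) :
  dotp (x *m A) y = dotp x (y *m A^T).
Proof.
transitivity ((x *m A *m y^T) 0 0).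
  by rewrite [RHS]mxE; apply: eq_bigr => j _; rewrite [y^T _ _]mxE.
by rewrite -mulmxA mxE; apply: eq_bigr => j _; rewrite -[A in A *m _]trmxK -trmx_mul [_^T _ _]mxE.
Qed.

Lemma dotp_CS m (x y : 'rV[R]_m) : dotp x y ^+ 2 <= dotp x x * dotp y y.
Proof.
have [->|y0] := eqVneq y 0; first by rewrite !dotp0r expr0n/= mulr0.
have yy := dotp_gt0 y0.
have := dotp_ge0 (dotp y y *: x + (- dotp x y) *: y).
rewrite !(dotpDl, dotpDr, dotpZl, dotpZr) (dotpC y x) => H.
have : 0 <= dotp y y * (dotp x x * dotp y y - dotp x y ^+ 2).
  by apply: le_trans H _; rewrite le_eqVlt; apply/orP; left; apply/eqP; ring.
by rewrite pmulr_rge0// subr_ge0.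
Qed.

Lemma dotp_continuous m (A : 'M[R]_m) :
  continuous (fun x : 'rV[R]_m => dotp (x *m A) x).
Proof.
have -> : (fun x : 'rV[R]_m => dotp (x *m A) x) =
    (fun x => \sum_(j < m) \sum_(i < m) x 0 i * A i j * x 0 j).
  apply/funext => x; apply: eq_bigr => j _; rewrite mxE mulr_suml.
  by apply: eq_bigr => i _.
have sumc (F : 'I_m -> 'rV[R]_m -> R) : (forall i, continuous (F i)) ->
    continuous (fun x => \sum_(i < m) F i x).
  move=> cF; elim: (index_enum _) => [|i s IH] x.
    by under eq_fun do rewrite big_nil; exact: cst_continuous.
  under eq_fun do rewrite big_cons.
  by apply: (@continuousD _ _ _ (F i)); [exact: cF|exact: IH].
apply: (sumc) => j; apply: (sumc) => i x.
apply: (@continuousM _ _ (fun x : 'rV[R]_m => x 0 i * A i j)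
  (fun x : 'rV[R]_m => x 0 j)); last exact: coord_continuous.
apply: (@continuousM _ _ (fun x : 'rV[R]_m => x 0 i) (fun=> A i j)).
  exact: coord_continuous.
exact: cst_continuous.
Qed.

(** The first-order condition at a minimum of the Rayleigh quotient says
    that the minimizer is an eigenvector, whose eigenvalue is the minimum. *)
Lemma rayleigh_min m (A : 'M[R]_m) : (0 < m)%N -> A^T = A ->
  exists a (v : 'rV[R]_m), [/\ v != 0, v *m A = a *: v &
    forall x, a * dotp x x <= dotp (x *m A) x].
Proof.
move=> m0 sA.
pose S := [set x : 'rV[R]_m | dotp x x = 1].
have dotp1 x : dotp x x = dotp (x *m 1%:M) x by rewrite mulmx1.
have bS : bounded_set S.
  exists 1; split; first exact: num_real.
  move=> M M1 x Sx; rewrite /= in Sx.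
  have xj j : `|x 0 j| <= 1.
    rewrite -(@expr_le1 _ 2)// real_normK ?num_real//.
    rewrite -Sx /dotp (bigD1 j)//= -expr2 lerDl.
    by apply: sumr_ge0 => k _; rewrite -expr2 sqr_ge0.
  apply: le_trans (ltW M1); rewrite [leLHS]/Num.norm/= mx_normrE.
  by apply: bigmax_le => // -[i j] _; rewrite (ord1 i).
have cS : closed S.
  rewrite (_ : S = (fun x : 'rV[R]_m => dotp (x *m 1%:M) x) @^-1` [set 1]).
    apply: closed_comp; first by move=> x _; exact: dotp_continuous.
    exact: closed_eq.
  by apply/seteqP; split => x /=; rewrite -dotp1.
have S0 : S !=set0.
  exists (delta_mx 0 (Ordinal m0)); rewrite /S/= /dotp (bigD1 (Ordinal m0))//=.
  rewrite !mxE !eqxx mulr1 big1 ?addr0// => k kn.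
  by rewrite !mxE (negbTE kn) andbF mulr0.
have [|v] := compact_EVT_min S0 (bounded_closed_compact bS cS)
    (f := fun x : 'rV[R]_m => dotp (x *m A) x).
  by apply: continuous_subspaceT; exact: dotp_continuous.
rewrite inE => vS vmin; rewrite /S/= in vS.
pose a := dotp (v *m A) v.
have minA x : a * dotp x x <= dotp (x *m A) x.
  have [->|x0] := eqVneq x 0; first by rewrite !dotp0r mulr0.
  have xx := dotp_gt0 x0.
  pose t := (Num.sqrt (dotp x x))^-1.
  have t2 : t ^+ 2 = (dotp x x)^-1 by rewrite exprVn sqr_sqrtr ?ltW.
  have := vmin (t *: x); rewrite inE /S/= dotpZl dotpZr mulrA -expr2 t2.
  rewrite mulVf ?gt_eqF// => /(_ erefl).
  rewrite -scalemxAl dotpZl dotpZr mulrA -expr2 t2 -/a.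
  by rewrite mulrC ler_pdivlMr.
exists a, v; split => //.
  by apply/eqP => v0; move: vS; rewrite v0 dotp0r => /esym/eqP; rewrite oner_eq0.
pose B := A - a%:M.
have xB x : x *m B = x *m A - a *: x by rewrite mulmxBr mul_mx_scalar.
have sB : B^T = B by rewrite /B linearB/= sA tr_scalar_mx.
have qB x : 0 <= dotp (x *m B) x.
  by rewrite xB dotpDl -scaleNr dotpZl mulNr subr_ge0.
have vB : dotp (v *m B) v = 0.
  by rewrite xB dotpDl -scaleNr dotpZl vS mulr1 subrr.
pose y := v *m B.
suff : y == 0 by rewrite /y xB subr_eq0 => /eqP.
rewrite -dotp_eq0; apply/eqP/le_anti; rewrite dotp_ge0 andbT.
set s := dotp y y; set r := dotp (y *m B) y.
have r0 : 0 <= r by exact: qB.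
have s0 : 0 <= s by exact: dotp_ge0.
(* the quadratic polynomial t |-> 2 t s + t^2 r is nonnegative *)
have H t : 0 <= 2 * t * s + t ^+ 2 * r.
  have := qB (v + t *: y); rewrite mulmxDl -scalemxAl.
  rewrite !(dotpDl, dotpDr, dotpZl, dotpZr) vB -/y.
  rewrite -/s -/r => H; have ys : dotp (y *m B) v = s by rewrite dotp_mulmx sB.
  apply: le_trans H _; rewrite ys le_eqVlt; apply/orP; left; apply/eqP.
  by ring.
have r1 : 0 < r + 1 by rewrite ltr_wpDl.
have := H (- s / (r + 1)).
have -> : 2 * (- s / (r + 1)) * s + (- s / (r + 1)) ^+ 2 * r =
   - (s ^+ 2 * ((r + 2) / (r + 1) ^+ 2)) by field; rewrite gt_eqF.
have q0 : 0 < (r + 2) / (r + 1) ^+ 2 by apply: divr_gt0; [lra|exact: exprn_gt0].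
rewrite oppr_ge0 (pmulr_lle0 _ q0).
move=> s2; have : s ^+ 2 == 0 by rewrite eq_le s2 sqr_ge0.
by rewrite sqrf_eq0 => /eqP ->.
Qed.

(** Eigenvectors are test vectors for one direction; the minimizer of the
    Rayleigh quotient is an eigenvector for the other. *)
Lemma le_lambda_min m (A : 'M[R]_m) k : (0 < m)%N -> A^T = A ->
  (k <= lambda_min A) <-> (forall x, k * dotp x x <= dotp (x *m A) x).
Proof.
move=> m0 sA; have [a [v [v0 vA minA]]] := rayleigh_min m0 sA.
have ev : eigenvalue A a by apply/eigenvalueP; exists v.
have lb b : eigenvalue A b -> a <= b.
  move=> /eigenvalueP[w wA w0]; have := minA w; rewrite wA dotpZl.
  by rewrite ler_pM2r// dotp_gt0.
have -> : lambda_min A = a.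
  apply/le_anti/andP; split; last by apply: lb_le_inf; [exists a|move=> b /lb].
  by apply: ge_inf => //; exists a => b /lb.
split=> [ka x|H]; first by apply: le_trans (minA x); rewrite ler_wpM2r ?dotp_ge0.
by have := H v; rewrite vA dotpZl ler_pM2r ?dotp_gt0.
Qed.

End quadratic_forms.

(** * Polynomials of bounded degree and polynomial features *)

Section polynomials.
Context (R : realType) (d : nat).
Implicit Types (p : mpoly.mpoly d R) (F G : 'rV[R]_d -> R) (x u : 'rV[R]_d).

Lemma row_norm_le u (c : R) : 0 <= c -> (`|u| <= c) <-> (forall j, `|u 0 j| <= c).
Proof.
move=> c0; rewrite [leLHS]/Num.norm/= mx_normrE; split.
  move=> H j; apply: le_trans H.
  by apply: (le_bigmax _ (fun ij : 'I_1 * 'I_d => `|u ij.1 ij.2|) (0, j)).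
by move=> H; apply: bigmax_le => // -[i j] _; rewrite (ord1 i).
Qed.

Lemma coord_norm_le u j : `|u 0 j| <= `|u|.
Proof. by have /row_norm_le : `|u| <= `|u| by []; apply. Qed.

Definition evalp p x : R := mpoly.meval (fun j => x 0 j) p.

Definition polydeg m F := exists2 p, (mpoly.msize p <= m.+1)%N & F =1 evalp p.

Lemma polydegW m k F : (m <= k)%N -> polydeg m F -> polydeg k F.
Proof. by move=> mk [p pm Fp]; exists p => //; apply: leq_trans pm _. Qed.

Lemma polydeg_eq m F G : F =1 G -> polydeg m F -> polydeg m G.
Proof. by move=> FG [p pm Fp]; exists p => // x; rewrite -FG. Qed.

Lemma polydeg_cst m c : polydeg m (fun=> c).
Proof.
exists (mpoly.mpolyC d c); last by move=> x; rewrite /evalp mpoly.mevalC.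
by rewrite mpoly.msizeC; case: (c != 0).
Qed.

Lemma polydegD m F G : polydeg m F -> polydeg m G ->
  polydeg m (fun x => F x + G x).
Proof.
move=> [p pm Fp] [q qm Gq]; exists (p + q).
  by apply: leq_trans (mpoly.msizeD_le _ _) _; rewrite geq_max pm qm.
by move=> x; rewrite /evalp mpoly.mevalD Fp Gq.
Qed.

Lemma polydegM m k F G : polydeg m F -> polydeg k G ->
  polydeg (m + k) (fun x => F x * G x).
Proof.
move=> [p pm Fp] [q qm Gq]; exists (p * q); last first.
  by move=> x; rewrite /evalp mpoly.mevalM Fp Gq.
have [->|p0] := eqVneq p 0; first by rewrite mul0r mpoly.msize0.
have [->|q0] := eqVneq q 0; first by rewrite mulr0 mpoly.msize0.
rewrite mpoly.msizeM//; have := leq_add pm qm; rewrite addSn addnS.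
by case: (mpoly.mmeasure _ p + _)%N.
Qed.

Lemma polydegZ m c F : polydeg m F -> polydeg m (fun x => c * F x).
Proof. by move=> pF; rewrite -[m]add0n; apply: polydegM pF; exact: polydeg_cst. Qed.

Lemma polydeg_coord j : polydeg 1 (fun x => x 0 j).
Proof.
exists (mpoly.mpolyX R (mpoly.mnm1 j)); last by move=> x; rewrite /evalp mpoly.mevalXU.
by rewrite mpoly.msizeX mpoly.mdeg1.
Qed.

Lemma polydeg_sum (I : Type) (s : seq I) (P : pred I) m (F : I -> 'rV[R]_d -> R) :
  (forall i, P i -> polydeg m (F i)) -> polydeg m (fun x => \sum_(i <- s | P i) F i x).
Proof.
move=> H; elim: s => [|i s IH].
  by apply: polydeg_eq (polydeg_cst m 0) => x; rewrite big_nil.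
have [Pi|nPi] := boolP (P i).
  by apply: polydeg_eq (polydegD (H i Pi) IH) => x; rewrite big_cons Pi.
by apply: polydeg_eq IH => x; rewrite big_cons (negbTE nPi).
Qed.

Lemma polydeg_exp m F n : polydeg m F -> polydeg (m * n) (fun x => F x ^+ n).
Proof.
move=> pF; elim: n => [|n IH].
  by rewrite muln0; exact: polydeg_cst.
rewrite mulnS; apply: polydeg_eq (polydegM pF IH) => x.
by rewrite exprS.
Qed.

Lemma polydeg_prod (I : Type) (s : seq I) (m : I -> nat) (F : I -> 'rV[R]_d -> R) :
  (forall i, polydeg (m i) (F i)) ->
  polydeg (\sum_(i <- s) m i) (fun x => \prod_(i <- s) F i x).
Proof.
move=> H; elim: s => [|i s IH].
  by apply: polydeg_eq (polydeg_cst _ 1) => x; rewrite big_nil.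
rewrite big_cons; apply: polydeg_eq (polydegM (H i) IH) => x.
by rewrite big_cons.
Qed.

(** Expand F in monomials: each of them becomes a product of at most m functions
    of degree one. *)
Lemma polydeg_comp m F (G : 'I_d -> 'rV[R]_d -> R) :
  polydeg m F -> (forall j, polydeg 1 (G j)) ->
  polydeg m (fun x => F (\row_j G j x)).
Proof.
move=> [p pm Fp] pG.
apply: (@polydeg_eq _ (fun x => \sum_(k <- mpoly.msupp p)
    mpoly.mcoeff k p * \prod_j G j x ^+ (mpoly.fun_of_multinom k j))).
  move=> x; rewrite Fp /evalp mpoly.mevalE; apply: eq_bigr => k _.
  by congr (_ * _); apply: eq_bigr => j _; rewrite mxE.
have -> : (fun x => \sum_(k <- mpoly.msupp p)
    mpoly.mcoeff k p * \prod_j G j x ^+ (mpoly.fun_of_multinom k j)) =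
  (fun x => \sum_(k <- mpoly.msupp p | k \in mpoly.msupp p)
    mpoly.mcoeff k p * \prod_j G j x ^+ (mpoly.fun_of_multinom k j)).
  by apply/funext => x; rewrite -big_seq.
apply: polydeg_sum => k ks; apply: polydegZ.
apply: (@polydegW (\sum_j 1 * mpoly.fun_of_multinom k j)).
  have := mpoly.msize_mdeg_lt ks; rewrite mpoly.mdegE => H.
  by rewrite -ltnS; apply: leq_trans pm; under eq_bigr do rewrite mul1n.
by apply: polydeg_prod => j; apply: polydeg_exp.
Qed.

(** On the cube, being bounded and Lipschitz is stable under sums and products. *)
Definition lip_cube F := exists2 L : R, 0 <= L &
  (forall u, unit_cube u -> `|F u| <= L) /\
  (forall u u', unit_cube u -> unit_cube u' -> `|F u - F u'| <= L * `|u - u'|).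

Lemma lip_cst c : lip_cube (fun=> c).
Proof.
by exists `|c| => //; split=> [//|u u' _ _]; rewrite subrr normr0 mulr_ge0.
Qed.

Lemma lip_coord j : lip_cube (fun u => u 0 j).
Proof.
exists 1 => //; split=> [u /(_ j)/andP[u0 u1]|u u' _ _].
  by rewrite ger0_norm.
by rewrite mul1r; have := coord_norm_le (u - u') j; rewrite !mxE.
Qed.

Lemma lipD F G : lip_cube F -> lip_cube G -> lip_cube (fun u => F u + G u).
Proof.
move=> [L L0 [FL FL']] [M M0 [GM GM']]; exists (L + M); first exact: addr_ge0.
split=> [u cu|u u' cu cu'].
  by apply: le_trans (ler_normD _ _) _; rewrite lerD ?FL ?GM.
rewrite mulrDl opprD addrACA; apply: le_trans (ler_normD _ _) _.
by rewrite lerD ?FL' ?GM'.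
Qed.

Lemma lipM F G : lip_cube F -> lip_cube G -> lip_cube (fun u => F u * G u).
Proof.
move=> [L L0 [FL FL']] [M M0 [GM GM']].
exists (2 * (L * M)); first by rewrite !mulr_ge0.
have LM : 0 <= L * M by rewrite mulr_ge0.
split=> [u cu|u u' cu cu'].
  rewrite normrM; apply: (@le_trans _ _ (L * M)); last lra.
  by rewrite ler_pM ?FL ?GM.
have -> : F u * G u - F u' * G u' = F u * (G u - G u') + (F u - F u') * G u'.
  by ring.
apply: le_trans (ler_normD _ _) _; rewrite !normrM.
have -> : 2 * (L * M) * `|u - u'| = L * (M * `|u - u'|) + (L * `|u - u'|) * M.
  by ring.
by rewrite lerD// ler_pM ?FL ?GM ?FL' ?GM'.
Qed.

Lemma lip_eq F G : F =1 G -> lip_cube F -> lip_cube G.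
Proof. by move=> /funext ->. Qed.

Lemma lip_evalp p : lip_cube (evalp p).
Proof.
have lsum (I : Type) (s : seq I) (H : I -> 'rV[R]_d -> R) :
    (forall i, lip_cube (H i)) -> lip_cube (fun x => \sum_(i <- s) H i x).
  move=> lH; elim: s => [|i s IH].
    by apply: lip_eq (lip_cst 0) => x; rewrite big_nil.
  by apply: lip_eq (lipD (lH i) IH) => x; rewrite big_cons.
have lprod (I : Type) (s : seq I) (H : I -> 'rV[R]_d -> R) :
    (forall i, lip_cube (H i)) -> lip_cube (fun x => \prod_(i <- s) H i x).
  move=> lH; elim: s => [|i s IH].
    by apply: lip_eq (lip_cst 1) => x; rewrite big_nil.
  by apply: lip_eq (lipM (lH i) IH) => x; rewrite big_cons.
apply: lip_eq (lsum _ _ _ (fun k => lipM (lip_cst (mpoly.mcoeff k p))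
  (lprod _ (index_enum 'I_d)
    (fun j u => \prod_(i < mpoly.fun_of_multinom k j) u 0 j) _))).
  move=> u; rewrite /evalp mpoly.mevalE; apply: eq_bigr => k _.
  by congr (_ * _); apply: eq_bigr => j _; rewrite prodr_const card_ord.
by move=> k j; apply: lprod => i; exact: lip_coord.
Qed.

End polynomials.

Lemma digits_inj N n (a b : 'I_n -> nat) :
  (forall j, a j < N)%N -> (forall j, b j < N)%N ->
  (\sum_j a j * N ^ j = \sum_j b j * N ^ j)%N -> a =1 b.
Proof.
elim: n a b => [|n IH] a b aN bN; first by move=> _ [].
rewrite !big_ord_recl !expn0 !muln1.
have shift (f : 'I_n.+1 -> nat) :
    (\sum_(i < n) f (lift ord0 i) * N ^ lift ord0 i =
     N * \sum_(i < n) f (lift ord0 i) * N ^ i)%N.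
  rewrite big_distrr/=; apply: eq_bigr => i _.
  by rewrite /bump/= add1n expnS mulnCA.
rewrite !shift => E.
have N0 : (0 < N)%N by apply: leq_ltn_trans (aN ord0).
have ab0 : a ord0 = b ord0.
  have := congr1 (modn^~ N) E.
  by rewrite /= ![(_ + N * _)%N]addnC ![(N * _)%N]mulnC !modnMDl !modn_small.
move: E; rewrite ab0 => /addnI/eqP; rewrite eqn_pmul2l// => /eqP E.
have IH' := IH (a \o lift ord0) (b \o lift ord0) (fun j => aN _) (fun j => bN _) E.
by move=> j; case: (unliftP ord0 j) => [k ->|->//]; exact: IH'.
Qed.

Section anchors.
Context (R : realType) (d ell : nat).

(** The curve t |-> (t, t^N, t^(N^2), ...) of Kronecker's substitution. *)
Definition kron (N : nat) (t : R) : 'rV[R]_d := \row_j t ^+ (N ^ j)%N.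

(** Kronecker's substitution sends distinct monomials of partial degrees less
    than N to distinct powers of t, so a polynomial vanishing at N^d points of
    the curve is zero. *)
Lemma kron_vanish (p : mpoly.mpoly d R) N (t : 'I_(N ^ d) -> R) :
  (mpoly.msize p <= N)%N -> injective t ->
  (forall a, evalp p (kron N (t a)) = 0) -> p = 0.
Proof.
move=> pN tinj pt.
pose expo (k : mpoly.multinom d) := (\sum_j mpoly.fun_of_multinom k j * N ^ j)%N.
have klt k : k \in mpoly.msupp p -> forall j, (mpoly.fun_of_multinom k j < N)%N.
  move=> ks j; have := mpoly.msize_mdeg_lt ks; rewrite mpoly.mdegE => H.
  apply: leq_trans pN; apply: leq_ltn_trans H.
  by rewrite (bigD1 j)//= leq_addr.
pose P : {poly R} := \sum_(k <- mpoly.msupp p) mpoly.mcoeff k p *: 'X^(expo k).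
have expo_lt k : k \in mpoly.msupp p -> (expo k < N ^ d)%N.
  move=> /klt {}klt; rewrite /expo.
  have H n (f : 'I_n -> nat) : (forall j, f j < N)%N ->
      (\sum_(j < n) f j * N ^ j < N ^ n)%N.
    elim: n f => [|n IH] f fN; first by rewrite big_ord0.
    rewrite big_ord_recr/=; apply: (@leq_trans (N ^ n + f ord_max * N ^ n)).
      by rewrite ltn_add2r; apply: (IH (fun j => f (widen_ord (leqnSn n) j))).
    by rewrite -mulSn expnS leq_mul2r fN orbT.
  exact: H.
have P0 : P = 0.
  apply/eqP; apply: contraT => Pn0.
  have szP : (size P <= N ^ d)%N.
    apply/leq_sizeP => i iN; rewrite /P coef_sum big_seq big1// => k ks.
    rewrite coefZ coefXn; case: eqP => [E|]; last by rewrite mulr0.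
    by have := expo_lt k ks; rewrite ltnNge -E iN.
  have := @max_poly_roots _ P [seq t a | a <- enum 'I_(N ^ d)] Pn0.
  rewrite size_map size_enum_ord.
  have -> : all (root P) [seq t a | a <- enum 'I_(N ^ d)].
    apply/allP => _ /mapP[a _ ->]; rewrite /root -(pt a) /P.
    rewrite horner_sum /evalp mpoly.mevalE; apply/eqP/eq_bigr => k _.
    rewrite hornerZ hornerXn; congr (_ * _); rewrite /expo -prodrXr.
    apply: eq_bigr => j _.
    by rewrite mxE -exprM mulnC.
  rewrite map_inj_uniq ?enum_uniq//= => /(_ isT isT).
  by rewrite ltnNge szP.
apply/mpoly.mpolyP => k; rewrite mpoly.mcoeff0.
have [ks|/mpoly.memN_msupp_eq0//] := boolP (k \in mpoly.msupp p).
have : P`_(expo k) = 0 by rewrite P0 coef0.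
rewrite /P coef_sum (bigD1_seq k) ?mpoly.msupp_uniq//= coefZ coefXn eqxx mulr1.
rewrite big_seq_cond big1 ?addr0// => k' /andP[k's k'k].
rewrite coefZ coefXn; case: eqP => [E|]; last by rewrite mulr0.
case/negP: k'k; apply/eqP/mpoly.mnmP => j.
by apply: (digits_inj (klt _ k's) (klt _ ks)).
Qed.

Variable psi : 'I_(qdim d ell) -> mpoly.mpoly d R.

Definition feat (u : 'rV[R]_d) : 'rV[R]_(qdim d ell) := \row_k evalp (psi k) u.

Lemma dotp_feat c u : dotp c (feat u) = evalp (\sum_k c 0 k *: psi k) u.
Proof.
rewrite /evalp /dotp (@raddf_sum _ _ (mpoly.meval _)).
apply: eq_bigr => k _; rewrite mxE; exact/esym/mpoly.mevalZ.
Qed.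

Lemma feat_lip : exists2 L : R, 0 <= L &
  (forall u, unit_cube u -> dotp (feat u) (feat u) <= L ^+ 2) /\
  (forall u u', unit_cube u -> unit_cube u' ->
     dotp (feat u - feat u') (feat u - feat u') <= L ^+ 2 * `|u - u'| ^+ 2).
Proof.
have /choice[L HL] : forall k, exists L : R, [/\ 0 <= L,
    (forall u, unit_cube u -> `|evalp (psi k) u| <= L) &
    (forall u u', unit_cube u -> unit_cube u' ->
       `|evalp (psi k) u - evalp (psi k) u'| <= L * `|u - u'|)].
  by move=> k; have [L L0 [H1 H2]] := lip_evalp (psi k); exists L.
exists (\sum_k L k); first by apply: sumr_ge0 => k _; case: (HL k).
have L0 k : 0 <= L k by case: (HL k).
have sq : \sum_k L k ^+ 2 <= (\sum_k L k) ^+ 2.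
  rewrite [leRHS]expr2 mulr_suml; apply: ler_sum => k _.
  rewrite expr2 ler_wpM2l// (bigD1 k)//= lerDl.
  exact: sumr_ge0.
split=> [u cu|u u' cu cu'].
  apply: le_trans sq; apply: ler_sum => k _; rewrite mxE -expr2.
  rewrite -real_normK ?num_real// lerXn2r ?nnegrE//.
  by case: (HL k) => _ H _; exact: H.
apply: (@le_trans _ _ ((\sum_k L k ^+ 2) * `|u - u'| ^+ 2)); last first.
  by rewrite ler_wpM2r// sqr_ge0.
rewrite mulr_suml; apply: ler_sum => k _; rewrite !mxE -expr2 -exprMn.
rewrite -real_normK ?num_real// lerXn2r ?nnegrE ?mulr_ge0//.
by case: (HL k) => _ _ H; exact: H.
Qed.

Hypothesis hpsi : polynomial_basis psi.

(** Evaluation at finitely many points of the Kronecker curve is injective on the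
    polynomials of degree at most ell, hence bounded below; this persists near
    these points, because polynomials are Lipschitz on the cube. *)
Lemma anchors : exists (m : nat) (u : 'I_m -> 'rV[R]_d) (eta0 k0 : R),
  [/\ (qdim d ell <= m)%N, 0 < eta0, 0 < k0,
      (forall a j, 0 <= u a 0 j /\ u a 0 j + eta0 <= 1) &
      forall u' : 'I_m -> 'rV[R]_d, (forall a, unit_cube (u' a)) ->
        (forall a, `|u a - u' a| <= eta0) ->
        forall c, k0 * dotp c c <= \sum_a dotp c (feat (u' a)) ^+ 2].
Proof.
case: hpsi => psi_size psi_basis.
pose N := ell.+1; pose m := (N ^ d)%N.
pose t (a : 'I_m) : R := a.+1%:R / m.+1%:R.
have m1 : (0 : R) < m.+1%:R by rewrite ltr0n.
have t_inj : injective t.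
  move=> a b /(mulIf _) E; apply/val_inj; apply/eqP.
  rewrite -eqSS -(eqr_nat R); apply/eqP/E.
  by rewrite invr_eq0 gt_eqF.
pose u a := kron N (t a).
have t0 a : 0 <= t a by rewrite divr_ge0.
have t1 a : t a + m.+1%:R^-1 <= 1.
  rewrite /t -[X in _ + X]mul1r -mulrDl ler_pdivrMr// mul1r natr1 ler_nat.
  by rewrite ltnS.
have t1' a : t a <= 1.
  by apply: le_trans (t1 a); rewrite lerDl invr_ge0.
have ut a j : 0 <= u a 0 j <= t a.
  rewrite mxE exprn_ge0//= -[leRHS]expr1 ler_wiXn2l ?t0 ?t1'// expn_gt0.
  by [].
pose A : 'M[R]_(qdim d ell, m) := \matrix_(k, a) feat (u a) 0 k.
have cA c a : (c *m A) 0 a = dotp c (feat (u a)).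
  by rewrite mxE; apply: eq_bigr => k _; rewrite [A _ _]mxE.
have A_free : row_free A.
  apply: inj_row_free => c cA0.
  have p0 : \sum_k c 0 k *: psi k = 0.
    apply: (kron_vanish (t := t) _ t_inj).
      apply: leq_trans (mpoly.msize_sum _ _ _) _; apply/bigmax_leqP => k _.
      by apply: leq_trans (mpoly.msizeZ_le _ _) _.
    by move=> a; rewrite -dotp_feat -cA cA0 mxE.
  have [|c0 [_ cU]] := psi_basis 0; first by rewrite mpoly.msize0.
  have -> : c = c0 by rewrite (cU c)// p0.
  by rewrite (cU 0)//; rewrite big1// => k _; rewrite mxE scale0r.
have [B AB] := row_freeP A_free.
pose b0 := 1 + \sum_k \sum_a B a k ^+ 2.
have b0_gt0 : 0 < b0.
  by rewrite ltr_pwDl// sumr_ge0// => k _; rewrite sumr_ge0// => a _; rewrite sqr_ge0.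
have lowA c : dotp c c <= b0 * \sum_a dotp c (feat (u a)) ^+ 2.
  have -> : dotp c c = \sum_k (\sum_a dotp c (feat (u a)) * B a k) ^+ 2.
    apply: eq_bigr => k _; rewrite -expr2; congr (_ ^+ 2).
    rewrite -{1}[c]mulmx1 -AB mulmxA mxE; apply: eq_bigr => a _.
    by rewrite cA.
  set Y := \sum_a dotp c _ ^+ 2.
  have Y0 : 0 <= Y by apply: sumr_ge0 => a _; rewrite sqr_ge0.
  rewrite /b0 mulrDl mul1r mulr_suml ler_wpDl//; apply: ler_sum => k _.
  have := dotp_CS (\row_a dotp c (feat (u a))) (\row_a B a k).
  rewrite /dotp; under eq_bigr do rewrite !mxE.
  under [X in _ <= X * _]eq_bigr do rewrite !mxE -expr2.
  under [X in _ <= _ * X]eq_bigr do rewrite !mxE -expr2.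
  by rewrite mulrC.
have [L L0 [_ HL]] := feat_lip.
pose D := 4 * b0 * m%:R * L ^+ 2 + 1.
have D0 : 0 < D by rewrite ltr_wpDl// !mulr_ge0// ?sqr_ge0// ltW.
pose eta0 := Num.min (m.+1%:R^-1) (Num.min 1 D^-1).
have e0 : 0 < eta0 by rewrite !lt_min invr_gt0 m1 ltr01 invr_gt0.
exists m, u, eta0, (4 * b0)^-1; split => //.
- by rewrite -(eqP A_free); exact: rank_leq_col.
- by rewrite invr_gt0 mulr_gt0.
- move=> a j; case/andP: (ut a j) => u0 u1; split => //.
  by apply: le_trans (t1 a); rewrite lerD// ge_min lexx.
move=> u' cu' uu' c.
set S := \sum_a dotp c (feat (u' a)) ^+ 2.
have cu a : unit_cube (u a).
  move=> j; case/andP: (ut a j) => -> /= H; exact: le_trans (t1' a).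
have cc := dotp_ge0 c.
have pert a : dotp c (feat (u a)) ^+ 2 <=
    2 * dotp c (feat (u' a)) ^+ 2 + 2 * (dotp c c * (L ^+ 2 * D^-1)).
  have := dotp_CS c (feat (u a) - feat (u' a)).
  rewrite dotpDr dotpNr; set x := dotp c (feat (u a)); set y := dotp c _.
  move=> H; have {}H : (x - y) ^+ 2 <= dotp c c * (L ^+ 2 * D^-1).
    apply: le_trans H _; rewrite ler_wpM2l//; apply: le_trans (HL _ _ _ _) _ => //.
    rewrite ler_wpM2l ?sqr_ge0//.
    apply: (@le_trans _ _ eta0); last by rewrite !ge_min lexx !orbT.
    apply: (@le_trans _ _ (eta0 ^+ 2)); first by rewrite lerXn2r ?nnegrE// ltW.
    rewrite expr2 -[leRHS]mulr1 ler_wpM2l ?(ltW e0)//.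
    by rewrite !ge_min lexx orbT.
  have : x ^+ 2 = 2 * y ^+ 2 + 2 * (x - y) ^+ 2 - (x - 2 * y) ^+ 2 by ring.
  by move=> ->; have := sqr_ge0 (x - 2 * y); lra.
have {pert}H : dotp c c <= b0 * (2 * S + 2 * m%:R * (dotp c c * (L ^+ 2 * D^-1))).
  apply: le_trans (lowA c) _; rewrite ler_wpM2l ?(ltW b0_gt0)//.
  apply: le_trans (ler_sum _ (fun a _ => pert a)) _.
  rewrite big_split/= -mulr_sumr -/S sumr_const card_ord -mulr_natl.
  by rewrite le_eqVlt; apply/orP; left; apply/eqP; ring.
have small : 4 * b0 * m%:R * L ^+ 2 * D^-1 <= 1.
  by rewrite ler_pdivrMr// mul1r lerDl.
have S0 : 0 <= S by apply: sumr_ge0 => a _; rewrite sqr_ge0.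
have H2 : dotp c c <= b0 * 2 * S + 2^-1 * dotp c c.
  apply: le_trans H _; rewrite mulrDr; apply: lerD; first by rewrite mulrA.
  have -> : b0 * (2 * m%:R * (dotp c c * (L ^+ 2 * D^-1))) =
    2^-1 * dotp c c * (4 * b0 * m%:R * L ^+ 2 * D^-1) by field; rewrite gt_eqF.
  rewrite -[leRHS]mulr1 ler_wpM2l// mulr_ge0//.
rewrite ler_pdivrMl ?mulr_gt0//; lra.
Qed.

End anchors.

(** * Taylor approximation in Hoelder balls *)

Section taylor_one_coordinate.
Context (R : realType).

Lemma is_derive_taylor_sum n (c : nat -> R) (b t : R) :
  is_derive t 1 (fun t => \sum_(i < n.+1) c i * ((t - b) ^+ i / i`!%:R))
    (\sum_(i < n) c i.+1 * ((t - b) ^+ i / i`!%:R)).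
Proof.
elim: n => [|n IH].
  rewrite big_ord0; under eq_fun do rewrite big_ord1 expr0 fact0 divr1 mulr1.
  exact: is_derive_cst.
under eq_fun do rewrite big_ord_recr/=.
rewrite big_ord_recr/=.
apply: (@is_deriveD _ _ _ _ (fun t => c n.+1 * ((t - b) ^+ n.+1 / n.+1`!%:R))) => //.
have -> : (fun t => c n.+1 * ((t - b) ^+ n.+1 / n.+1`!%:R)) =
    (c n.+1 / n.+1`!%:R) \*: (((id - cst b) : R -> R) ^+ n.+1).
  by apply/funext => u; rewrite !fctE /GRing.scale/= mulrA mulrAC.
have d1 : is_derive t 1 ((id - cst b) : R -> R) (1 - 0).
  by apply: is_deriveB; exact: is_derive_cst.
have := is_deriveZ (c n.+1 / n.+1`!%:R) (is_deriveX n.+1 d1).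
rewrite (_ : _ *: (_ *: _) = c n.+1 * ((t - b) ^+ n / n`!%:R))//.
rewrite subr0 /GRing.scale/= mulr1 factS natrM.
have n0 : n`!%:R != 0 :> R by rewrite pnatr_eq0 -lt0n fact_gt0.
have n1 : n%:R + 1 != 0 :> R by rewrite natr1 pnatr_eq0.
rewrite fctE/= -natr1.
by field; rewrite n0 n1.
Qed.

(** The intermediate point of the mean value theorem is no farther from b than
    t. *)
Lemma mvt_bound (r r' : R -> R) (b t M : R) :
  (forall s : R, 0 <= s <= 1 -> is_derive s 1 r (r' s)) ->
  0 <= b <= 1 -> 0 <= t <= 1 ->
  (forall s : R, 0 <= s <= 1 -> `|s - b| <= `|t - b| -> `|r' s| <= M) ->
  `|r t - r b| <= M * `|t - b|.
Proof.
move=> dr /andP[b0 b1] /andP[t0 t1] HM.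
have cont (x y : R) : 0 <= x -> y <= 1 -> {within `[x, y], continuous r}.
  move=> x0 y1; apply: derivable_within_continuous => s.
  rewrite in_itv/= => /andP[xs sy].
  suff /dr[] : 0 <= s <= 1 by [].
  by rewrite (le_trans x0 xs) (le_trans sy y1).
have [bt|tb] := leP b t.
  have [s|c] := MVT_segment bt _ (cont b t b0 t1) (df := r').
    rewrite in_itv/= => /andP[bs st]; apply: dr.
    by rewrite (le_trans b0 (ltW bs)) (le_trans (ltW st) t1).
  rewrite in_itv/= => /andP[bc ct] ->; rewrite normrM ler_wpM2r// HM//.
    by rewrite (le_trans b0 bc) (le_trans ct t1).
  by rewrite !ger0_norm ?subr_ge0// lerD2r.
have [s|c] := MVT_segment (ltW tb) _ (cont t b t0 b1) (df := r').
  rewrite in_itv/= => /andP[bs st]; apply: dr.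
  by rewrite (le_trans t0 (ltW bs)) (le_trans (ltW st) b1).
rewrite in_itv/= => /andP[bc ct] E; rewrite distrC E normrM distrC.
rewrite ler_wpM2r// HM//.
  by rewrite (le_trans t0 bc) (le_trans ct b1).
by rewrite !(distrC _ b) !ger0_norm ?subr_ge0// ?lerD2l ?lerN2// ltW.
Qed.

End taylor_one_coordinate.

Section taylor.
Context (R : realType) (d : nat).
Implicit Types (x b z : 'rV[R]_d) (F g : 'rV[R]_d -> R).

Definition setc z (j : 'I_d) (t : R) : 'rV[R]_d :=
  \row_k (if k == j then t else z 0 k).

Lemma is_derive_setc F z j t : derivable F (setc z j t) (delta_mx 0 j) ->
  is_derive t 1 (fun t => F (setc z j t)) (partial j F (setc z j t)).
Proof.
have E : (fun h : R => h^-1 *: (((fun t => F (setc z j t)) \o shift t) (h *: 1) -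
      F (setc z j t))) =
    (fun h : R => h^-1 *: ((F \o shift (setc z j t)) (h *: delta_mx 0 j) -
      F (setc z j t))).
  apply/funext => h; congr (_ *: (_ - _)); congr F.
  apply/rowP => k; rewrite !mxE eqxx/=; have [_|kj] := eqVneq k j.
    by rewrite /GRing.scale/=.
  by rewrite mulr0 add0r.
by move=> dF; split; rewrite ?/derivable ?/partial ?/derive E.
Qed.

(** Taylor's formula along one coordinate, with a Hoelder remainder: the
    derivative of the remainder is the remainder of the derivative. *)
Lemma taylor_coordinate m F z (j : 'I_d) (b K alpha : R) :
  0 <= b <= 1 -> 0 <= K -> 0 <= alpha ->
  (forall i (t : R), (i < m)%N -> 0 <= t <= 1 ->
     derivable (iter i (partial j) F) (setc z j t) (delta_mx 0 j)) ->
  (forall t : R, 0 <= t <= 1 ->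
     `|iter m (partial j) F (setc z j t) - iter m (partial j) F (setc z j b)|
       <= K * `|t - b| `^ alpha) ->
  forall t : R, 0 <= t <= 1 ->
  `|F (setc z j t) - \sum_(i < m.+1)
     iter i (partial j) F (setc z j b) * ((t - b) ^+ i / i`!%:R)|
    <= K * (`|t - b| ^+ m * `|t - b| `^ alpha).
Proof.
move=> b01 K0 a0; elim: m F => [|m IH] F dF hF t t01.
  by rewrite big_ord1/= !expr0 fact0 divr1 mulr1 mul1r; exact: hF.
pose c i := iter i (partial j) F (setc z j b).
pose r t := F (setc z j t) - \sum_(i < m.+2) c i * ((t - b) ^+ i / i`!%:R).
pose r' t := partial j F (setc z j t) -
  \sum_(i < m.+1) c i.+1 * ((t - b) ^+ i / i`!%:R).
have dr (s : R) : 0 <= s <= 1 -> is_derive s 1 r (r' s).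
  move=> s01; apply: is_deriveB; last exact: is_derive_taylor_sum.
  by apply: is_derive_setc; exact: (dF 0%N).
have rb : r b = 0.
  rewrite /r big_ord_recl expr0 fact0 divr1 mulr1 big1 ?addr0 ?subrr//.
  by move=> i _; rewrite expr0n/= mul0r mulr0.
have HIH (s : R) : 0 <= s <= 1 -> `|r' s| <= K * (`|s - b| ^+ m * `|s - b| `^ alpha).
  move=> s01; rewrite /r'.
  under eq_bigr do rewrite /c iterSr.
  apply: IH => //.
    by move=> i u im u01; have := dF i.+1 u im u01; rewrite iterSr.
  by move=> u u01; have := hF u u01; rewrite !iterSr.
have := @mvt_bound R r r' b t (K * (`|t - b| ^+ m * `|t - b| `^ alpha)) dr b01 t01.
rewrite rb subr0 => H; apply: le_trans (H _) _.
  move=> s s01 st; apply: le_trans (HIH s s01) _.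
  rewrite ler_wpM2l// ler_pM ?exprn_ge0 ?powR_ge0//.
    by rewrite lerXn2r ?nnegrE.
  by rewrite ge0_ler_powR ?nnegrE.
by rewrite le_eqVlt; apply/orP; left; apply/eqP; rewrite exprSr; ring.
Qed.

Lemma partials_cat (s1 s2 : seq 'I_d) g :
  partials (s1 ++ s2) g = partials s1 (partials s2 g).
Proof. exact: foldr_cat. Qed.

Lemma partials_nseq m (i : 'I_d) g : partials (nseq m i) g = iter m (partial i) g.
Proof. by elim: m => //= m ->. Qed.

Lemma partial_multi_ext (nu nu' : 'I_d -> nat) g :
  nu =1 nu' -> partial_multi nu g = partial_multi nu' g.
Proof.
by move=> E; rewrite /partial_multi; congr (partials (flatten _) g);
  apply: eq_map => j; rewrite E.
Qed.

(** The multi-index partials are taken with the smallest index outermost, so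
    differentiating further along an index below all the others stays within
    them. *)
Lemma partial_multi_set (nu : 'I_d -> nat) (i : 'I_d) m g :
  (forall j : 'I_d, (j <= i)%N -> nu j = 0%N) ->
  partial_multi (fun j => if j == i then m else nu j) g =
  iter m (partial i) (partial_multi nu g).
Proof.
move=> nu0; rewrite /partial_multi.
have := enum_uniq 'I_d; have := mem_enum 'I_d i.
have : sorted ltn (map val (enum 'I_d)) by rewrite val_enum_ord iota_ltn_sorted.
rewrite (sorted_pairwise ltn_trans).
move=> + iin; rewrite inE in iin; case/splitPr: iin => p1 p2.
rewrite map_cat pairwise_cat/= => /and3P[p1i _ _].
rewrite cat_uniq/= => /and4P[_ /norP[ip1 _] ip2 _].
have p1lt j : j \in p1 -> (j < i)%N.
  move=> jp1; move/allrelP : p1i; apply; first exact: map_f.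
  by rewrite inE eqxx.
have fl0 (f : 'I_d -> seq 'I_d) : (forall j, j \in p1 -> f j = [::]) ->
    flatten [seq f j | j <- p1] = [::].
  elim: p1 {p1i ip1 p1lt} => //= j s IHs Hs.
  by rewrite Hs ?mem_head// IHs// => k ks; rewrite Hs// inE ks orbT.
rewrite !map_cat !flatten_cat !fl0; last 2 first.
- by move=> j /p1lt ji; rewrite nu0// ltnW.
- by move=> j /p1lt ji; rewrite ifN ?nu0// 1?ltnW// -val_eqE/= ltn_eqF.
rewrite /= eqxx nu0// partials_cat partials_nseq/=.
congr (iter _ _ (partials (flatten _) _)); apply/eq_in_map => j jp2.
by case: eqVneq => // ji; rewrite -ji jp2 in ip2.
Qed.

Section hoelder.
Variables (ell : nat) (alpha L : R).
Hypotheses (alpha0 : 0 <= alpha) (L0 : 0 <= L).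

(** What Taylor's formula needs of a Hoelder ball, restricted to the cube. *)
Definition smooth g : Prop :=
  (forall (js : seq 'I_d) j x, (size js < ell)%N -> unit_cube x ->
     derivable (partials js g) x (delta_mx 0 j)) /\
  (forall nu : 'I_d -> nat, (\sum_j nu j = ell)%N -> forall x y,
     unit_cube x -> unit_cube y ->
     `|partial_multi nu g x - partial_multi nu g y| <= L * enorm (x - y) `^ alpha).

(** The expansion moves from b to x one coordinate at a time. *)
Definition mixp x b (i : nat) : 'rV[R]_d := \row_k (if (k < i)%N then x 0 k else b 0 k).

Lemma mixp_cube x b i : unit_cube x -> unit_cube b -> unit_cube (mixp x b i).
Proof. by move=> cx cb j; rewrite mxE; case: ifP. Qed.

Lemma setc_cube z j t : unit_cube z -> 0 <= t <= 1 -> unit_cube (setc z j t).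
Proof. by move=> cz t01 k; rewrite mxE; case: ifP. Qed.

Lemma enorm_setc z j t s : enorm (setc z j t - setc z j s) = `|t - s|.
Proof.
rewrite /enorm (bigD1 j)//= big1 ?addr0 ?mxE ?eqxx ?sqrtr_sqr//.
by move=> k kj; rewrite !mxE (negbTE kj) subrr expr0n.
Qed.

Lemma size_multi (nu : 'I_d -> nat) (s : seq 'I_d) :
  size (flatten [seq nseq (nu j) j | j <- s]) = (\sum_(j <- s) nu j)%N.
Proof.
by elim: s => [|j s IH]/=; rewrite ?big_nil// big_cons size_cat size_nseq IH.
Qed.

(** Expanding one coordinate after the other, the last one first, the
    intermediate expansions only involve partials in the order of a
    multi-index. *)
Lemma taylor_mix i : (i <= d)%N -> exists2 C : R, 0 <= C &
  forall g b (nu : 'I_d -> nat) k, smooth g -> unit_cube b ->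
  (forall j : 'I_d, (j < i)%N -> nu j = 0%N) ->
  (\sum_j nu j + k = ell)%N ->
  exists2 P, polydeg k P & forall x, unit_cube x ->
   `|partial_multi nu g (mixp x b i) - P x| <=
     C * (`|x - b| ^+ k * `|x - b| `^ alpha).
Proof.
elim: i => [_|i IH id].
  exists 0 => // g b nu k _ _ _ _.
  exists (fun=> partial_multi nu g b) => [|x _]; first exact: polydeg_cst.
  by rewrite (_ : mixp x b 0 = b) ?subrr ?normr0 ?mul0r//; apply/rowP => j; rewrite mxE.
have [C C0 HC] := IH (ltnW id).
exists (L + ell.+1%:R * C) => [|g b nu k sg cb nu0 nuk].
  by rewrite addr_ge0// mulr_ge0.
pose i' := Ordinal id.
pose nu' m j := if j == i' then m else nu j.
have nu0' (j : 'I_d) : (j <= i')%N -> nu j = 0%N by move=> ji; apply: nu0.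
have nu'E m : partial_multi (nu' m) g = iter m (partial i') (partial_multi nu g).
  exact: partial_multi_set.
have nu'S m : (\sum_j nu' m j = m + \sum_j nu j)%N.
  rewrite [LHS](bigD1 i')//= [in RHS](bigD1 i')//= {1}/nu' eqxx nu0'//.
  rewrite add0n; congr (_ + _)%N.
  by apply: eq_bigr => j ji; rewrite /nu' (negbTE ji).
have /choice[P HP] : forall m : 'I_k.+1, exists P, polydeg (k - m) P /\
    forall x, unit_cube x -> `|iter m (partial i') (partial_multi nu g) (mixp x b i) - P x|
      <= C * (`|x - b| ^+ (k - m) * `|x - b| `^ alpha).
  move=> m; have mk : (m <= k)%N by rewrite -ltnS.
  have [||P pP HP] := HC g b (nu' m) (k - m)%N sg cb.
  - move=> j ji; rewrite /nu' ifN ?nu0//; first exact: ltnW.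
    by rewrite -val_eqE/= ltn_eqF.
  - by rewrite nu'S addnAC subnKC// addnC.
  by exists P; split => // x cx; rewrite -nu'E; exact: HP.
exists (fun x => \sum_(m < k.+1) P m x * ((x 0 i' + - b 0 i') ^+ m * (m`!%:R)^-1)).
  apply: polydeg_sum => m _; have [pP _] := HP m.
  have mk : (m <= k)%N by rewrite -ltnS.
  apply: (@polydegW R d (k - m + m)); first by rewrite subnK.
  apply: polydegM => //.
  have := polydegZ (m`!%:R)^-1 (polydeg_exp m (polydegD (polydeg_coord R i')
     (polydeg_cst d 1 (- b 0 i')))).
  by rewrite mul1n; apply: polydeg_eq => x; rewrite mulrC.
move=> x cx.
have cz := mixp_cube i cx cb.
have E1 : mixp x b i.+1 = setc (mixp x b i) i' (x 0 i').
  apply/rowP => j; rewrite !mxE ltnS leq_eqVlt -val_eqE/=.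
  by case: eqP => // ji; congr (x _ _); exact: val_inj.
have E2 : mixp x b i = setc (mixp x b i) i' (b 0 i').
  apply/rowP => j; rewrite !mxE; case: eqP => // ->.
  by rewrite ltnn.
set N := `|x - b| `^ alpha; have N0 : 0 <= N by exact: powR_ge0.
have xb : `|x 0 i' - b 0 i'| <= `|x - b|.
  by have := coord_norm_le (x - b) i'; rewrite !mxE.
have T1 : `|partial_multi nu g (mixp x b i.+1) - \sum_(m < k.+1)
     iter m (partial i') (partial_multi nu g) (mixp x b i) *
       ((x 0 i' - b 0 i') ^+ m / m`!%:R)| <= L * (`|x - b| ^+ k * N).
  rewrite E1 {2}E2.
  apply: (@le_trans _ _ (L * (`|x 0 i' - b 0 i'| ^+ k * `|x 0 i' - b 0 i'| `^ alpha))).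
    apply: taylor_coordinate => //.
    - move=> m t mk t01; rewrite -partials_nseq /partial_multi -partials_cat.
      apply: sg.1; last exact: setc_cube.
      rewrite size_cat size_nseq size_multi big_enum/=.
      by rewrite -nuk addnC ltn_add2l.
    - move=> t t01; rewrite -nu'E -(enorm_setc (mixp x b i) i' t (b 0 i')).
      apply: sg.2; [|exact: setc_cube..].
      by rewrite nu'S addnC.
  rewrite ler_wpM2l// ler_pM ?exprn_ge0 ?powR_ge0//.
    by rewrite lerXn2r ?nnegrE.
  by rewrite ge0_ler_powR ?nnegrE.
set S := \sum_(m < _) _ in T1; set S' := \sum_(m < _) _.
have T2 : `|S - S'| <= ell.+1%:R * (C * (`|x - b| ^+ k * N)).
  rewrite -sumrB; apply: le_trans (ler_norm_sum _ _ _) _.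
  apply: (@le_trans _ _ (\sum_(m < k.+1) C * (`|x - b| ^+ k * N))).
    apply: ler_sum => m _; rewrite -mulrBl normrM.
    have mk : (m <= k)%N by rewrite -ltnS.
    have [_ /(_ x cx) H] := HP m.
    apply: (@le_trans _ _ (C * (`|x - b| ^+ (k - m) * N) * `|x - b| ^+ m)).
      rewrite ler_pM// normrM normrX -[leRHS]mulr1 ler_pM ?exprn_ge0//.
        by rewrite lerXn2r ?nnegrE.
      rewrite normfV invf_le1 ?normr_gt0 ?pnatr_eq0 -?lt0n ?fact_gt0//.
      by rewrite normr_nat ler1n fact_gt0.
    have -> : `|x - b| ^+ k = `|x - b| ^+ (k - m) * `|x - b| ^+ m.
      by rewrite -exprD subnK.
    by rewrite le_eqVlt; apply/orP; left; apply/eqP; ring.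
  rewrite sumr_const card_ord -[leLHS]mulr_natl ler_wpM2r//.
    by rewrite mulr_ge0// mulr_ge0// exprn_ge0.
  by rewrite ler_nat ltnS -nuk leq_addl.
rewrite -[X in `|X|](subrKA S) mulrDl.
by apply: le_trans (ler_normD _ _) _; rewrite lerD// -mulrA.
Qed.

End hoelder.

Lemma hoelder_ball_smooth U (s L : R) g : @unit_cube R d `<=` U ->
  hoelder_ball U s L g -> smooth (hoelder_ell s) (hoelder_alpha s) L g.
Proof.
move=> cU [[dg _] Lg]; split=> [js j x jl cx|nu nuE x y cx cy].
  by apply: dg => //; exact: cU.
have [->|xy] := eqVneq x y.
  have e0 : enorm (y - y) = 0 :> R.
    by rewrite /enorm big1 ?sqrtr0// => j _; rewrite !mxE subrr expr0n.
  have H : (0 <= hoelder_norm U s g)%E.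
    apply: adde_ge0; first by apply: sume_ge0 => k _; exact: Lnorm_ge0.
    exact: bigmax_ge_id.
  have := le_trans H Lg; rewrite lee_fin => L0.
  by rewrite subrr normr0 mulr_ge0 ?powR_ge0.
have exy : 0 < enorm (x - y).
  rewrite sqrtr_gt0 lt0r psumr_eq0; last by move=> j _; rewrite sqr_ge0.
  rewrite sumr_ge0 ?andbT; last by move=> j _; rewrite sqr_ge0.
  apply: contraNN xy => /allP H; apply/eqP/rowP => j.
  have := H j (mem_index_enum _); rewrite sqrf_eq0 !mxE subr_eq0.
  by move/eqP.
rewrite -ler_pdivrMr ?powR_gt0//.
have nul j : (nu j < (hoelder_ell s).+1)%N.
  by rewrite ltnS -nuE (bigD1 j)//= leq_addr.
pose nu' : {ffun 'I_d -> 'I_(hoelder_ell s).+1} := [ffun j => Ordinal (nul j)].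
rewrite -lee_fin; apply: le_trans Lg.
rewrite /hoelder_norm; apply: le_trans (leeDr _ _); last first.
  by apply: sume_ge0 => k _; exact: Lnorm_ge0.
apply: (@le_trans _ _ (ereal_sup [set r | exists x y, [/\ U x, U y, x <> y &
        r = (`|partial_multi (fun j => nu' j) g x
               - partial_multi (fun j => nu' j) g y|
             / enorm (x - y) `^ hoelder_alpha s)%:E]])).
  apply: ereal_sup_ubound; exists x, y; split; [exact: cU..|exact/eqP|].
  have nuE' : nu =1 (fun j => nu' j) by move=> j; rewrite ffunE.
  by rewrite !(partial_multi_ext _ nuE').
apply: (@le_bigmax_cond _ _ _ _ _ (fun nu : {ffun 'I_d -> 'I_(hoelder_ell s).+1} => _)).
by apply/eqP/(etrans _ nuE)/eq_bigr => j _; rewrite ffunE.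
Qed.

(** [taylor_mix] once all the coordinates are expanded, from the multi-index 0. *)
Lemma hoelder_taylor U (s L : R) : 1 < s -> 0 <= L -> @unit_cube R d `<=` U ->
  exists2 C : R, 0 <= C & forall g b, hoelder_ball U s L g -> unit_cube b ->
  exists2 P, polydeg (hoelder_ell s) P &
    forall x, unit_cube x -> `|g x - P x| <= C * `|x - b| `^ s.
Proof.
move=> s1 L0 cU.
have a0 : 0 <= hoelder_alpha s.
  rewrite /hoelder_alpha /hoelder_ell subr_ge0.
  have cs : 0 < Num.ceil s by rewrite ceil_gt0; exact: lt_trans s1.
  case: (Num.ceil s) cs (ceilB1_lt s) => // -[|n]// _ /= H.
  by rewrite ltW//; move: H; rewrite -addn1 PoszD addrK.
have [C C0 HC] := taylor_mix (hoelder_ell s) a0 L0 (leqnn d).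
exists C => // g b gU cb.
have [||P pP HP] := HC g b (fun=> 0%N) (hoelder_ell s) (hoelder_ball_smooth cU gU) cb.
- by [].
- by rewrite big1.
exists P => // x cx; have := HP x cx.
have -> : mixp x b d = x by apply/rowP => j; rewrite mxE ltn_ord.
have -> : partial_multi (fun=> 0%N) g = g.
  rewrite /partial_multi; set l := flatten _; suff -> : l = [::] by [].
  by apply/size0nil; rewrite size_multi big1.
rewrite -powR_mulrn// -powRD ?subrKC//.
by case: eqP => //= s0; rewrite s0 ltr10 in s1.
Qed.

End taylor.

(** * Residual contrasts of least squares *)

Lemma normr_le_sqr (R : realType) (a b : R) : 0 <= b -> a ^+ 2 <= b ^+ 2 -> `|a| <= b.
Proof.
by move=> b0 ab; rewrite -ler_sqr ?nnegrE// real_normK ?num_real.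
Qed.

Section least_squares.
Context (R : realType) (q n : nat) (A : {set 'I_n}) (phi : 'I_n -> 'rV[R]_q).
Variables (i1 i2 : 'I_n).

Definition fgram : 'M[R]_q := \sum_(i in A) (phi i)^T *m phi i.

Lemma dotp_suml (I : finType) (P : pred I) m (F : I -> 'rV[R]_m) y :
  dotp (\sum_(i | P i) F i) y = \sum_(i | P i) dotp (F i) y.
Proof.
rewrite /dotp exchange_big/=; apply: eq_bigr => j _.
by rewrite summxE mulr_suml.
Qed.

Lemma mul_fgram c : c *m fgram = \sum_(i in A) dotp c (phi i) *: phi i.
Proof.
rewrite /fgram mulmx_sumr; apply: eq_bigr => i _; apply/rowP => k.
rewrite mulmxA !mxE big_ord1 !mxE; congr (_ * _).
by apply: eq_bigr => j _; rewrite mxE.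
Qed.

Lemma dotp_fgram c c' :
  dotp (c *m fgram) c' = \sum_(i in A) dotp c (phi i) * dotp c' (phi i).
Proof.
rewrite mul_fgram dotp_suml; apply: eq_bigr => i _.
by rewrite dotpZl (dotpC _ c').
Qed.

Lemma fgram_sym : fgram^T = fgram.
Proof.
rewrite /fgram linear_sum/=; apply: eq_bigr => i _.
by rewrite trmx_mul trmxK.
Qed.

Definition delta := phi i1 - phi i2.
Definition lscoef := delta *m invmx fgram.
Definition ind2 i : R := (i == i1)%:R - (i == i2)%:R.
Definition resid i := ind2 i - dotp lscoef (phi i).

Hypotheses (i1A : i1 \in A) (i2A : i2 \in A).

Lemma sum_ind2 (f : 'I_n -> R) : \sum_(i in A) ind2 i * f i = f i1 - f i2.
Proof.
under eq_bigr do rewrite mulrBl.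
rewrite sumrB; congr (_ - _).
  rewrite (bigD1 i1)//= eqxx mul1r big1 ?addr0// => i /andP[_ /negbTE ->].
  by rewrite mul0r.
rewrite (bigD1 i2)//= eqxx mul1r big1 ?addr0// => i /andP[_ /negbTE ->].
by rewrite mul0r.
Qed.

Variable K : R.
Hypotheses (K0 : 0 < K)
  (low : forall c, K * dotp c c <= \sum_(i in A) dotp c (phi i) ^+ 2).

Lemma low_fgram c : K * dotp c c <= dotp (c *m fgram) c.
Proof.
by rewrite dotp_fgram; apply: le_trans (low c) _; under [leRHS]eq_bigr do rewrite -expr2.
Qed.

Lemma fgram_unit : fgram \in unitmx.
Proof.
rewrite -row_free_unit; apply: inj_row_free => c cG.
have := low_fgram c; rewrite cG (dotpC 0) dotp0r pmulr_rle0// => H.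
by apply/eqP; rewrite -dotp_eq0 eq_le H dotp_ge0.
Qed.

Lemma lscoefK : lscoef *m fgram = delta.
Proof. by rewrite /lscoef -mulmxA mulVmx ?mulmx1 ?fgram_unit. Qed.

(** The normal equations of least squares. *)
Lemma resid_orth c : \sum_(i in A) resid i * dotp c (phi i) = 0.
Proof.
under eq_bigr do rewrite mulrBl.
rewrite sumrB (sum_ind2 (fun i => dotp c (phi i))) -dotp_fgram lscoefK.
by rewrite -dotpNr -dotpDr dotpC subrr.
Qed.

(** The residual vector is the projection of e_i1 - e_i2, so that its squared
    norm is its inner product with e_i1 - e_i2. *)
Lemma resid_sq : \sum_(i in A) resid i ^+ 2 = resid i1 - resid i2.
Proof.
rewrite -(sum_ind2 resid) -[RHS]subr0.
rewrite -[X in _ = _ - X](resid_orth lscoef) -sumrB.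
by apply: eq_bigr => i _; rewrite {2}/resid /resid; ring.
Qed.

(** Cauchy-Schwarz against the lower bound on the Gram matrix. *)
Lemma lscoef_le : K ^+ 2 * dotp lscoef lscoef <= dotp delta delta.
Proof.
have [->|c0] := eqVneq lscoef 0; first by rewrite dotp0r mulr0 dotp_ge0.
have cc := dotp_gt0 c0.
have H1 := low_fgram lscoef; rewrite lscoefK in H1.
have := dotp_CS delta lscoef => H2.
rewrite -(ler_pM2r cc); apply: le_trans H2.
have -> : K ^+ 2 * dotp lscoef lscoef * dotp lscoef lscoef =
  (K * dotp lscoef lscoef) ^+ 2 by ring.
by rewrite lerXn2r ?nnegrE//; [rewrite mulr_ge0 ?ltW| apply: le_trans H1; rewrite mulr_ge0 ?ltW].
Qed.

Lemma dotp_lscoef y (a b : R) : 0 <= a -> 0 <= b ->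
  dotp delta delta <= a ^+ 2 -> dotp y y <= b ^+ 2 -> `|dotp lscoef y| <= a * b / K.
Proof.
move=> a0 b0 da yb; apply: normr_le_sqr; first by rewrite divr_ge0 ?mulr_ge0// ltW.
apply: le_trans (dotp_CS _ _) _; rewrite expr_div_n ler_pdivlMr ?exprn_gt0//.
rewrite mulrAC exprMn; apply: ler_pM => //.
- by apply: mulr_ge0; [exact: dotp_ge0|exact: sqr_ge0].
- exact: dotp_ge0.
- by apply: le_trans da; rewrite mulrC lscoef_le.
Qed.

(** When the two regressors are close, the projection hardly shortens the
    vector e_i1 - e_i2, of squared norm 2. *)
Lemma resid_sq_ge (a : R) : 0 <= a -> i1 != i2 -> dotp delta delta <= a ^+ 2 ->
  2 - a ^+ 2 / K <= resid i1 - resid i2.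
Proof.
move=> a0 i12 da; have := dotp_lscoef a0 a0 da da; rewrite -expr2 ler_norml.
rewrite /resid /ind2 !eqxx (negbTE i12) eq_sym (negbTE i12) dotpDr dotpNr.
by move=> /andP[_ H]; rewrite mulr1n mulr0n; lra.
Qed.

(** The residual contrast of f only sees f minus a function in the span of the
    regressors. *)
Lemma resid_bias (f : 'I_n -> R) c (a b e N : R) : 0 <= a -> 0 <= b -> 0 <= e ->
  #|A|%:R <= N ->
  dotp delta delta <= a ^+ 2 -> (forall i, i \in A -> dotp (phi i) (phi i) <= b ^+ 2) ->
  (forall i, i \in A -> `|f i - dotp c (phi i)| <= e) ->
  f i2 = dotp c (phi i2) ->
  `|\sum_(i in A) resid i * f i| <=
    `|f i1 - dotp c (phi i1)| + N * (a * b / K) * e.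
Proof.
move=> a0 b0 e0 AN da phib fe f2.
pose g i := f i - dotp c (phi i).
have -> : \sum_(i in A) resid i * f i = \sum_(i in A) resid i * g i.
  rewrite -[RHS]addr0 -[X in _ = _ + X](resid_orth c) -big_split/=.
  by apply: eq_bigr => i _; rewrite /g; ring.
have -> : \sum_(i in A) resid i * g i =
    g i1 - \sum_(i in A) dotp lscoef (phi i) * g i.
  under eq_bigr do rewrite mulrBl.
  by rewrite sumrB sum_ind2 /g f2 subrr subr0.
apply: le_trans (ler_normB _ _) _; rewrite lerD2l.
apply: le_trans (ler_norm_sum _ _ _) _.
apply: (@le_trans _ _ (\sum_(i in A) a * b / K * e)).
  apply: ler_sum => i iA; rewrite normrM ler_pM//; last exact: fe.
  by apply: dotp_lscoef => //; exact: phib.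
rewrite sumr_const -[leLHS]mulr_natl -[leRHS]mulrA; apply: ler_wpM2r => //.
by rewrite mulr_ge0// divr_ge0 ?mulr_ge0// ltW.
Qed.

End least_squares.

Section flat_estimator.
Context (R : realType) (d ell : nat).
Variables (psi : 'I_(qdim d ell) -> mpoly.mpoly d R) (s : 'I_d -> nat).
Context (n : nat).
Variables (x : 'I_n -> 'rV[R]_d).

Local Notation cell := (cell s).
Local Notation mem := (members x).

Definition cfeat (Q : cell) (i : 'I_n) := feat psi (local_coord x Q i).

Lemma gramE (Q : cell) : gram psi x Q = fgram (mem Q) (cfeat Q).
Proof.
apply/matrixP => k l; rewrite mxE /fgram summxE.
rewrite (big_enum_val (fun i => ((cfeat Q i)^T *m cfeat Q i) k l)).
by apply: eq_bigr => a _; rewrite !mxE big_ord1 !mxE.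
Qed.

Variable (Q : cell).
Variables (i1 i2 : 'I_n).
Hypotheses (i1A : i1 \in mem Q) (i2A : i2 \in mem Q).
Local Notation e := (Q, (i1, i2)).

Lemma pair_vec_design : (pair_vec x e)^T *m design psi x Q = delta (cfeat Q) i1 i2.
Proof.
apply/rowP => k; rewrite mxE.
transitivity (\sum_(i in mem Q) ind2 R i1 i2 i * cfeat Q i 0 k).
  rewrite (big_enum_val (fun i => ind2 R i1 i2 i * cfeat Q i 0 k)).
  by apply: eq_bigr => a _; rewrite !mxE.
by rewrite (sum_ind2 i1A i2A) !mxE.
Qed.

Lemma pair_resid (f : 'I_n -> R) :
  ((pair_vec x e)^T *m residual_maker psi x Q *m (\col_a f (enum_val a))) 0 0 =
  \sum_(i in mem Q) resid (mem Q) (cfeat Q) i1 i2 i * f i.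
Proof.
rewrite /residual_maker mulmxBr mulmx1 !mulmxA pair_vec_design gramE.
rewrite (big_enum_val (fun i => resid (mem Q) (cfeat Q) i1 i2 i * f i)).
rewrite mxE; apply: eq_bigr => a _; rewrite [X in _ * X]mxE; congr (_ * _).
rewrite [LHS]mxE [X in X + _]mxE [X in X + _]mxE [X in _ + X]mxE; congr (_ - _).
by rewrite mxE; apply: eq_bigr => k _; rewrite !mxE.
Qed.

Lemma pair_vE : pair_v psi x e =
  resid (mem Q) (cfeat Q) i1 i2 i1 - resid (mem Q) (cfeat Q) i1 i2 i2.
Proof.
have := pair_resid (ind2 R i1 i2); under eq_bigr do rewrite mulrC.
by rewrite (sum_ind2 i1A i2A).
Qed.

Lemma pair_ZE (y : 'I_n -> R) : pair_Z psi x y e =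
  (\sum_(i in mem Q) resid (mem Q) (cfeat Q) i1 i2 i * y i) ^+ 2 / pair_v psi x e.
Proof. by rewrite /pair_Z -pair_resid. Qed.

End flat_estimator.

(** * Chaos decomposition of the estimation error *)

Local Close Scope classical_set_scope.

Section subset_sums.
Context (R : realType) (I : finType).

Lemma sum_subset_setU1 (V : nmodType) (D : {set I}) k (F : {set I} -> V) : k \notin D ->
  \sum_(T : {set I} | T \subset k |: D) F T =
  \sum_(T : {set I} | T \subset D) (F T + F (k |: T)).
Proof.
move=> kD; rewrite big_split/= (bigID (fun T : {set I} => k \in T))/= addrC.
congr (_ + _).
  apply: eq_bigl => T; apply/andP/idP => [[TkD kT]|TD].
    by rewrite -(finset.setU1K kD) finset.subsetD1 TkD.
  split; first exact: fintype.subset_trans TD (finset.subsetUr _ _).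
  by apply: contra kD => /(fintype.subsetP TD).
rewrite (reindex_onto (fun T => k |: T) (fun T => T :\ k))/=; last first.
  by move=> T /andP[_ kT]; rewrite finset.setD1K.
apply: eq_bigl => T; rewrite finset.setU11 andbT.
apply/andP/idP => [[TkD /eqP TE]|TD].
  rewrite -TE; apply/fintype.subsetP => j; rewrite !inE => /andP[jk].
  by rewrite (negbTE jk)/= => jT; have := fintype.subsetP TkD j; rewrite !inE jT orbT (negbTE jk)/= => /(_ isT).
split; first exact: finset.setUS.
by rewrite finset.setU1K//; apply: contra kD => /(fintype.subsetP TD).
Qed.

Variable a : I -> R.

Definition msum (g : nat -> R) (D : {set I}) : R :=
  \sum_(T : {set I} | T \subset D) g #|T| * \prod_(i in T) a i.

Lemma msum0 g : msum g finset.set0 = g 0%N.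
Proof.
rewrite /msum (big_pred1 finset.set0); last by move=> T; rewrite finset.subset0.
by rewrite cards0 big_set0 mulr1.
Qed.

Lemma msumU1 g (D : {set I}) k : k \notin D ->
  msum g (k |: D) = msum g D + a k * msum (g \o S) D.
Proof.
move=> kD; rewrite /msum sum_subset_setU1// big_split/=; congr (_ + _).
rewrite mulr_sumr; apply: eq_bigr => T TD.
have kT : k \notin T by apply: contra kD => /(fintype.subsetP TD).
by rewrite cardsU1 kT big_setU1//= add1n mulrCA.
Qed.

Lemma set_ind (P : {set I} -> Prop) : P finset.set0 ->
  (forall k (D : {set I}), k \notin D -> P D -> P (k |: D)) -> forall D, P D.
Proof.
move=> P0 PU D; elim: {D}#|D| {-2}D (erefl #|D|) => [|m IH] D.
  by move=> /eqP; rewrite cards_eq0 => /eqP ->.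
move=> Dm; have /finset.set0Pn[k kD] : D != finset.set0 by rewrite -cards_eq0 Dm.
rewrite -(finset.setD1K kD); apply: PU; first by rewrite !inE eqxx.
by apply: IH; move: Dm; rewrite (cardsD1 k) kD add1n => -[].
Qed.

Lemma msum_deg0 g D : (forall m, g m.+1 = 0) -> msum g D = g 0%N.
Proof.
move=> g0; elim/set_ind: D => [|k D kD IH]; first exact: msum0.
rewrite msumU1// IH [X in _ * X]big1 ?mulr0 ?addr0// => T _.
by rewrite /= g0 mul0r.
Qed.

Lemma msum_deg1 g D : (forall m, g m.+2 = 0) ->
  msum g D = g 0%N + g 1%N * \sum_(i in D) a i.
Proof.
move=> g0; elim/set_ind: D => [|k D kD IH].
  by rewrite msum0 big_set0 mulr0 addr0.
by rewrite msumU1// IH msum_deg0// big_setU1//=; ring.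
Qed.

(** Adding one point to D turns msum g into msum g plus a multiple of msum of
    the shifted sequence, so that sequences vanishing from degree 3 on are
    treated by the degrees 0 and 1. *)
Lemma msum_deg2 g D : (forall m, g m.+3 = 0) ->
  2 * msum g D = 2 * g 0%N + 2 * g 1%N * \sum_(i in D) a i +
    g 2%N * ((\sum_(i in D) a i) ^+ 2 - \sum_(i in D) a i ^+ 2).
Proof.
move=> g0; elim/set_ind: D => [|k D kD IH].
  by rewrite msum0 !big_set0; ring.
by rewrite msumU1// mulrDr IH msum_deg1// !big_setU1//=; ring.
Qed.

(** The coefficient of a product of m distinct variables in the square of b plus
    the sum of the variables. *)
Definition gam (b : R) (m : nat) : R :=
  match m with 0 => b ^+ 2 | 1 => 2 * b | 2 => 2 | _ => 0 end.

(** Twice the elementary symmetric polynomial of degree 2 is the square of the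
    sum minus the sum of the squares. *)
Lemma sq_multilinear b :
  (b + \sum_i a i) ^+ 2 = \sum_i a i ^+ 2 +
    \sum_(T : {set I}) gam b #|T| * \prod_(i in T) a i.
Proof.
have := @msum_deg2 (gam b) [set: I] (fun m => erefl).
rewrite /msum; under eq_bigl do rewrite finset.subsetT.
under [\sum_(i in [set: I]) a i]eq_bigl do rewrite inE.
under [\sum_(i in [set: I]) a i ^+ 2]eq_bigl do rewrite inE.
move=> H; have n2 : 2 != 0 :> R by rewrite pnatr_eq0.
by apply: (mulfI n2); rewrite [RHS]mulrDr H /gam; ring.
Qed.

End subset_sums.

Section chaos.
Context (R : realType) (n : nat) (c : {set 'I_n} -> R) (s : R).

(** The square of a multilinear form in centered independent variables xi, of
    second moment at most s, once the variables of index in D are integrated. *)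
Definition chaosV (D : {set 'I_n}) (xi : 'I_n -> R) : R :=
  \sum_(S : {set 'I_n} | S \subset D) s ^+ #|S| *
    (\sum_(T : {set 'I_n} | T :&: D == S) c T * \prod_(i in T :\: D) xi i) ^+ 2.

Lemma chaosV0 xi : chaosV finset.set0 xi = (\sum_T c T * \prod_(i in T) xi i) ^+ 2.
Proof.
rewrite /chaosV (big_pred1 finset.set0); last by move=> T; rewrite finset.subset0.
rewrite cards0 expr0 mul1r; congr (_ ^+ 2).
by apply: eq_big => T; rewrite ?finset.setI0 ?eqxx// finset.setD0.
Qed.

Lemma chaosVT xi : chaosV [set: _] xi = \sum_(T : {set 'I_n}) s ^+ #|T| * c T ^+ 2.
Proof.
rewrite /chaosV; apply: eq_big => [T|S _]; first by rewrite finset.subsetT.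
rewrite (big_pred1 S); last by move=> T; rewrite finset.setIT.
by rewrite finset.setDT big_set0 mulr1.
Qed.

Definition setf (xi : 'I_n -> R) (i : 'I_n) (t : R) k := if k == i then t else xi k.

(** In the variable of index i each square is that of an affine function
    A + t B; integrating it out replaces t by 0 and t^2 by s. *)
Lemma chaosV_step (D : {set 'I_n}) i xi : i \notin D ->
  exists A B : {set 'I_n} -> R,
  (forall t, chaosV D (setf xi i t) =
     \sum_(S : {set 'I_n} | S \subset D) s ^+ #|S| * (A S + t * B S) ^+ 2) /\
  chaosV (i |: D) xi =
     \sum_(S : {set 'I_n} | S \subset D) s ^+ #|S| * (A S ^+ 2 + s * B S ^+ 2).
Proof.
move=> iD.
pose A S := \sum_(T : {set 'I_n} | T :&: (i |: D) == S)
  c T * \prod_(k in T :\: (i |: D)) xi k.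
exists A, (fun S => A (i |: S)); split=> [t|]; last first.
  rewrite /chaosV sum_subset_setU1//; apply: eq_bigr => S SD.
  have iS : i \notin S by apply: contra iD => /(fintype.subsetP SD).
  by rewrite cardsU1 iS add1n (exprSr s) [RHS]mulrDr [in RHS]mulrA.
apply: eq_bigr => S SD.
have iS : i \notin S by apply: contra iD => /(fintype.subsetP SD).
congr (_ * _ ^+ 2).
rewrite (bigID (fun T : {set 'I_n} => i \in T))/= addrC; congr (_ + _).
  apply: eq_big => [T|T /andP[_ iT]].
    apply/andP/eqP => [[/eqP <- iT]|TS].
      apply/finset.setP => k; rewrite !inE; case: eqVneq => //= -> .
      by rewrite (negbTE iT).
    have iT : i \notin T.
      by apply: contra iS => iT; rewrite -TS !inE iT eqxx.
    split=> //; rewrite -TS; apply/eqP/finset.setP => k; rewrite !inE.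
    by case: eqVneq => //= ->; rewrite (negbTE iT).
  congr (_ * _); apply: eq_big => k; last first.
    rewrite !inE => /andP[_ kT]; rewrite /setf ifN//.
    by apply: contraNN iT => /eqP <-.
  rewrite !inE negb_or; case: eqVneq => //= ->.
  by rewrite (negbTE iT) andbF.
rewrite mulr_sumr; apply: eq_big => [T|T /andP[_ iT]].
  apply/andP/eqP => [[/eqP <- iT]|TS].
    apply/finset.setP => k; rewrite !inE; case: eqVneq => //= -> .
    by rewrite iT.
  have iT : i \in T by have := finset.setU11 i S; rewrite -TS inE => /andP[].
  split=> //; apply/eqP/finset.setP => k; have := congr1 (fun X : {set 'I_n} => k \in X) TS.
  rewrite !inE; case: (eqVneq k i) => //= ->.
  by rewrite (negbTE iD) (negbTE iS) andbF.
rewrite (bigD1 i)/=; last by rewrite !inE iD iT.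
rewrite /setf eqxx mulrCA; congr (_ * (_ * _)); apply: eq_big => k.
  by rewrite !inE negb_or andbC andbA.
by move=> /andP[_ /negbTE ->].
Qed.

End chaos.

Lemma deg2_coef_bound (R : realType) (SA g0 X s b v bv : R) :
  2 * g0 + 2 * X = 2 * g0 + 2 * (4 * s * b ^+ 2) * v +
    (4 * s ^+ 2 * v ^+ 2 - 4 * s ^+ 2 * SA) ->
  0 <= 4 * s ^+ 2 * SA ->
  4 * s * b ^+ 2 * v <= v ^+ 2 * (4 * s * bv) ->
  X <= v ^+ 2 * (4 * s * bv) + 2^-1 * (4 * s ^+ 2 * v ^+ 2).
Proof. by move=> H1 H2 H3; lra. Qed.

Section coefficients.
Context (R : realType) (n : nat) (ET : finType) (E : {set ET}).
Variables (w v : ET -> R) (r : ET -> 'I_n -> R) (f y : 'I_n -> R) (sig2 : R).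
Hypotheses (w1 : \sum_(e in E) w e = 1)
  (vE : forall e, e \in E -> v e = \sum_i r e i ^+ 2).
Variable v0 : R.
Hypotheses (v0_gt0 : 0 < v0) (v_ge : forall e, e \in E -> v0 <= v e).

(** The estimate minus sig2 is a multilinear form, with coefficients coefT, in
    the noises y - f, plus a linear form, with coefficients coefB, in the
    centered squares. *)
Definition bias e := \sum_i r e i * f i.
Definition coefT (T : {set 'I_n}) : R :=
  \sum_(e in E) w e / v e * (gam (bias e) #|T| * \prod_(i in T) r e i).
Definition coefB (i : 'I_n) : R := \sum_(e in E) w e / v e * r e i ^+ 2.

Lemma v_gt0 e : e \in E -> 0 < v e.
Proof. by move=> eE; apply: lt_le_trans (v_ge eE). Qed.

(** The diagonal squares of the noises contribute v e times sig2 in mean, which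
    the division by v e and the normalization of the weights turn into sig2. *)
Lemma chaos_decomposition :
  \sum_(e in E) w e * ((\sum_i r e i * y i) ^+ 2 / v e) - sig2 =
  \sum_(T : {set 'I_n}) coefT T * \prod_(i in T) (y i - f i) +
  \sum_i coefB i * ((y i - f i) ^+ 2 - sig2).
Proof.
pose eps i := y i - f i.
have H e : e \in E -> w e * ((\sum_i r e i * y i) ^+ 2 / v e) =
    w e * sig2 + \sum_i w e / v e * r e i ^+ 2 * (eps i ^+ 2 - sig2) +
    \sum_(T : {set 'I_n}) w e / v e * (gam (bias e) #|T| * \prod_(i in T) r e i)
       * \prod_(i in T) eps i.
  move=> eE; have ve := v_gt0 eE.
  have -> : \sum_i r e i * y i = bias e + \sum_i r e i * eps i.
    by rewrite /bias -big_split; apply: eq_bigr => i _; rewrite /eps/=; ring.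
  rewrite sq_multilinear.
  have -> : w e * sig2 = w e / v e * (\sum_i r e i ^+ 2) * sig2.
    by rewrite -vE// divfK// gt_eqF.
  have -> : \sum_i w e / v e * r e i ^+ 2 * (eps i ^+ 2 - sig2) =
      w e / v e * \sum_i (r e i * eps i) ^+ 2 - w e / v e * (\sum_i r e i ^+ 2) * sig2.
    rewrite !mulr_sumr mulr_suml -sumrB; apply: eq_bigr => i _; ring.
  have -> : \sum_(T : {set 'I_n}) w e / v e * (gam (bias e) #|T| * \prod_(i in T) r e i)
       * \prod_(i in T) eps i = w e / v e *
       \sum_(T : {set 'I_n}) gam (bias e) #|T| * \prod_(i in T) (r e i * eps i).
    rewrite mulr_sumr; apply: eq_bigr => T _; rewrite big_split/=; ring.
  by ring.
rewrite (eq_bigr _ H) !big_split/= -mulr_suml w1 mul1r.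
have ar (t1 t2 t3 : R) : t1 + t2 + t3 - t1 = t3 + t2 by ring.
rewrite ar; congr (_ + _).
  rewrite exchange_big/=; apply: eq_bigr => T _.
  by rewrite /coefT mulr_suml.
rewrite exchange_big/=; apply: eq_bigr => i _.
by rewrite /coefB mulr_suml.
Qed.

Lemma sum_sqr_le (I : finType) (A : {set I}) (x : I -> R) :
  (\sum_(i in A) x i) ^+ 2 <= #|A|%:R * \sum_(i in A) x i ^+ 2.
Proof.
have H : (\sum_(i in A) x i) ^+ 2 <=
    \sum_(i in A) \sum_(j in A) 2^-1 * (x i ^+ 2 + x j ^+ 2).
  rewrite expr2 mulr_suml; apply: ler_sum => i _.
  rewrite mulr_sumr; apply: ler_sum => j _.
  by have := sqr_ge0 (x i - x j); nra.
apply: le_trans H _.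
under eq_bigr do rewrite -mulr_sumr big_split/= sumr_const.
rewrite -mulr_sumr big_split/= sumr_const sumrMnl.
rewrite -[X in _ * (X + X)]mulr_natl.
by rewrite le_eqVlt; apply/orP; left; apply/eqP; field.
Qed.

Variables (m : nat) (Cw beta : R).
Hypotheses (multi : forall i, (#|[set e in E | (r e i != 0)%R]| <= m)%N)
  (w_le : forall e, e \in E -> `|w e| <= Cw / #|E|%:R)
  (E0 : (0 < #|E|)%N)
  (b_le : forall e, e \in E -> `|bias e| <= beta).

Lemma Cw_ge0 : 0 <= Cw.
Proof.
have /finset.set0Pn[e eE] : E != finset.set0 by rewrite -cards_eq0 -lt0n.
have := w_le eE => /(le_trans (normr_ge0 _)).
by rewrite pmulr_lge0// invr_gt0 ltr0n.
Qed.

Lemma sum_w2 : \sum_(e in E) w e ^+ 2 <= Cw ^+ 2 / #|E|%:R.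
Proof.
have M0 : (0 : R) < #|E|%:R by rewrite ltr0n.
apply: (@le_trans _ _ (\sum_(e in E) (Cw / #|E|%:R) ^+ 2)).
  apply: ler_sum => e eE; rewrite -(real_normK (num_real (w e))).
  by rewrite lerXn2r ?nnegrE ?w_le// divr_ge0 ?Cw_ge0// ltW.
rewrite sumr_const -mulr_natl le_eqVlt; apply/orP; left; apply/eqP.
by field; rewrite gt_eqF.
Qed.

(** Cauchy-Schwarz: the sum over the pairs involving i has at most m terms. *)
Lemma sum_sqr_multi i (x : ET -> R) : (forall e, e \in E -> r e i = 0 -> x e = 0) ->
  (\sum_(e in E) x e) ^+ 2 <= m%:R * \sum_(e in E) x e ^+ 2.
Proof.
move=> x0.
pose A := [set e in E | r e i != 0].
have split0 (z : ET -> R) : (forall e, e \in E -> r e i = 0 -> z e = 0) ->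
    \sum_(e in E) z e = \sum_(e in A) z e.
  move=> z0; rewrite (bigID (fun e => r e i != 0))/= [X in _ + X]big1 ?addr0.
    by apply: eq_bigl => e; rewrite !inE.
  by move=> e /andP[eE /negPn/eqP]; exact: z0.
rewrite (split0 x)// (split0 (fun e => x e ^+ 2)); last first.
  by move=> e eE re; rewrite x0// expr0n.
apply: le_trans (sum_sqr_le _ _) _.
rewrite ler_wpM2r ?ler_nat ?multi//.
by apply: sumr_ge0 => e _; rewrite sqr_ge0.
Qed.

Lemma coefB_le : \sum_i coefB i ^+ 2 <= m%:R * Cw ^+ 2 / #|E|%:R.
Proof.
apply: (@le_trans _ _ (\sum_i m%:R * \sum_(e in E) (w e / v e * r e i ^+ 2) ^+ 2)).
  apply: ler_sum => i _; apply: (@sum_sqr_multi i) => e _ ->.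
  by rewrite expr0n mulr0.
rewrite -mulr_sumr -mulrA ler_wpM2l// exchange_big/=; apply: le_trans sum_w2.
apply: ler_sum => e eE; have ve := v_gt0 eE.
under eq_bigr do rewrite exprMn.
rewrite -mulr_sumr exprMn exprVn -mulrA -[leRHS]mulr1 ler_wpM2l ?sqr_ge0//.
rewrite ler_pdivrMl ?exprn_gt0// mulr1 vE// [leRHS]expr2 mulr_suml.
apply: ler_sum => i _; rewrite expr2 ler_wpM2l ?sqr_ge0//.
rewrite (bigD1 i)//= lerDl; apply: sumr_ge0 => k _; exact: sqr_ge0.
Qed.

(** Every index carries boundedly many pairs, so the multilinear coefficients
    of positive degree lose a factor of the number of pairs when squared. *)
Lemma coefT_le (s : R) : 0 <= s -> 0 <= beta ->
  \sum_(T : {set 'I_n}) s ^+ #|T| * coefT T ^+ 2 <=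
    (Cw * beta ^+ 2 / v0) ^+ 2 +
    m%:R * (4 * s * (beta ^+ 2 / v0) + 2 * s ^+ 2) * (Cw ^+ 2 / #|E|%:R).
Proof.
move=> s0 beta0; have M0 : (0 : R) < #|E|%:R by rewrite ltr0n.
have b2 e : e \in E -> bias e ^+ 2 <= beta ^+ 2.
  move=> eE; rewrite -(real_normK (num_real (bias e))).
  by rewrite lerXn2r ?nnegrE ?b_le.
rewrite (bigD1 finset.set0)//= cards0 expr0 mul1r; apply: lerD.
  rewrite -(real_normK (num_real (coefT finset.set0))) lerXn2r ?nnegrE//.
    by rewrite !mulr_ge0 ?Cw_ge0 ?sqr_ge0 ?invr_ge0 ?(ltW v0_gt0).
  rewrite /coefT cards0; apply: le_trans (ler_norm_sum _ _ _) _.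
  apply: (@le_trans _ _ (\sum_(e in E) Cw / #|E|%:R * (beta ^+ 2 / v0))).
    apply: ler_sum => e eE; have ve := v_gt0 eE.
    rewrite big_set0 mulr1/= -mulrA normrM ler_pM ?w_le//.
    rewrite normrM normrX mulrC ler_pM ?exprn_ge0//.
      by rewrite lerXn2r ?nnegrE ?b_le.
    by rewrite gtr0_norm ?invr_gt0// lef_pV2 ?posrE// v_ge.
  rewrite sumr_const -mulr_natl le_eqVlt; apply/orP; left; apply/eqP.
  by field; rewrite !gt_eqF.
pose g e k := s ^+ k * gam (bias e) k ^+ 2.
pose a e i := r e i ^+ 2.
apply: (@le_trans _ _ (\sum_(T : {set 'I_n} | T != finset.set0) m%:R *
    \sum_(e in E) (w e / v e) ^+ 2 * (g e #|T| * \prod_(i in T) a e i))).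
  apply: ler_sum => T /finset.set0Pn[i iT].
  apply: (@le_trans _ _ (s ^+ #|T| * (m%:R * \sum_(e in E)
      (w e / v e * (gam (bias e) #|T| * \prod_(i in T) r e i)) ^+ 2))).
    rewrite ler_wpM2l ?exprn_ge0//; apply: (@sum_sqr_multi i) => e eE re.
    by rewrite (bigD1 i)//= re mul0r !mulr0.
  rewrite mulrCA ler_wpM2l// mulr_sumr; apply: ler_sum => e eE.
  rewrite /g /a !exprMn -prodrXl le_eqVlt; apply/orP; left; apply/eqP; ring.
rewrite -mulr_sumr -[leRHS]mulrA ler_wpM2l// exchange_big/=.
apply: (@le_trans _ _ (\sum_(e in E) w e ^+ 2 *
    (4 * s * (beta ^+ 2 / v0) + 2 * s ^+ 2))).
  apply: ler_sum => e eE; have ve := v_gt0 eE.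
  rewrite -mulr_sumr exprMn -[leLHS]mulrA ler_wpM2l ?sqr_ge0//.
  rewrite exprVn ler_pdivrMl ?exprn_gt0//.
  have := @msum_deg2 R 'I_n (a e) (g e) [set: 'I_n].
  rewrite /msum (bigD1 finset.set0) ?finset.sub0set//= cards0 big_set0 mulr1.
  under eq_bigl do rewrite finset.subsetT/=.
  under [\sum_(i in [set: _]) a e i]eq_bigl do rewrite inE.
  under [\sum_(i in [set: _]) a e i ^+ 2]eq_bigl do rewrite inE.
  rewrite -(vE eE) => H.
  have {}H : 2 * (g e 0 + \sum_(T : {set 'I_n} | T != finset.set0) g e #|T| * \prod_(i in T) a e i) =
      2 * g e 0 + 2 * g e 1 * v e + g e 2 * (v e ^+ 2 - \sum_i a e i ^+ 2).
    by apply: H => k; rewrite /g/= expr0n mulr0.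
  have aa : 0 <= \sum_i a e i ^+ 2 by apply: sumr_ge0 => i _; exact: sqr_ge0.
  have g2 : g e 2 = 4 * s ^+ 2 by rewrite /g/=; ring.
  have g1 : g e 1 = 4 * s * bias e ^+ 2 by rewrite /g/=; ring.
  have g20 : 0 <= g e 2 * \sum_i a e i ^+ 2.
    by rewrite g2 mulr_ge0// mulr_ge0// sqr_ge0.
  have L1 : 4 * s * bias e ^+ 2 * v e <= v e ^+ 2 * (4 * s * (beta ^+ 2 / v0)).
    have -> : v e ^+ 2 * (4 * s * (beta ^+ 2 / v0)) = 4 * s * (beta ^+ 2 * (v e * (v e / v0))).
      by field; rewrite gt_eqF.
    rewrite -[leLHS]mulrA ler_wpM2l ?mulr_ge0//.
    rewrite ler_pM ?sqr_ge0 ?(ltW ve) ?b2//.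
    by rewrite -[leLHS]mulr1 ler_wpM2l ?(ltW ve)// ler_pdivlMr// mul1r v_ge.
  rewrite mulrDr g1 g2 mulrBr in H; rewrite mulrDr; rewrite g2 in g20.
  have -> : v e ^+ 2 * (2 * s ^+ 2) = 2^-1 * (4 * s ^+ 2 * v e ^+ 2) by field.
  exact: (deg2_coef_bound H g20 L1).
rewrite -mulr_suml [leLHS]mulrC ler_wpM2l ?sum_w2//.
by rewrite addr_ge0 ?mulr_ge0 ?sqr_ge0 ?invr_ge0 ?(ltW v0_gt0).
Qed.

End coefficients.

(** * The law of the sample and its resampling *)

Local Open Scope classical_set_scope.
Local Open Scope ring_scope.

Section integral_density.
Context d d' (T : measurableType d) (T' : measurableType d') (R : realType).
Variables (rho : {measure set T' -> \bar R}) (m : {measure set T -> \bar R}).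
Variables (D : set T) (mD : measurable D) (p : T -> R) (phi : T -> T').
Hypotheses (mp : measurable_fun D p) (p0 : forall x, D x -> 0 <= p x).
Hypothesis mphi : measurable_fun setT phi.
Hypothesis rhoE : forall A, measurable A ->
  (rho A = \int[m]_(x in D `&` phi @^-1` A) (p x)%:E)%E.

Import HBNNSimple.

Let density_nnsfun (h : {nnsfun T' >-> R}) :
  (\int[rho]_x (h x)%:E = \int[m]_(x in D) ((p x)%:E * (h (phi x))%:E))%E.
Proof.
under [LHS]eq_integral do rewrite fimfunE -fsumEFin//.
rewrite [LHS]ge0_integral_fsum//; last 2 first.
  - by move=> r; exact/measurable_EFinP/measurableT_comp.
  - by move=> n x _; rewrite EFinM nnfun_muleindic_ge0.
under [RHS]eq_integral.
  move=> x xD; rewrite fimfunE -fsumEFin// ge0_mule_fsumr; last first.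
    by move=> r; rewrite EFinM nnfun_muleindic_ge0.
  over.
have mi r : measurable_fun D (fun x => (r * \1_(h @^-1` [set r]) (phi x))%:E).
  apply/measurable_EFinP; apply: measurable_funTS.
  apply: (@measurableT_comp _ _ _ _ _ _ ( *%R r)) => //.
  by apply: measurableT_comp mphi.
rewrite [RHS]ge0_integral_fsum//; last 2 first.
  - by move=> r; apply: emeasurable_funM => //; exact/measurable_EFinP.
  - move=> n x Dx; rewrite mule_ge0//; first by rewrite lee_fin p0.
    by rewrite EFinM nnfun_muleindic_ge0.
apply: eq_fsbigr => r _.
have mr : measurable (h @^-1` [set r]) by [].
rewrite integralZl_indic_nnsfun//= integral_indic// setIT.
rewrite rhoE//.
have [r0|r0] := ltP r 0.
  rewrite preimage_nnfun0// preimage_set0 setI0 integral_set0 mule0.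
  by rewrite integral0_eq// => x _; rewrite indic0 mulr0 mule0.
under [RHS]eq_integral do rewrite EFinM muleCA.
rewrite ge0_integralZl//; last 2 first.
- apply: emeasurable_funM; first exact/measurable_EFinP.
  apply/measurable_EFinP/measurable_funTS.
  by apply: measurableT_comp mphi.
- by move=> x Dx; rewrite mule_ge0// lee_fin ?p0.
congr (_ * _)%E; rewrite integral_mkcondr; apply: eq_integral => x _.
rewrite patchE indicE; have -> : (x \in phi @^-1` (h @^-1` [set r])) =
    (phi x \in h @^-1` [set r]) by apply/idP/idP => /set_mem ?; exact/mem_set.
by case: ifPn; rewrite (mule1, mule0).
Qed.

Lemma ge0_integral_density (f : T' -> \bar R) :
  measurable_fun setT f -> (forall x, 0 <= f x)%E ->
  (\int[rho]_x f x = \int[m]_(x in D) ((p x)%:E * f (phi x)))%E.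
Proof.
move=> mf f0.
pose f_ := nnsfun_approx measurableT mf.
transitivity (lim (\int[rho]_x (f_ n x)%:E @[n --> \oo])%E).
  rewrite -monotone_convergence//=.
  - apply: eq_integral => ? /[!inE] xD; apply/esym/cvg_lim => //=.
    exact: cvg_nnsfun_approx.
  - by move=> n; exact/measurable_EFinP/measurable_funTS.
  - by move=> n ? _; rewrite lee_fin.
  - by move=> ? _ ? ? mn; rewrite lee_fin; exact/lefP/nd_nnsfun_approx.
under eq_fun do rewrite density_nnsfun.
rewrite -monotone_convergence//=.
- apply: eq_integral => x /[!inE] xD; rewrite limeMl//.
    by congr (_ * _)%E; apply/cvg_lim => //; exact: cvg_nnsfun_approx.
  by apply/cvg_ex; exists (f (phi x)); exact: cvg_nnsfun_approx.
- move=> n; apply: emeasurable_funM; first exact/measurable_EFinP.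
  apply/measurable_EFinP/measurable_funTS.
  by apply: measurableT_comp mphi.
- by move=> n x Dx; rewrite mule_ge0// lee_fin ?p0.
- move=> x Dx a b ab; rewrite lee_wpmul2l ?lee_fin ?p0//.
  exact/lefP/nd_nnsfun_approx.
Qed.

End integral_density.

Section kpull.
Context d0 d1 d2 (W : measurableType d0) (X : measurableType d1)
  (Y : measurableType d2) (R : realType).
Variables (Q : R.-pker X ~> Y) (phi : W -> X).

Definition kpull (mphi : measurable_fun [set: W] phi) (w : W) :
  {measure set Y -> \bar R} := Q (phi w).

Hypothesis mphi : measurable_fun [set: W] phi.

Let kpull_measurable U : measurable U -> measurable_fun [set: W] (kpull mphi ^~ U).
Proof.
by move=> mU; exact: (measurableT_comp (measurable_kernel Q U mU) mphi).
Qed.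

HB.instance Definition _ := isKernel.Build _ _ _ _ _ (kpull mphi) kpull_measurable.

Let kpull_prob w : kpull mphi w [set: Y] = 1%E.
Proof. exact: prob_kernel. Qed.

HB.instance Definition _ := Kernel_isProbability.Build _ _ _ _ _
  (kpull mphi) kpull_prob.

End kpull.

Section tuple_laws.
Context d (T : measurableType d) (R : realType) (n : nat).

Definition box (A : 'I_n -> set T) : set (n.-tuple T) :=
  [set z | forall i, A i (tnth z i)].

Lemma measurable_box (A : 'I_n -> set T) :
  (forall i, measurable (A i)) -> measurable (box A).
Proof.
move=> mA; have -> : box A = \bigcap_(i in [set: 'I_n])
    ((fun x : n.-tuple T => tnth x i) @^-1` A i).
  by apply/seteqP; split => x /= H i; [move=> _|]; exact: H.
apply: fin_bigcap_measurable; first exact: finite_finset.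
move=> i _; rewrite -[X in measurable X]setTI.
by apply: measurable_tnth.
Qed.

(** Boxes are a generating pi-system of the product sigma-algebra. *)
Lemma tuple_law_unique (m1 m2 : {measure set (n.-tuple T) -> \bar R}) :
  (m1 setT < +oo)%E ->
  (forall A, (forall i, measurable (A i)) -> m1 (box A) = m2 (box A)) ->
  forall B, measurable B -> m1 B = m2 B.
Proof.
move=> m1oo m12.
pose G := [set B | exists2 A : 'I_n -> set T, (forall i, measurable (A i)) & B = box A].
have GT : G setT.
  by exists (fun=> setT) => //; apply/seteqP; split.
apply: (@measure_unique _ _ _ G (fun=> setT)) => //.
- apply/seteqP; split; last first.
    apply: smallest_sub; first exact: sigma_algebra_measurable.
    by move=> _ [A mA ->]; exact: measurable_box.
  apply: smallest_sub; first exact: smallest_sigma_algebra.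
  have sub i (B : set T) : measurable B ->
      <<s G >> ((fun x : n.-tuple T => tnth x i) @^-1` B).
    move=> mB; apply: sub_sigma_algebra.
    exists (fun k => if k == i then B else setT); first by move=> k; case: ifP.
    apply/seteqP; split => [x Bx k|x /(_ i)/=]; last by rewrite eqxx.
    by case: eqVneq => // ->.
  move=> B; rewrite -bigcup_seq/= => -[i _ [C mC <-]].
  by rewrite setTI; exact: sub.
- move=> _ _ [A mA ->] [B mB ->]; exists (fun i => A i `&` B i).
    by move=> i; exact: measurableI.
  apply/seteqP; split => [x [Ax Bx] i|x H]; first by split.
  by split=> i; have [] := H i.
- by rewrite bigcup_const.
- by move=> _ [A mA ->]; exact: m12.
Qed.

Definition upd (z : n.-tuple T) (i : 'I_n) (t : T) : n.-tuple T :=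
  [tuple if k == i then t else tnth z k | k < n].

Lemma measurable_upd d0 (W : measurableType d0) (f : W -> n.-tuple T) i (g : W -> T) :
  measurable_fun setT f -> measurable_fun setT g ->
  measurable_fun setT (fun w => upd (f w) i (g w)).
Proof.
move=> /measurable_fun_tnthP mf mg; apply/measurable_fun_tnthP => k.
rewrite (_ : _ \o _ = fun w => if k == i then g w else tnth (f w) k); last first.
  by apply/funext => w; rewrite /= tnth_mktuple.
by case: eqVneq => // _; exact: mf.
Qed.

End tuple_laws.

Lemma in_set_iff (T U : Type) (A : set T) (B : set U) x y :
  (A x <-> B y) -> (x \in A) = (y \in B).
Proof. by move=> [H1 H2]; apply/idP/idP => /set_mem ?; apply/mem_set; auto. Qed.

Section gibbs.
Context (R : realType) d1 d2 (X : measurableType d1) (Y : measurableType d2)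
  d0 (Omega : measurableType d0) (P : probability Omega R) (n : nat).
Let T : measurableType _ := (X * Y)%type.
Variables (Z : 'I_n -> {RV P >-> T}) (m : {measure set X -> \bar R})
  (D : set X) (p : X -> R) (Q : R.-pker X ~> Y) (phi : T -> Y).
Hypotheses (mD : measurable D) (mp : measurable_fun D p)
  (p0 : forall x, D x -> 0 <= p x) (mphi : measurable_fun setT phi).
Hypothesis indep : forall A : 'I_n -> set T, (forall i, measurable (A i)) ->
  P [set w | forall i, A i (Z i w)] = (\prod_(i < n) P (Z i @^-1` A i))%E.
Hypothesis law : forall i (A : set T), measurable A -> P (Z i @^-1` A) =
  (\int[m]_(x in D) ((p x)%:E * Q x [set u | A (x, phi (x, u))]))%E.

Definition sample (w : Omega) : n.-tuple T := [tuple Z i w | i < n].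

Lemma measurable_sample : measurable_fun setT sample.
Proof.
apply/measurable_fun_tnthP => i.
rewrite (_ : _ \o _ = Z i)//.
by apply/funext => w; rewrite /= tnth_mktuple.
Qed.

Let mX i : measurable_fun setT (fun w => (Z i w).1).
Proof. by apply: measurableT_comp => //. Qed.

Let kphi (A : set T) (x : X) : \bar R := Q x [set u | A (x, phi (x, u))].

Let mpair : measurable_fun setT (fun z : X * Y => (z.1, phi z)).
Proof. exact: measurable_fun_pair. Qed.

Let kphi_int (A : set T) x : measurable A ->
  kphi A x = (\int[Q x]_u (\1_A (x, phi (x, u)))%:E)%E.
Proof.
move=> mA; rewrite /kphi.
have -> : (fun u => (\1_A (x, phi (x, u)))%:E) =
    (fun u => (\1_[set u | A (x, phi (x, u))] u)%:E) :> (Y -> \bar R).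
  by apply/funext => u; rewrite !indicE; congr ((nat_of_bool _)%:R%:E); exact: in_set_iff.
rewrite integral_indic ?setIT//.
have mf : measurable_fun setT (fun u : Y => (x, phi (x, u))).
  exact: (measurableT_comp mpair (measurable_pair1 x)).
by rewrite -[X in measurable X]setTI; exact: mf.
Qed.

Let mkphi A : measurable A -> measurable_fun setT (kphi A).
Proof.
move=> mA; rewrite (_ : kphi A = fun x => (\int[Q x]_u (\1_A (x, phi (x, u)))%:E)%E).
  apply: (measurable_fun_integral_finite_kernel (fun z : X * Y => (\1_A (z.1, phi z))%:E)).
    by move=> z; rewrite lee_fin.
  apply/measurable_EFinP.
  have mi : measurable_fun setT (\1_A : T -> R) by [].
  exact: (measurableT_comp mi mpair).
by apply/funext => x; exact: kphi_int.
Qed.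

Lemma integral_design i (k : X -> \bar R) : measurable_fun setT k ->
  (forall x, 0 <= k x)%E ->
  (\int[P]_w k (Z i w).1 = \int[m]_(x in D) ((p x)%:E * k x))%E.
Proof.
move=> mk k0.
transitivity (\int[P]_(w in setT) ((1 : R)%:E * k (Z i w).1))%E.
  by apply: eq_integral => w _; rewrite mul1e.
pose Xi : {mfun Omega >-> X} := HB.pack (fun w => (Z i w).1)
  (isMeasurableFun.Build _ _ _ _ _ (mX i)).
rewrite -(@ge0_integral_density _ _ _ _ _ (distribution P Xi) P setT _ (fun=> 1) Xi)//.
  apply: ge0_integral_density => // A mA.
  rewrite -[LHS]/(P (Xi @^-1` A)).
  have -> : Xi @^-1` A = Z i @^-1` (A `*` setT).
    by apply/seteqP; split => w //= [].
  rewrite law; last exact: measurableX.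
  rewrite preimage_id integral_mkcondr; apply: eq_integral => x _.
  rewrite patchE; case: ifPn => xA.
    rewrite (_ : [set u | _] = setT) ?prob_kernel ?mule1//.
    by apply/seteqP; split => // u _ /=; split=> //; exact: set_mem.
  rewrite (_ : [set u | _] = set0) ?measure0 ?mule0//.
  apply/seteqP; split => // u /= [] /mem_set; by rewrite (negbTE xA).
move=> A mA; rewrite setTI integral_cst ?mul1e//.
by rewrite -[X in measurable X]setTI; exact: mX.
Qed.

Let others i (A : 'I_n -> set T) : set Omega := [set w | forall k, k != i -> A k (Z k w)].

Let mothers i A : (forall i, measurable (A i)) -> measurable (others i A).
Proof.
move=> mA; have -> : others i A = \bigcap_(k in [set k | k != i]) (Z k @^-1` A k).
  by apply/seteqP; split => w.
apply: fin_bigcap_measurable; first exact: finite_finset.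
by move=> k _; rewrite -[X in measurable X]setTI; exact: measurable_funP.
Qed.

Let others_indep i A B : (forall i, measurable (A i)) -> measurable B ->
  P (others i A `&` Z i @^-1` B) = (P (others i A) * P (Z i @^-1` B))%E.
Proof.
move=> mA mB.
pose A' B k := if k == i then B else A k.
have E C : measurable C -> P (others i A `&` Z i @^-1` C) =
    (P (Z i @^-1` C) * \prod_(k < n | k != i) P (Z k @^-1` A k))%E.
  move=> mC; have -> : others i A `&` Z i @^-1` C = [set w | forall k, A' C k (Z k w)].
    apply/seteqP; split => [w [H1 H2] k|w H]; rewrite /A'.
      by case: eqVneq => [->//|]; exact: H1.
    split=> [k ki|]; first by have := H k; rewrite /A' (negbTE ki).
    by have := H i; rewrite /A' eqxx.
  rewrite indep; last by move=> k; rewrite /A'; case: ifP.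
  rewrite (bigD1 i)//= /A' eqxx; congr (_ * _)%E.
  by apply: eq_bigr => k /negbTE ->.
have := E setT measurableT; rewrite preimage_setT setIT probability_setT mul1e => ->.
by rewrite E// muleC.
Qed.

(** The conditional mean of S when the i-th response is drawn anew given the
    design and the other responses. *)
Definition step i (S : n.-tuple T -> \bar R) (z : n.-tuple T) : \bar R :=
  (\int[Q (tnth z i).1]_u S (upd z i ((tnth z i).1, phi ((tnth z i).1, u))))%E.

Let mupd i : measurable_fun setT (fun zu : n.-tuple T * Y =>
  upd zu.1 i ((tnth zu.1 i).1, phi ((tnth zu.1 i).1, zu.2))).
Proof.
apply: measurable_upd => //.
have mx : measurable_fun setT (fun zu : n.-tuple T * Y => (tnth zu.1 i).1).
  apply: (measurableT_comp measurable_fst).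
  exact: (measurableT_comp (measurable_tnth i) measurable_fst).
apply: measurable_fun_pair => //.
apply: measurableT_comp mphi _.
exact: measurable_fun_pair.
Qed.

Let mxi i : measurable_fun setT (fun z : n.-tuple T => (tnth z i).1).
Proof. by apply: (measurableT_comp measurable_fst); exact: measurable_tnth. Qed.

Lemma measurable_step i S : measurable_fun setT S -> (forall z, 0 <= S z)%E ->
  measurable_fun setT (step i S).
Proof.
move=> mS S0.
apply: (measurable_fun_integral_finite_kernel (fun zu : n.-tuple T * Y =>
  S (upd zu.1 i ((tnth zu.1 i).1, phi ((tnth zu.1 i).1, zu.2))))
  (kpull Q (mxi i))).
  by move=> z; exact: S0.
exact: (measurableT_comp mS (mupd i)).
Qed.

Lemma step_ge0 i S : (forall z, 0 <= S z)%E -> forall z, (0 <= step i S z)%E.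
Proof. by move=> S0 z; exact: integral_ge0. Qed.

(** Both sides are laws of tuples that agree on boxes, by independence of the
    observations. *)
Lemma integral_step i S : measurable_fun setT S -> (forall z, 0 <= S z)%E ->
  (\int[P]_w S (sample w) = \int[P]_w step i S (sample w))%E.
Proof.
move=> mS S0.
pose Zt : {mfun Omega >-> n.-tuple T} := HB.pack sample
  (isMeasurableFun.Build _ _ _ _ _ measurable_sample).
(* The resampled law is a composition of kernels, hence a measure. *)
pose l : R.-pker unit ~> Omega := kprobability (@measurable_cst _ _ unit _ setT (P : pprobability Omega R)).
have mXi : measurable_fun setT (fun tw : unit * Omega => (Z i tw.2).1).
  exact: (measurableT_comp (mX i) measurable_snd).
pose Psi (twu : (unit * Omega) * Y) : n.-tuple T :=
  upd (sample twu.1.2) i ((Z i twu.1.2).1, phi ((Z i twu.1.2).1, twu.2)).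
have mPsi : measurable_fun setT Psi.
  have mw : measurable_fun setT (fun twu : (unit * Omega) * Y => twu.1.2).
    exact: (measurableT_comp measurable_snd measurable_fst).
  have mx : measurable_fun setT (fun twu : (unit * Omega) * Y => (Z i twu.1.2).1).
    exact: (measurableT_comp (mX i) mw).
  apply: measurable_upd; first exact: (measurableT_comp measurable_sample mw).
  apply: measurable_fun_pair => //.
  by apply: measurableT_comp mphi _; exact: measurable_fun_pair.
pose k1 := kpull Q mXi.
pose k : (R.-sfker (unit * Omega)%type ~> _) := mkcomp k1 (kdirac mPsi).
have Ek F : measurable_fun setT F -> (forall z, 0 <= F z)%E ->
  (\int[kcomp l k tt]_z F z = \int[P]_w \int[Q (Z i w).1]_u F (Psi ((tt, w), u)))%E.
  move=> mF F0; rewrite integral_kcomp//; apply: eq_integral => w _.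
  rewrite /k integral_kcomp//; apply: eq_integral => u _.
  by rewrite integral_dirac// diracT mul1e.
have -> : (\int[P]_w step i S (sample w) = \int[kcomp l k tt]_z S z)%E.
  rewrite Ek//; apply: eq_integral => w _; rewrite /step.
  by rewrite tnth_mktuple.
have -> : (\int[P]_w S (sample w) = \int[distribution P Zt]_z S z)%E.
  by rewrite ge0_integral_distribution.
apply: eq_measure_integral => B mB _.
apply: tuple_law_unique => //.
  by rewrite -[X in (X < _)%E]/(P (Zt @^-1` setT)) preimage_setT probability_setT ltry.
move=> A mA.
have mbox := measurable_box mA.
have kE : kcomp l k tt (box A) = (\int[P]_(w in others i A) kphi (A i) (Z i w).1)%E.
  transitivity (\int[kcomp l k tt]_z (\1_(box A) z)%:E)%E.
    by rewrite integral_indic// setIT.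
  rewrite Ek; [|by apply/measurable_EFinP|by move=> z; rewrite lee_fin].
  rewrite [RHS]integral_mkcond; apply: eq_integral => w _.
  rewrite patchE; case: ifPn => [/set_mem ow|/negP now].
    rewrite kphi_int//; apply: eq_integral => u _.
    rewrite !indicE; congr ((nat_of_bool _)%:R%:E).
    apply: in_set_iff; split=> H.
      by have := H i; rewrite /Psi/= tnth_mktuple eqxx.
    move=> j; rewrite /Psi/= tnth_mktuple; case: eqVneq => [->//|ji].
    by rewrite tnth_mktuple; exact: ow.
  apply: integral0_eq => u _; rewrite indicE; case: (boolP (_ \in _)) => // /set_mem H.
  exfalso; apply: now; apply/mem_set => j ji.
  by have := H j; rewrite /Psi/= tnth_mktuple (negbTE ji) tnth_mktuple.
apply: etrans (esym kE); rewrite -[LHS]/(P (Zt @^-1` box A)) {kE}.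
have -> : (\int[P]_(w in others i A) kphi (A i) (Z i w).1 =
    P (others i A) * \int[P]_w kphi (A i) (Z i w).1)%E.
  pose Xi : {mfun Omega >-> X} := HB.pack (fun w => (Z i w).1)
    (isMeasurableFun.Build _ _ _ _ _ (mX i)).
  have mo := mothers i mA.
  have k0 x : (0 <= kphi (A i) x)%E by exact: measure_ge0.
  transitivity (\int[P]_(w in others i A) ((1 : R)%:E * kphi (A i) (Xi w)))%E.
    by apply: eq_integral => w _; rewrite mul1e.
  transitivity (\int[P]_(w in setT) ((fine (P (others i A)))%:E * kphi (A i) (Xi w)))%E; last first.
    rewrite ge0_integralZl//; last 2 first.
    - by apply: measurableT_comp (mX i); exact: mkphi.
    - by rewrite lee_fin fine_ge0.
    by rewrite fineK// fin_num_measure.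
  pose rho0 : {measure set X -> \bar R} := pushforward (mrestr P mo) Xi.
  pose rho := rho0 (mX i).
  transitivity (\int[rho]_x kphi (A i) x)%E; [apply: esym|];
    apply: ge0_integral_density => //; try exact: mkphi.
  - move=> C mC; rewrite /rho /rho0/= /pushforward /mrestr integral_cst ?mul1e; last first.
      apply: measurableI => //; rewrite -[X in measurable X]setTI; exact: mX.
    by rewrite setIC.
  - by move=> w _; rewrite fine_ge0.
  - move=> C mC; rewrite /rho /rho0/= /pushforward /mrestr setTI integral_cst; last first.
      by rewrite -[X in measurable X]setTI; exact: mX.
    rewrite fineK ?fin_num_measure// setIC.
    have -> : Xi @^-1` C = Z i @^-1` (C `*` setT).
      by apply/seteqP; split => w //= [].
    by rewrite others_indep//; exact: measurableX.
have -> : (\int[P]_w kphi (A i) (Z i w).1 = P (Z i @^-1` A i))%E.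
  by rewrite integral_design ?law//; exact: mkphi.
rewrite -others_indep//; congr (P _); apply/seteqP; split => [w H|w [H1 H2] j].
  by split=> [j ji|]; [have := H j|have := H i]; rewrite tnth_mktuple.
rewrite /= tnth_mktuple; case: (eqVneq j i) => [->//|]; exact: H1.
Qed.

End gibbs.

Section moments.
Context (R : realType) (m : probability (measurableTypeR R) R).

(** The cross term integrates to zero. *)
Lemma integral_affine_sq (zeta : R -> R) (s : R) :
  measurable_fun setT zeta -> (\int[m]_u (zeta u)%:E = 0)%E ->
  (\int[m]_u (zeta u ^+ 2)%:E <= s%:E)%E ->
  forall a b : R, (\int[m]_u ((a + zeta u * b) ^+ 2)%:E <= (a ^+ 2 + s * b ^+ 2)%:E)%E.
Proof.
move=> mz z0 z2 a b.
have mz2 : measurable_fun setT (fun u => zeta u ^+ 2) by exact: measurable_funX.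
have i2 : m.-integrable setT (EFin \o (fun u => zeta u ^+ 2)).
  apply/integrableP; split; first exact/measurable_EFinP.
  under eq_integral do rewrite /= ger0_norm ?sqr_ge0//.
  by apply: le_lt_trans z2 _; rewrite ltry.
have ic (c : R) : m.-integrable setT (EFin \o cst c).
  exact: finite_measure_integrable_cst.
have i1 : m.-integrable setT (EFin \o zeta).
  apply: (le_integrable measurableT _ _ (integrableD measurableT (ic 1) i2)).
    exact/measurable_EFinP.
  move=> u _ /=; rewrite lee_fin [leRHS]ger0_norm; last by rewrite addr_ge0// sqr_ge0.
  rewrite -(real_normK (num_real (zeta u))).
  by have := sqr_ge0 (`|zeta u| - 1); nra.
have -> : (\int[m]_u ((a + zeta u * b) ^+ 2)%:E =
  \int[m]_u ((a ^+ 2)%:E + ((2 * a * b)%:E * (zeta u)%:E + (b ^+ 2)%:E * (zeta u ^+ 2)%:E)))%E.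
  by apply: eq_integral => u _; rewrite -!EFinM -!EFinD; congr (_%:E); ring.
have iz1 := integrableZl measurableT (2 * a * b) i1.
have iz2 := integrableZl measurableT (b ^+ 2) i2.
rewrite integralD//=; [|exact: (ic (a ^+ 2))|exact: integrableD].
rewrite integralD//= !integralZl//= z0 mule0 add0e.
rewrite integral_cst//= probability_setT mule1 EFinD leeD2l//.
by rewrite (mulrC s) [(b ^+ 2 * s)%:E]EFinM lee_wpmul2l// lee_fin sqr_ge0.
Qed.

(** The second claim holds since the integral of (u^2 - v)^2 is that of u^4
    minus v^2. *)
Lemma noise_moments (v M : R) : (\int[m]_u u%:E = 0)%E ->
  (\int[m]_u (u ^+ 2)%:E = v%:E)%E -> (\int[m]_u (u ^+ 4)%:E <= M%:E)%E ->
  (\int[m]_u (u ^+ 2 - v)%:E = 0)%E /\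
  (\int[m]_u ((u ^+ 2 - v) ^+ 2)%:E <= M%:E)%E.
Proof.
move=> u1 u2 u4.
have mid : measurable_fun setT (id : R -> R) by [].
have mX k : measurable_fun setT (fun u : R => u ^+ k) by exact: measurable_funX.
have ic (c : R) : m.-integrable setT (EFin \o cst c).
  exact: finite_measure_integrable_cst.
have i2 : m.-integrable setT (EFin \o (fun u => u ^+ 2)).
  apply/integrableP; split; first exact/measurable_EFinP.
  under eq_integral do rewrite /= ger0_norm ?sqr_ge0//.
  by rewrite u2 ltry.
have u40 (u : R) : 0 <= u ^+ 4 by rewrite -[4%N]/(2 * 2)%N exprM sqr_ge0.
have i4 : m.-integrable setT (EFin \o (fun u => u ^+ 4)).
  apply/integrableP; split; first exact/measurable_EFinP.
  under eq_integral do rewrite /= ger0_norm ?u40//.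
  by apply: le_lt_trans u4 _; rewrite ltry.
split.
  under eq_integral do rewrite EFinD.
  rewrite (integralD measurableT i2 (ic (- v))) /= u2 integral_cst//=.
  by rewrite probability_setT mule1 -EFinD subrr.
have -> : (\int[m]_u ((u ^+ 2 - v) ^+ 2)%:E =
  \int[m]_u ((u ^+ 4)%:E + ((v ^+ 2)%:E + (- (2 * v))%:E * (u ^+ 2)%:E)))%E.
  by apply: eq_integral => u _; rewrite -!EFinM -!EFinD; congr (_%:E); ring.
have iz2 := integrableZl measurableT (- (2 * v)) i2.
rewrite integralD//=; [|exact: (integrableD measurableT (ic (v ^+ 2)) iz2)].
rewrite integralD//=; [|exact: (ic (v ^+ 2))].
rewrite integralZl//= u2 integral_cst//= probability_setT mule1 -EFinM -EFinD.
apply: (@le_trans _ _ (M%:E + (v ^+ 2 + - (2 * v) * v)%:E)%E); first exact: leeD2r.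
rewrite -EFinD lee_fin; have := sqr_ge0 v; nra.
Qed.

End moments.

Lemma measurable_sum_cond (R : realType) d (T : measurableType d) (D : set T)
    (I : Type) (s : seq I) (P : pred I) (h : I -> T -> R) :
  (forall i, measurable_fun D (h i)) ->
  measurable_fun D (fun x => \sum_(i <- s | P i) h i x).
Proof. by move=> mh; under eq_fun do rewrite -big_filter; exact: measurable_sum. Qed.

Section pack_probability.
Context (R : realType) d (Y : measurableType d).
Variables (m : {measure set Y -> \bar R}) (m1 : m [set: Y] = 1%E).

Definition prob_fun : set Y -> \bar R := m.
HB.instance Definition _ := Measure.on prob_fun.
HB.instance Definition _ := Measure_isProbability.Build _ _ _ prob_fun m1.
Definition pack_probability : probability Y R := prob_fun.

End pack_probability.

Section chaos_expectation.
Context (R : realType) d1 (X : measurableType d1) d0 (Omega : measurableType d0)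
  (P : probability Omega R) (n : nat).
Let Y := measurableTypeR R.
Let T : measurableType _ := (X * Y)%type.
Variables (Z : 'I_n -> {RV P >-> T}) (m : {measure set X -> \bar R})
  (D : set X) (p f : X -> R) (Q : R.-pker X ~> Y).
Hypotheses (mD : measurable D) (mp : measurable_fun D p)
  (p0 : forall x, D x -> 0 <= p x) (mf : measurable_fun setT f).
Hypothesis indep : forall A : 'I_n -> set T, (forall i, measurable (A i)) ->
  P [set w | forall i, A i (Z i w)] = (\prod_(i < n) P (Z i @^-1` A i))%E.
Hypothesis law : forall i (A : set T), measurable A -> P (Z i @^-1` A) =
  (\int[m]_(x in D) ((p x)%:E * Q x [set u | A (x, f x + u)%R]))%E.

Let phi (z : T) : Y := f z.1 + z.2.

Let mphi : measurable_fun setT phi.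
Proof. by apply: measurable_funD => //; exact: measurableT_comp mf _. Qed.

Definition noise_of (z : n.-tuple T) i : R := (tnth z i).2 - f (tnth z i).1.

Lemma noise_of_upd z i u :
  noise_of (upd z i ((tnth z i).1, phi ((tnth z i).1, u))) = setf (noise_of z) i u.
Proof.
apply/funext => k; rewrite /noise_of /setf tnth_mktuple.
by case: eqVneq => // _; rewrite /phi/= addrAC subrr add0r.
Qed.

Definition xs (z : n.-tuple T) i : X := (tnth z i).1.

Lemma xs_upd z i u : xs (upd z i ((tnth z i).1, phi ((tnth z i).1, u))) = xs z.
Proof.
by apply/funext => k; rewrite /xs tnth_mktuple; case: eqVneq => // ->.
Qed.

Variables (zeta : 'I_2 -> R -> R) (s : 'I_2 -> R) (G : set X) (GD : G `<=` D)
  (mG : measurable G).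
Hypotheses (mzeta : forall j, measurable_fun setT (zeta j)) (s0 : forall j, 0 <= s j).
Hypothesis Gae : (\int[m]_(x in D `&` ~` G) (p x)%:E = 0)%E.
Hypothesis zeta1 : forall j x, G x -> (\int[Q x]_u (zeta j u)%:E = 0)%E.
Hypothesis zeta2 : forall j x, G x -> (\int[Q x]_u (zeta j u ^+ 2)%:E <= (s j)%:E)%E.
Variable c : 'I_2 -> ('I_n -> X) -> {set 'I_n} -> R.

Let V (S : {set 'I_n}) (z : n.-tuple T) : R :=
  \sum_(j < 2) 2 * chaosV (c j (xs z)) (s j) S (fun i => zeta j (noise_of z i)).

Let V_ge0 S z : 0 <= V S z.
Proof.
apply: sumr_ge0 => j _; rewrite mulr_ge0// sumr_ge0// => B _.
by rewrite mulr_ge0 ?sqr_ge0// exprn_ge0.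
Qed.

Let mlin j (a b : R) : measurable_fun setT (fun u : Y => (a + zeta j u * b) ^+ 2).
Proof.
apply: measurable_funX; apply: measurable_funD; first exact: measurable_cst.
by apply: measurable_funM; [exact: mzeta|exact: measurable_cst].
Qed.

Let setf_zeta j (xi : 'I_n -> R) i u :
  (fun k => zeta j (setf xi i u k)) = setf (fun k => zeta j (xi k)) i (zeta j u).
Proof. by apply/funext => k; rewrite /setf; case: ifP. Qed.

Let V_meas (S : {set 'I_n}) i z : i \notin S ->
  measurable_fun setT (fun u : Y => V S (upd z i ((tnth z i).1, phi ((tnth z i).1, u)))).
Proof.
move=> iS; apply: measurable_sum => j; apply: measurable_funM => //.
under eq_fun do rewrite xs_upd noise_of_upd setf_zeta.
have [A [B [HA _]]] := @chaosV_step R n (c j (xs z)) (s j) S i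
  (fun k => zeta j (noise_of z k)) iS.
under eq_fun do rewrite HA.
by apply: measurable_sum_cond => C; apply: measurable_funM; [exact: measurable_cst|exact: mlin].
Qed.

Let V_step (S : {set 'I_n}) i z : i \notin S -> G (xs z i) ->
  (step Q phi i (fun z => (V S z)%:E) z <= (V (i |: S)%SET z)%:E)%E.
Proof.
move=> iS Gz; rewrite /step -/(xs z i).
pose q : probability Y R := pack_probability (prob_kernel (s := Q) (xs z i)).
have H j : (\int[q]_u (2 * chaosV (c j (xs z)) (s j) S
      (setf (fun k => zeta j (noise_of z k)) i (zeta j u)))%:E <=
    (2 * chaosV (c j (xs z)) (s j) (i |: S)%SET (fun i => zeta j (noise_of z i)))%:E)%E.
  have [A [B [HA ->]]] := @chaosV_step R n (c j (xs z)) (s j) S i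
    (fun k => zeta j (noise_of z k)) iS.
  under eq_integral do rewrite HA EFinM.
  have mAB (C : {set 'I_n}) : measurable_fun setT (fun u : Y => (s j ^+ #|C| * (A C + zeta j u * B C) ^+ 2)%:E).
    by apply/measurable_EFinP; apply: measurable_funM; [exact: measurable_cst|exact: mlin].
  have AB0 (C : {set 'I_n}) (u : Y) : 0 <= s j ^+ #|C| * (A C + zeta j u * B C) ^+ 2.
    by rewrite mulr_ge0 ?sqr_ge0// exprn_ge0.
  under eq_integral do rewrite -sumEFin -big_filter.
  rewrite ge0_integralZl//; last 2 first.
  - by apply: emeasurable_sum.
  - by move=> u _; apply: sume_ge0 => C _; rewrite lee_fin.
  rewrite EFinM lee_wpmul2l// ge0_integral_sum//; last first.
    by move=> C u _; rewrite lee_fin.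
  rewrite -sumEFin -[leRHS]big_filter; apply: lee_sum => C _.
  under eq_integral do rewrite EFinM.
  rewrite ge0_integralZl//; last 3 first.
  - by apply/measurable_EFinP; exact: mlin.
  - by move=> u _; rewrite lee_fin sqr_ge0.
  - by rewrite lee_fin exprn_ge0.
  rewrite EFinM lee_wpmul2l ?lee_fin ?exprn_ge0//.
  by apply: integral_affine_sq => //; [exact: zeta1|exact: zeta2].
rewrite (_ : (\int[_]_u _)%E = (\int[q]_u (\sum_(j < 2) (2 * chaosV (c j (xs z)) (s j) S
      (setf (fun k => zeta j (noise_of z k)) i (zeta j u)))%:E))%E); last first.
  apply: eq_integral => u _; rewrite sumEFin; congr (_%:E).
  apply: eq_bigr => j _; rewrite xs_upd noise_of_upd setf_zeta//.
rewrite ge0_integral_sum//; last 2 first.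
- move=> j; have [A [B [HA _]]] := @chaosV_step R n (c j (xs z)) (s j) S i
    (fun k => zeta j (noise_of z k)) iS.
  apply/measurable_EFinP; apply: measurable_funM => //.
  rewrite (_ : (fun _ => _) = (fun u => \sum_(S0 : {set 'I_n} | S0 \subset S)
    s j ^+ #|S0| * (A S0 + zeta j u * B S0) ^+ 2)); last by apply/funext => u; rewrite HA.
  by apply: measurable_sum_cond => C; apply: measurable_funM; [exact: measurable_cst|exact: mlin].
- move=> j u _; rewrite lee_fin mulr_ge0// sumr_ge0// => B _.
  by rewrite mulr_ge0 ?sqr_ge0// exprn_ge0.
by rewrite /V -sumEFin; apply: lee_sum => j _; exact: H.
Qed.

(** Resample the responses one after the other: each step integrates one noise
    out of the squares, which leaves the sum of the squared coefficients. *)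
Lemma chaos_expectation (S bnd : n.-tuple T -> R) :
  measurable_fun setT S -> (forall z, 0 <= S z) ->
  measurable_fun setT bnd -> (forall z, 0 <= bnd z) ->
  (forall z, (forall i, G (xs z i)) ->
     S z <= \sum_(j < 2) 2 * (\sum_(B : {set 'I_n}) c j (xs z) B *
       \prod_(i in B) zeta j (noise_of z i)) ^+ 2) ->
  (forall z, (forall i, G (xs z i)) ->
     \sum_(j < 2) 2 * \sum_(B : {set 'I_n}) s j ^+ #|B| * c j (xs z) B ^+ 2 <= bnd z) ->
  (\int[P]_w (S (sample Z w))%:E <= \int[P]_w (bnd (sample Z w))%:E)%E.
Proof.
move=> mS S0 mb b0 SV Vb.
pose steps (l : seq 'I_n) := foldr (fun i F => step Q phi i F) (fun z => (S z)%:E) l.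
have steps0 l z : (0 <= steps l z)%E.
  elim: l z => [|i l IH] z /=; first by rewrite lee_fin.
  exact: step_ge0.
have msteps l : measurable_fun setT (steps l).
  elim: l => [|i l IH] /=; first exact/measurable_EFinP.
  by apply: measurable_step.
have Esteps l : (\int[P]_w (S (sample Z w))%:E = \int[P]_w steps l (sample Z w))%E.
  elim: l => [//|i l ->] /=.
  by apply: (integral_step mD mp p0 mphi indep law).
have steps_le l z : uniq l -> (forall i, G (xs z i)) ->
    (steps l z <= (V [set:: l]%SET z)%:E)%E.
  elim: l z => [|i l IH] z /=.
    move=> _ Gz; rewrite lee_fin; apply: le_trans (SV _ Gz) _.
    rewrite le_eqVlt; apply/orP; left; apply/eqP; apply: eq_bigr => j _.
    by rewrite (_ : [set:: [::]]%SET = finset.set0) ?chaosV0//; apply/setP => k; rewrite !inE.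
  move=> /andP[il ul] Gz.
  have -> : [set:: i :: l]%SET = (i |: [set:: l])%SET by apply/setP => k; rewrite !inE.
  apply: (@le_trans _ _ (step Q phi i (fun z => (V [set:: l]%SET z)%:E) z)); last first.
    by apply: V_step; rewrite ?inE.
  have iS : i \notin [set:: l]%SET by rewrite inE.
  apply: ge0_le_integral => //.
  - apply: measurableT_comp (msteps l) _; apply: measurable_upd => //.
    apply: measurable_fun_pair => //.
    by apply: measurableT_comp mphi _; exact: measurable_fun_pair.
  - by apply/measurable_EFinP; exact: V_meas.
  - move=> u _; apply: IH => // k.
    by rewrite xs_upd.
rewrite (Esteps (enum 'I_n)); apply: ae_ge0_le_integral => //.
- by apply: measurableT_comp (measurable_sample Z); exact: msteps.
- by move=> w _; rewrite lee_fin.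
- by apply/measurable_EFinP; apply: measurableT_comp (measurable_sample Z).
have bad i : P.-negligible [set w | ~ G (Z i w).1].
  exists (Z i @^-1` ((~` G) `*` setT)); split.
  - rewrite -[X in measurable X]setTI; apply: measurable_funP => //.
    by apply: measurableX => //; exact: measurableC.
  - rewrite law; last by apply: measurableX => //; exact: measurableC.
    rewrite -Gae integral_mkcondr; apply: eq_integral => x _.
    rewrite patchE; case: ifPn => xG.
      rewrite (_ : [set u | _] = setT) ?prob_kernel ?mule1//.
      by apply/seteqP; split => // u _ /=; split=> //; exact: set_mem.
    rewrite (_ : [set u | _] = set0) ?measure0 ?mule0//.
    by apply/seteqP; split => // u [] /= H _; move/negP: xG; apply; exact/mem_set.
  - by move=> w /= nG; split.
have bads (l : seq 'I_n) : P.-negligible [set w | exists2 i, i \in l & ~ G (Z i w).1].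
  elim: l => [|i l IH].
    rewrite (_ : [set w | _] = set0); first exact: negligible_set0.
    by apply/seteqP; split => // w [].
  apply: negligibleS (negligibleU (bad i) IH) => w /= [k].
  by rewrite inE => /predU1P[->|kl] nG; [left|right; exists k].
have := bads (enum 'I_n).
apply: negligibleS => w /= H; apply: contrapT => nG; apply: H => _.
have Gw i : G (xs (sample Z w) i).
  apply: contrapT => nGi; apply: nG; exists i; first by rewrite mem_enum.
  by move: nGi; rewrite /xs tnth_mktuple.
apply: le_trans (steps_le _ _ (enum_uniq _) Gw) _.
rewrite lee_fin; apply: le_trans (Vb _ Gw).
rewrite le_eqVlt; apply/orP; left; apply/eqP; apply: eq_bigr => j _.
rewrite (_ : [set:: enum 'I_n]%SET = finset.setT) ?chaosVT//.
by apply/setP => k; rewrite !inE mem_enum.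
Qed.

End chaos_expectation.

(** * Measurability of the estimator *)

(** Density of the rational vectors; it makes the comparison with the smallest
    eigenvalue a countable intersection of measurable conditions. *)
Lemma rational_quadratic (R : realType) m (A : 'M[R]_m) (k : R) :
  (forall r : {ffun 'I_m -> rat}, let x := \row_j ratr (r j) in
     k * dotp x x <= dotp (x *m A) x) ->
  forall x, k * dotp x x <= dotp (x *m A) x.
Proof.
move=> H x; rewrite leNgt; apply/negP => lt.
pose B := A - k%:M.
have BE y : dotp (y *m B) y = dotp (y *m A) y - k * dotp y y.
  by rewrite mulmxBr mul_mx_scalar dotpDl -scaleNr dotpZl mulNr.
have Bx : dotp (x *m B) x < 0 by rewrite BE subr_lt0.
have := @dotp_continuous R m B x => cB.
have [e /= e0 eB] : nbhs_ball x [set y | dotp (y *m B) y < 0].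
  rewrite nbhs_ballE; apply: (cB [set t | t < 0]).
  by apply: open_nbhs_nbhs; split; [exact: open_lt|].
have /choice[r Hr] : forall j, exists r : rat, x 0 j - e < ratr r < x 0 j + e.
  move=> j; have [|r] := @rat_in_itvoo R (x 0 j - e) (x 0 j + e).
    by rewrite ltrBlDr -addrA ltrDl addr_gt0.
  by rewrite in_itv/=; exists r.
have := eB (\row_j ratr (r j)); rewrite /=.
suff bx : ball x e (\row_j ratr (r j)).
  move=> /(_ bx); rewrite BE subr_lt0 ltNge => /negP; apply.
  have := H [ffun j => r j].
  rewrite (_ : \row_j _ = \row_j ratr (r j))//.
  by apply/rowP => j; rewrite !mxE ffunE.
split=> // i j; rewrite (ord1 i) mxE /ball/= /ball_/=.
case/andP: (Hr j) => H1 H2; rewrite ltr_norml; apply/andP; split; lra.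
Qed.

Section measurable_closure.
Context (R : realType) d (T : measurableType d).
Local Notation M := (measurable_fun [set: T]).

(** Away from 0 the inverse of f is f (f^2)^(-1), and the power function is
    measurable. *)
Lemma measurable_finv (f : T -> R) : M f -> M (fun z => (f z)^-1).
Proof.
move=> mf; rewrite (_ : (fun z => _) = (fun z => f z * (f z ^+ 2) `^ (-1))).
  apply: measurable_funM => //.
  by apply: measurableT_comp (@measurable_powR R (-1)) _; exact: measurable_funX.
apply/funext => z; rewrite powR_inv1 ?sqr_ge0//.
have [->|fz] := eqVneq (f z) 0; first by rewrite invr0 mul0r.
by rewrite expr2 invfM mulrA divff// mul1r.
Qed.

Lemma measurable_b2r (b : T -> bool) : M b -> M (fun z => (b z)%:R : R).
Proof.
move=> mb; rewrite (_ : (fun z => _) = (fun z => if b z then 1 else 0)).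
  by apply: measurable_fun_ifT.
by apply/funext => z; case: (b z).
Qed.

Lemma measurable_forallb (I : finType) (b : I -> T -> bool) :
  (forall i, M (b i)) -> M (fun z => [forall i, b i z]).
Proof.
move=> mb; rewrite (_ : (fun z => _) = (fun z => all (fun i => b i z) (enum I))).
  elim: (enum I) => [|i l IH] /=; first exact: measurable_cst.
  by apply: measurable_and.
apply/funext => z; apply/forallP/allP => [H i _|H i]; first exact: H.
by apply: H; rewrite mem_enum.
Qed.

Lemma measurable_iff (b : T -> bool) : measurable [set z | b z] -> M b.
Proof.
move=> mb; apply: (measurable_fun_bool true); rewrite setTI.
by rewrite (_ : _ @^-1` _ = [set z | b z]).
Qed.

Lemma measurable_prod_fin (I : finType) (h : I -> T -> R) :
  (forall i, M (h i)) -> M (fun x => \prod_i h i x).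
Proof. by move=> mh; apply: measurable_prod. Qed.

Definition mxM m n (A : T -> 'M[R]_(m, n)) := forall i j, M (fun z => A z i j).

Lemma mxM_mul m n p (A : T -> 'M[R]_(m, n)) (B : T -> 'M[R]_(n, p)) :
  mxM A -> mxM B -> mxM (fun z => A z *m B z).
Proof.
move=> mA mB i j; under eq_fun do rewrite mxE.
by apply: measurable_sum => k; apply: measurable_funM.
Qed.

Lemma measurable_det m (A : T -> 'M[R]_m) : mxM A -> M (fun z => \det (A z)).
Proof.
move=> mA; apply: measurable_sum => s; apply: measurable_funM => //.
by apply: measurable_prod_fin => i; exact: mA.
Qed.

Lemma mxM_inv m (A : T -> 'M[R]_m) : mxM A -> mxM (fun z => invmx (A z)).
Proof.
move=> mA i j.
rewrite (_ : (fun z => _) = (fun z => if \det (A z) == 0 then A z i j else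
    (\det (A z))^-1 * cofactor (A z) j i)); last first.
  apply/funext => z; rewrite /invmx unitmxE unitfE; case: eqP => //= _.
  by rewrite !mxE.
apply: measurable_fun_ifT => //.
  by apply: measurable_fun_eqr; [exact: measurable_det|exact: measurable_cst].
apply: measurable_funM; first by apply: measurable_finv; exact: measurable_det.
apply: measurable_funM => //; apply: measurable_det => k l.
by under eq_fun do rewrite !mxE; exact: mA.
Qed.

Lemma measurable_dotp m (x y : T -> 'rV[R]_m) : mxM x -> mxM y ->
  M (fun z => dotp (x z) (y z)).
Proof. by move=> mx my; apply: measurable_sum => j; apply: measurable_funM. Qed.

Lemma measurable_le_lambda_min m (A : T -> 'M[R]_m) k : (0 < m)%N -> mxM A ->
  (forall z, (A z)^T = A z) -> M (fun z => k <= lambda_min (A z)).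
Proof.
move=> m0 mA sA; apply: measurable_iff.
pose F (i : nat) : set T := if unpickle i is Some r then
  [set z | let x := \row_j ratr ((r : {ffun 'I_m -> rat}) j) in
     k * dotp x x <= dotp (x *m A z) x] else setT.
rewrite (_ : [set z | _] = \bigcap_i F i).
  apply: bigcapT_measurable => i; rewrite /F; case: (unpickle i) => // r.
  rewrite -[X in measurable X]setTI.
  rewrite (_ : [set z | _] = (fun z => k * dotp (\row_j ratr (r j)) (\row_j ratr (r j))
      <= dotp (\row_j ratr (r j) *m A z) (\row_j ratr (r j))) @^-1` [set true])//.
  apply: measurable_fun_ler => //; apply: measurable_dotp => //.
  by apply: mxM_mul => // a b.
apply/seteqP; split => z /=.
  move=> /(le_lambda_min k m0 (sA z)) H i _; rewrite /F; case: (unpickle i) => [r|//]; exact: H.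
move=> FH; apply/(le_lambda_min k m0 (sA z)); apply: rational_quadratic => r.
by have := FH (pickle r) Logic.I; rewrite /F pickleK; apply.
Qed.

Lemma measurable_evalp n (p : mpoly.mpoly n R) (u : T -> 'rV[R]_n) : mxM u ->
  M (fun z => evalp p (u z)).
Proof.
move=> mu; rewrite /evalp; under eq_fun do rewrite mpoly.mevalE.
apply: measurable_sum => k; apply: measurable_funM => //.
by apply: measurable_prod_fin => j; apply: measurable_funX; exact: mu.
Qed.

End measurable_closure.

Lemma enorm_sq (R : realType) d (x : 'rV[R]_d) : enorm x ^+ 2 = \sum_j x 0 j ^+ 2.
Proof. by rewrite sqr_sqrtr// sumr_ge0// => j _; rewrite sqr_ge0. Qed.

Section measurable_estimator.
Context (R : realType) (d ell n : nat).
Variables (psi : 'I_(qdim d ell) -> mpoly.mpoly d R) (s : 'I_d -> nat).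
Variables (Nmax : nat) (kappa v0 lambda h vlow : R) (h0 : 0 <= h).
Context dT (T : measurableType dT).
Variables (x : T -> 'I_n -> 'rV[R]_d) (y : T -> 'I_n -> R).
Local Notation M := (measurable_fun [set: T]).
Hypotheses (mx : forall i, mxM (fun z => x z i)) (my : forall i, M (fun z => y z i)).

Lemma qdim_gt0 : (0 < qdim d ell)%N.
Proof. by rewrite bin_gt0 leq_addl. Qed.

Local Notation cell := (cell s).
Local Notation mem z := (members (x z)).

Lemma measurable_members (Q : cell) i : M (fun z => i \in mem z Q).
Proof.
under eq_fun do rewrite inE.
apply: measurable_forallb => j; have mxj : M (fun z => x z i 0 j) by exact: mx.
apply: measurable_and; first exact: measurable_fun_ler.
apply: measurable_or; first exact: measurable_fun_ltr.
by apply: measurable_and => //; exact: measurable_fun_eqr.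
Qed.

Lemma sum_members (V : T -> 'I_n -> R) (Q : cell) z :
  \sum_(i in mem z Q) V z i = \sum_i (i \in mem z Q)%:R * V z i.
Proof.
rewrite big_mkcond; apply: eq_bigr => i _.
by case: ifP; rewrite (mul1r, mul0r).
Qed.

Lemma measurable_cfeat (Q : cell) i : mxM (fun z => cfeat psi (x z) Q i).
Proof.
move=> a k; rewrite (ord1 a); under eq_fun do rewrite mxE.
apply: measurable_evalp => b j; rewrite (ord1 b); under eq_fun do rewrite mxE.
by apply: measurable_funM => //; apply: measurable_funB => //; exact: mx.
Qed.

Lemma measurable_gram (Q : cell) : mxM (fun z => gram psi (x z) Q).
Proof.
move=> k l; under eq_fun do rewrite gramE /fgram summxE
  (sum_members (fun z i => ((cfeat psi (x z) Q i)^T *m cfeat psi (x z) Q i) k l)).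
apply: measurable_sum => i; apply: measurable_funM.
  by apply: measurable_b2r; exact: measurable_members.
apply: mxM_mul; last exact: measurable_cfeat.
by move=> a b; under eq_fun do rewrite mxE; exact: measurable_cfeat.
Qed.

Lemma card_members (Q : cell) z : (#|mem z Q|%:R : R) = \sum_i (i \in mem z Q)%:R.
Proof. by rewrite -sum1_card natr_sum big_mkcond; apply: eq_bigr => i _; case: ifP. Qed.

Lemma measurable_card (Q : cell) : M (fun z => #|mem z Q|%:R : R).
Proof.
under eq_fun do rewrite card_members.
by apply: measurable_sum => i; apply: measurable_b2r; exact: measurable_members.
Qed.

Lemma measurable_retained (Q : cell) : M (fun z => retained_cell psi Nmax kappa (x z) Q).
Proof.
apply: measurable_and.
  apply: measurable_and.
    under eq_fun do rewrite -(ltr_nat R).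
    by apply: measurable_fun_ltr => //; exact: measurable_card.
  under eq_fun do rewrite -(ler_nat R).
  by apply: measurable_fun_ler => //; exact: measurable_card.
apply: measurable_le_lambda_min; first exact: qdim_gt0.
  move=> i j; under eq_fun do rewrite mxE; apply: measurable_funM.
    by apply: measurable_finv; exact: measurable_card.
  exact: measurable_gram.
by move=> z; rewrite linearZ/= gramE fgram_sym.
Qed.

Let rs z (Q : cell) i1 i2 i := resid (mem z Q) (cfeat psi (x z) Q) i1 i2 i.

Lemma measurable_resid (Q : cell) i1 i2 i : M (fun z => rs z Q i1 i2 i).
Proof.
apply: measurable_funB => //; apply: measurable_dotp; last exact: measurable_cfeat.
apply: mxM_mul.
  move=> a k; rewrite (_ : (fun z => _) = (fun z =>
      cfeat psi (x z) Q i1 a k - cfeat psi (x z) Q i2 a k)).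
    by apply: measurable_funB; apply: measurable_cfeat.
  by apply/funext => z; rewrite !mxE.
under eq_fun do rewrite -gramE.
by apply: mxM_inv; exact: measurable_gram.
Qed.

Local Notation E z := (edges psi s Nmax kappa v0 h (x z)).
Local Notation pair := (cell * ('I_n * 'I_n))%type.

Lemma measurable_edges (e : pair) : M (fun z => e \in E z).
Proof.
case: e => Q [i1 i2].
rewrite (_ : (fun z => _) = (fun z => [&& retained_cell psi Nmax kappa (x z) Q,
    i1 \in mem z Q, i2 \in mem z Q, (i1 < i2)%N,
    [forall j, `|(x z i1 0 j - corner R Q j) / side R s j -
                 (x z i2 0 j - corner R Q j) / side R s j| <= h] &
    v0 <= rs z Q i1 i2 i1 - rs z Q i1 i2 i2])).
  apply: measurable_and; first exact: measurable_retained.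
  apply: measurable_and; first exact: measurable_members.
  apply: measurable_and; first exact: measurable_members.
  apply: measurable_and => //; apply: measurable_and.
    apply: measurable_forallb => j; apply: measurable_fun_ler => //.
    apply: measurableT_comp => //; apply: measurable_funB.
      by apply: measurable_funM => //; apply: measurable_funB => //; exact: mx.
    by apply: measurable_funM => //; apply: measurable_funB => //; exact: mx.
  by apply: measurable_fun_ler => //; apply: measurable_funB; exact: measurable_resid.
apply/funext => z; rewrite inE /=.
case: (retained_cell _ _ _ _ _) => //=.
case i1m: (i1 \in mem z Q) => //=; case i2m: (i2 \in mem z Q) => //=.
rewrite pair_vE//; congr [&& _, _ & _].
apply/idP/forallP => [/(row_norm_le _ h0) H j|H].
  by have := H j; rewrite !mxE.
by apply/(row_norm_le _ h0) => j; have := H j; rewrite !mxE.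
Qed.

Lemma measurable_sum_edges (F : T -> pair -> R) :
  (forall e, M (fun z => if e \in E z then F z e else 0)) ->
  M (fun z => \sum_(e in E z) F z e).
Proof.
move=> mF; under eq_fun do rewrite big_mkcond.
exact: measurable_sum.
Qed.

Lemma measurable_edge_if (F : T -> pair -> R) e : M (fun z => F z e) ->
  M (fun z => if e \in E z then F z e else 0).
Proof. by move=> mF; apply: measurable_fun_ifT => //; exact: measurable_edges. Qed.

Lemma measurable_sum_edges_all (F : T -> pair -> R) :
  (forall e, M (fun z => F z e)) -> M (fun z => \sum_(e in E z) F z e).
Proof. by move=> mF; apply: measurable_sum_edges => e; exact: measurable_edge_if. Qed.

Lemma measurable_pair_s (e : pair) : M (fun z => pair_s h (x z) e).
Proof.
rewrite /pair_s; apply: measurable_funM => //; under eq_fun do rewrite enorm_sq.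
apply: measurable_sum => j; apply: measurable_funX.
under eq_fun do rewrite !mxE.
by apply: measurable_funB; apply: measurable_funM => //; apply: measurable_funB => //; exact: mx.
Qed.

Lemma measurable_nedges : M (fun z => nedges psi s Nmax kappa v0 h (x z)).
Proof.
rewrite /nedges; under eq_fun do rewrite -sum1_card natr_sum.
by apply: measurable_sum_edges_all => e.
Qed.

Lemma measurable_sbar : M (fun z => sbar psi s Nmax kappa v0 h (x z)).
Proof.
apply: measurable_funM; first by apply: measurable_finv; exact: measurable_nedges.
by apply: measurable_sum_edges_all => e; exact: measurable_pair_s.
Qed.

Lemma measurable_weight (e : pair) : M (fun z => weight psi Nmax kappa v0 lambda h (x z) e).
Proof.
apply: measurable_funB; first by apply: measurable_finv; exact: measurable_nedges.
apply: measurable_funM.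
  apply: measurable_funM; first exact: measurable_sbar.
  by apply: measurable_funB; [exact: measurable_pair_s|exact: measurable_sbar].
apply: measurable_finv; apply: measurable_funD; last first.
  by apply: measurable_funM => //; exact: measurable_nedges.
apply: measurable_sum_edges_all => e'.
apply: measurable_funX.
by apply: measurable_funB; [exact: measurable_pair_s|exact: measurable_sbar].
Qed.

Lemma measurable_sigma2 :
  M (fun z => sigma2_unclipped psi s Nmax kappa v0 lambda h vlow (x z) (y z)).
Proof.
rewrite /sigma2_unclipped; apply: measurable_fun_ifT => //.
  under eq_fun do rewrite -(ltr_nat R).
  by apply: measurable_fun_ltr => //; exact: measurable_nedges.
apply: measurable_sum_edges => -[Q [i1 i2]].
rewrite (_ : (fun z => _) = (fun z => if (Q, (i1, i2)) \in E z then
    weight psi Nmax kappa v0 lambda h (x z) (Q, (i1, i2)) *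
    ((\sum_i (i \in mem z Q)%:R * (rs z Q i1 i2 i * y z i)) ^+ 2 /
      (rs z Q i1 i2 i1 - rs z Q i1 i2 i2)) else 0)).
  apply: measurable_fun_ifT => //; first exact: measurable_edges.
  apply: measurable_funM; first exact: measurable_weight.
  apply: measurable_funM.
    apply: measurable_funX; apply: measurable_sum => i; apply: measurable_funM.
      by apply: measurable_b2r; exact: measurable_members.
    by apply: measurable_funM => //; exact: measurable_resid.
  by apply: measurable_finv; apply: measurable_funB; exact: measurable_resid.
apply/funext => z; case: ifP => // eE; congr (_ * _).
move: eE; rewrite inE /= => /and5P[_ i1m i2m _ _].
rewrite pair_ZE//; congr (_ ^+ 2 / _); last exact: pair_vE.
exact: (sum_members (fun z i => rs z Q i1 i2 i * y z i)).
Qed.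

End measurable_estimator.

(** * Lower tail of the number of occupied cells *)

Section second_moment.
Context (R : realType) d (Omega : measurableType d) (P : probability Omega R).
Variables (C I : finType) (E : C -> I -> set Omega) (K mult : R).
Hypotheses (mE : forall Q t, measurable (E Q t)) (K1 : 1 <= K) (mult0 : 0 <= mult).
Let p Q t := fine (P (E Q t)).
Hypothesis E_indep : forall Q Q' t t', Q != Q' ->
  (P (E Q t `&` E Q' t') <= (K * (p Q t * p Q' t'))%:E)%E.
Hypothesis E_mult : forall w Q, \sum_t \1_(E Q t) w <= mult :> R.

Definition count (w : Omega) : R := \sum_Q \sum_t \1_(E Q t) w.
Definition mean_count : R := \sum_Q \sum_t p Q t.

Let mone Q t : measurable_fun setT (\1_(E Q t) : Omega -> R).
Proof. exact: measurable_indic. Qed.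

Lemma measurable_count : measurable_fun setT count.
Proof. by apply: measurable_sum => Q; apply: measurable_sum => t; exact: mone. Qed.

Let count_ge0 w : 0 <= count w.
Proof. by apply: sumr_ge0 => Q _; apply: sumr_ge0 => t _; rewrite indicE. Qed.

Let PE Q t : P (E Q t) = (p Q t)%:E.
Proof. by rewrite fineK// fin_num_measure. Qed.

Let int_count : (\int[P]_w (count w)%:E = mean_count%:E)%E.
Proof.
rewrite /count /mean_count; under eq_integral do rewrite -sumEFin.
rewrite ge0_integral_sum//; last 2 first.
- by move=> Q; apply/measurable_EFinP; apply: measurable_sum => t; exact: mone.
- by move=> Q w _; rewrite lee_fin; apply: sumr_ge0 => t _; rewrite indicE.
rewrite -sumEFin; apply: eq_bigr => Q _; under eq_integral do rewrite -sumEFin.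
rewrite ge0_integral_sum//; last first.
  by move=> t; apply/measurable_EFinP; exact: mone.
by rewrite -sumEFin; apply: eq_bigr => t _; rewrite integral_indic// setIT; exact: PE.
Qed.

(** Inside a cell the count is bounded, and two distinct cells are nearly
    independent, so the variance of the count is of the order of its mean, up to
    K - 1 times the square of its mean. *)
Lemma int_count_sq :
  (\int[P]_w (count w ^+ 2)%:E <= (mult * mean_count + K * mean_count ^+ 2)%:E)%E.
Proof.
pose cnt Q w : R := \sum_t \1_(E Q t) w.
have cnt0 Q w : 0 <= cnt Q w by apply: sumr_ge0 => t _; rewrite indicE.
have mcnt Q : measurable_fun setT (cnt Q) by apply: measurable_sum => t; exact: mone.
have mI Q t Q' t' : measurable (E Q t `&` E Q' t') by exact: measurableI.
pose F w : R := mult * count w +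
  \sum_Q \sum_(Q' | Q' != Q) \sum_t \sum_t' \1_(E Q t `&` E Q' t') w.
have mF2 Q Q' : measurable_fun setT (fun w => \sum_t \sum_t' \1_(E Q t `&` E Q' t') w : R).
  by apply: measurable_sum => t; apply: measurable_sum => t'; exact: measurable_indic.
have F20 Q Q' w : 0 <= \sum_t \sum_t' \1_(E Q t `&` E Q' t') w :> R.
  by apply: sumr_ge0 => t _; apply: sumr_ge0 => t' _; rewrite indicE.
have count_sq w : count w ^+ 2 <= F w.
  rewrite expr2 /F {1}/count mulr_suml mulr_sumr -big_split/=.
  apply: ler_sum => Q _; rewrite -/(cnt Q w) /count (bigD1 Q)//= mulrDr.
  rewrite -/(cnt Q w); apply: lerD; first by rewrite ler_wpM2r ?cnt0//; exact: E_mult.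
  rewrite mulr_sumr; apply: ler_sum => Q' _; rewrite mulr_suml; apply: ler_sum => t _.
  rewrite mulr_sumr; apply: ler_sum => t' _; rewrite indicI/=.
  exact: lexx.
have mF : measurable_fun setT F.
  apply: measurable_funD; first by apply: measurable_funM => //; exact: measurable_count.
  apply: measurable_sum => Q; under eq_fun do rewrite -big_filter.
  by apply: measurable_sum => Q'; exact: mF2.
apply: (@le_trans _ _ (\int[P]_w (F w)%:E)%E).
  apply: ge0_le_integral => //.
  - by move=> w _; rewrite lee_fin sqr_ge0.
  - by apply/measurable_EFinP; apply: measurable_funX; exact: measurable_count.
  - exact/measurable_EFinP.
  - by move=> w _; rewrite lee_fin.
have mc0 w : 0 <= mult * count w.
  exact: mulr_ge0.
rewrite /F; under eq_integral do rewrite EFinD.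
rewrite ge0_integralD//; last 4 first.
- by move=> w _; rewrite lee_fin.
- by apply/measurable_EFinP; apply: measurable_funM => //; exact: measurable_count.
- by move=> w _; rewrite lee_fin; apply: sumr_ge0 => Q _; apply: sumr_ge0.
- apply/measurable_EFinP; apply: measurable_sum => Q; under eq_fun do rewrite -big_filter.
  by apply: measurable_sum => Q'; exact: mF2.
rewrite EFinD; apply: leeD.
  under eq_integral do rewrite EFinM.
  rewrite ge0_integralZl//; last 2 first.
  - by apply/measurable_EFinP; exact: measurable_count.
  - by move=> w _; rewrite lee_fin.
  by rewrite int_count EFinM.
under eq_integral do rewrite -sumEFin.
rewrite ge0_integral_sum//; last 2 first.
- move=> Q; apply/measurable_EFinP; under eq_fun do rewrite -big_filter.
  by apply: measurable_sum => Q'; exact: mF2.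
- by move=> Q w _; rewrite lee_fin; apply: sumr_ge0.
have -> : K * mean_count ^+ 2 =
    \sum_Q \sum_Q' \sum_t \sum_t' K * (p Q t * p Q' t').
  rewrite /mean_count expr2 mulr_suml mulr_sumr; apply: eq_bigr => Q _.
  rewrite mulr_sumr mulr_sumr; apply: eq_bigr => Q' _.
  rewrite mulr_suml mulr_sumr; apply: eq_bigr => t _.
  by rewrite mulr_sumr mulr_sumr.
have pp0 Q t Q' t' : 0 <= K * (p Q t * p Q' t').
  by rewrite mulr_ge0 ?(le_trans ler01 K1)// mulr_ge0// fine_ge0.
rewrite -sumEFin; apply: lee_sum => Q _.
apply: (@le_trans _ _ (\sum_(Q' | Q' != Q) \sum_t \sum_t' K * (p Q t * p Q' t'))%:E); last first.
  rewrite lee_fin [leRHS](bigD1 Q)//= lerDr; apply: sumr_ge0 => t _; exact: sumr_ge0.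
under eq_integral do rewrite -sumEFin -big_filter.
rewrite ge0_integral_sum//; last 2 first.
- by move=> Q'; apply/measurable_EFinP; exact: mF2.
- by move=> Q' w _; rewrite lee_fin.
rewrite big_filter -sumEFin; apply: lee_sum => Q' QQ'.
under eq_integral do rewrite -sumEFin.
rewrite ge0_integral_sum//; last 2 first.
- move=> t; apply/measurable_EFinP; apply: measurable_sum => t'; exact: measurable_indic.
- by move=> t w _; rewrite lee_fin; apply: sumr_ge0 => t' _; rewrite indicE.
rewrite -sumEFin; apply: lee_sum => t _.
under eq_integral do rewrite -sumEFin.
rewrite ge0_integral_sum//; last first.
  by move=> t'; apply/measurable_EFinP; exact: measurable_indic.
rewrite -sumEFin; apply: lee_sum => t' _; rewrite integral_indic// setIT.
by apply: E_indep; rewrite eq_sym.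
Qed.

(** Chebyshev's inequality. *)
Lemma count_lower_tail : 0 < mean_count ->
  (P [set w | (count w <= mean_count / 2)%R]
    <= (4 * mult / mean_count + 4 * (K - 1))%:E)%E.
Proof.
set b := mean_count => b0.
have mA : measurable [set w | count w <= b / 2].
  rewrite -[X in measurable X]setTI.
  rewrite (_ : [set w | _] = (fun w => count w <= b / 2) @^-1` [set true])//.
  by apply: measurable_fun_ler => //; exact: measurable_count.
have H : (\int[P]_w ((count w - b) ^+ 2)%:E <= (mult * b + (K - 1) * b ^+ 2)%:E)%E.
  have E2 : (\int[P]_w ((count w - b) ^+ 2)%:E + (2 * b ^+ 2)%:E =
      \int[P]_w (count w ^+ 2)%:E + (b ^+ 2)%:E)%E.
    have -> : ((2 * b ^+ 2)%:E = \int[P]_w (2 * b * count w)%:E)%E.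
      under eq_integral do rewrite EFinM.
      rewrite ge0_integralZl//; last 3 first.
      - by apply/measurable_EFinP; exact: measurable_count.
      - by move=> w _; rewrite lee_fin.
      - by rewrite lee_fin mulr_ge0// ltW.
      by rewrite int_count -EFinM; congr (_%:E); rewrite -/b; ring.
    have -> : ((b ^+ 2)%:E = \int[P]_w (b ^+ 2)%:E)%E.
      rewrite integral_cst// -[LHS]mule1; congr (_ * _)%E.
      exact/esym/probability_setT.
    have m1 : measurable_fun setT (fun w => ((count w - b) ^+ 2)%:E).
      apply/measurable_EFinP; apply: measurable_funX; apply: measurable_funB => //.
      exact: measurable_count.
    have m2 : measurable_fun setT (fun w => (2 * b * count w)%:E).
      by apply/measurable_EFinP; apply: measurable_funM => //; exact: measurable_count.
    have m3 : measurable_fun setT (fun w => (count w ^+ 2)%:E).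
      by apply/measurable_EFinP; apply: measurable_funX; exact: measurable_count.
    have g1 w : (0 <= ((count w - b) ^+ 2)%:E)%E by rewrite lee_fin sqr_ge0.
    have g2 w : (0 <= (2 * b * count w)%:E)%E.
      by rewrite lee_fin mulr_ge0// mulr_ge0// ltW.
    have g3 w : (0 <= (count w ^+ 2)%:E)%E by rewrite lee_fin sqr_ge0.
    have g4 : (0 <= (b ^+ 2)%:E)%E by rewrite lee_fin sqr_ge0.
    rewrite -!ge0_integralD//.
    by apply: eq_integral => w _; rewrite -!EFinD; congr (_%:E); ring.
  have := int_count_sq; rewrite -/b => L.
  have {}L : (\int[P]_w ((count w - b) ^+ 2)%:E + (2 * b ^+ 2)%:E <=
      (mult * b + K * b ^+ 2 + b ^+ 2)%:E)%E.
    by rewrite E2 EFinD leeD2r.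
  rewrite -leeBrDr// in L; apply: le_trans L _.
  by rewrite -EFinB lee_fin le_eqVlt; apply/orP; left; apply/eqP; ring.
have L : ((b ^+ 2 / 4)%:E * P [set w | (count w <= b / 2)%R] <=
    (mult * b + (K - 1) * b ^+ 2)%:E)%E.
  apply: le_trans H.
  rewrite -integral_cst//; apply: (@le_trans _ _
     (\int[P]_(w in [set w | (count w <= b / 2)%R]) ((count w - b) ^+ 2)%:E)%E).
    apply: ge0_le_integral => //.
    - by move=> w _; rewrite lee_fin divr_ge0// sqr_ge0.
    - apply/measurable_EFinP/measurable_funTS; apply: measurable_funX.
      by apply: measurable_funB => //; exact: measurable_count.
    - move=> w /= wb; rewrite lee_fin; nra.
  apply: ge0_subset_integral => //.
  - apply/measurable_EFinP; apply: measurable_funX.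
    by apply: measurable_funB => //; exact: measurable_count.
  - by move=> w _; rewrite lee_fin sqr_ge0.
have b24 : 0 < b ^+ 2 / 4 by rewrite divr_gt0// exprn_gt0.
rewrite -(@lee_pmul2l _ (b ^+ 2 / 4)%:E)//; apply: le_trans L _.
rewrite -EFinM lee_fin le_eqVlt; apply/orP; left; apply/eqP.
by field; rewrite gt_eqF.
Qed.

End second_moment.

Section occupancy.
Context (R : realType) d (Omega : measurableType d) (P : probability Omega R).
Context d' (T : measurableType d') (mu : probability T R) (n m : nat).
Variable X : 'I_n -> Omega -> T.
Hypotheses (mX : forall i, measurable_fun setT (X i)).
Hypothesis joint : forall A : 'I_n -> set T, (forall i, measurable (A i)) ->
  P [set w | forall i, A i (X i w)] = (\prod_i mu (A i))%E.
Variables (C V : finType) (cl : C -> set T) (bx : C -> V -> 'I_m -> set T).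
Hypotheses (mcl : forall Q, measurable (cl Q)) (mbx : forall Q v k, measurable (bx Q v k)).
Hypothesis cl_disj : forall Q Q' x, cl Q x -> cl Q' x -> Q = Q'.
Hypothesis bx_sub : forall Q v k, bx Q v k `<=` cl Q.
Variable k0 : 'I_m.
Hypothesis bx_disj : forall Q v v' x, bx Q v k0 x -> bx Q v' k0 x -> v = v'.
Variables (rho pi0 : R).
Hypotheses (rho0 : 0 <= rho) (rho2 : rho <= 2^-1) (pi00 : 0 <= pi0).
Hypothesis cl_le : forall Q, (mu (cl Q) <= rho%:E)%E.
Hypothesis bx_ge : forall Q v, (pi0%:E <= \prod_k mu (bx Q v k))%E.

(** An arrangement names the m points that lie in a cell, by the rank of the box
    that each of them occupies, and one of the configurations of boxes. *)
Definition arrangement : finType :=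
  (V * {f : {ffun 'I_m -> 'I_n} | injectiveb f})%type.

Definition slot Q (t : arrangement) (i : 'I_n) : set T :=
  if [pick k | val t.2 k == i] is Some k then bx Q t.1 k else ~` cl Q.

Definition arranged Q (t : arrangement) : set Omega :=
  [set w | forall i, slot Q t i (X i w)].

Let mslot Q t i : measurable (slot Q t i).
Proof. by rewrite /slot; case: pickP => // _; apply: measurableC. Qed.

Lemma measurable_arranged Q t : measurable (arranged Q t).
Proof.
have -> : arranged Q t = \bigcap_(i in [set: 'I_n]) (X i @^-1` slot Q t i).
  by apply/seteqP; split => w /= H i; [move=> _|]; exact: H.
apply: fin_bigcap_measurable; first exact: finite_finset.
by move=> i _; rewrite -[X in measurable X]setTI; exact: mX.
Qed.

Let arr_inj (t : arrangement) : injective (val t.2).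
Proof. exact/injectiveP/(valP t.2). Qed.

Lemma slot_img Q t k : slot Q t (val t.2 k) = bx Q t.1 k.
Proof.
rewrite /slot; case: pickP => [k' /eqP /arr_inj ->//|/(_ k)].
by rewrite eqxx.
Qed.

Lemma slot_out Q (t : arrangement) i : i \notin codom (val t.2) -> slot Q t i = ~` cl Q.
Proof.
move=> ni; rewrite /slot; case: pickP => // k /eqP ki.
by rewrite -ki codom_f in ni.
Qed.

(** The other points avoid the cell, and the boxes are contained in it. *)
Lemma arranged_cell Q t w i : arranged Q t w ->
  (i \in codom (val t.2)) <-> cl Q (X i w).
Proof.
move=> Et; split.
  by move=> /codomP[k ->]; have := Et (val t.2 k); rewrite slot_img; exact: bx_sub.
move=> Qi; apply: contrapT => /negP ni; have := Et i; rewrite slot_out//; exact.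
Qed.

(** The named points are exactly the points of the cell, so that only the order
    in which they are named is free; the box of rank k0 gives the
    configuration. *)
Lemma arranged_mult w Q : \sum_t \1_(arranged Q t) w <= (m ^ m)%:R :> R.
Proof.
have -> : \sum_t \1_(arranged Q t) w = #|[pred t | `[< arranged Q t w >]]|%:R :> R.
  rewrite -sum1_card natr_sum [RHS]big_mkcond; apply: eq_bigr => t _.
  rewrite indicE inE; case: ifPn => /asboolP H; last by rewrite memNset.
  by rewrite mem_set.
rewrite ler_nat.
have [z|/card_gt0P[t0]] := posnP #|[pred t | `[< arranged Q t w >]]|; first by rewrite z.
rewrite unfold_in/= => /asboolP E0.
pose g (t : arrangement) := val t.2.
have gE t t' : arranged Q t w -> arranged Q t' w -> g t = g t' -> t = t'.
  case: t t' => [v f] [v' f'] E E' /val_inj/= ff; congr pair => //; subst f'.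
  have := E (val f k0); have := E' (val f k0).
  rewrite (slot_img Q (v', f)) (slot_img Q (v, f)) /= => a b.
  exact: (bx_disj b a).
rewrite -(card_in_imset (f := g) (D := [pred t | `[< arranged Q t w >]])); last first.
  by move=> t t'; rewrite !unfold_in/= => /asboolP a /asboolP b; exact: gE a b.
apply: (@leq_trans #|ffun_on (mem (codom (g t0))) : pred {ffun 'I_m -> 'I_n}|).
  apply/subset_leq_card/fintype.subsetP => f /imsetP[t]; rewrite unfold_in/= => /asboolP Et ->.
  apply/ffun_onP => k; apply/(arranged_cell _ E0)/(arranged_cell _ Et).
  exact: codom_f.
by rewrite card_ffun_on card_codom ?card_ord//; exact: arr_inj.
Qed.

Let mu_fin A : measurable A -> mu A \is a fin_num.
Proof. by move=> mA; rewrite fin_num_measure. Qed.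

Let q A : R := fine (mu A).
Let muE A : measurable A -> mu A = (q A)%:E.
Proof. by move=> mA; rewrite fineK ?mu_fin. Qed.
Let q0 A : 0 <= q A. Proof. exact: fine_ge0. Qed.
Let q_sub A B : measurable A -> measurable B -> A `<=` B -> q A <= q B.
Proof. by move=> mA mB AB; rewrite -lee_fin -!muE//; apply: le_measure; rewrite ?inE. Qed.
Let q_C A : measurable A -> q (~` A) = 1 - q A.
Proof.
move=> mA; apply: EFin_inj; rewrite -muE; last exact: measurableC.
by rewrite probability_setC// muE.
Qed.

Let arrE Q t : P (arranged Q t) = (\prod_i q (slot Q t i))%:E.
Proof.
rewrite joint; last by move=> i; exact: mslot.
by rewrite -prodEFin; apply: eq_bigr => i _; rewrite muE.
Qed.

Let a := (1 - rho)^-1.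
Let a1 : 1 <= a.
Proof. by rewrite /a invf_ge1; move: rho0 rho2; lra. Qed.

(** The two events constrain every point separately, so it suffices to compare
    point by point: a point lies in at most one of the cells, and the constraint
    to avoid one cell has probability at least 1 - rho, lost only for the 2 m
    points that are placed in a box. *)
Lemma arranged_indep Q Q' t t' : Q != Q' ->
  (P (arranged Q t `&` arranged Q' t') <=
   (a ^+ (2 * m) * (fine (P (arranged Q t)) * fine (P (arranged Q' t'))))%:E)%E.
Proof.
move=> QQ'; have -> : arranged Q t `&` arranged Q' t' =
    [set w | forall i, (slot Q t i `&` slot Q' t' i) (X i w)].
  by apply/seteqP; split => w /= => [[H1 H2] i|H]; [split|split=> i; case: (H i)].
rewrite (joint (A := fun i => slot Q t i `&` slot Q' t' i)); last first.
  by move=> i; apply: measurableI; exact: mslot.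
rewrite !arrE/= -big_split/=.
under eq_bigr do rewrite (muE (measurableI _ _ (mslot _ _ _) (mslot _ _ _))).
rewrite prodEFin lee_fin.
pose e (u : arrangement) i : nat := i \in codom (val u.2).
have -> : a ^+ (2 * m) = \prod_i (a ^+ (e t i) * a ^+ (e t' i)).
  have H u : \prod_i a ^+ e u i = a ^+ m.
    rewrite -expr_sum; congr (a ^+ _).
    rewrite (eq_bigr (fun i => if i \in codom (val u.2) then 1 else 0)%N) => [|i _].
      rewrite -big_mkcond sum1_card.
      by rewrite card_codom ?card_ord//; exact: arr_inj.
    by rewrite /e; case: ifP.
  by rewrite big_split/= !H -exprD mul2n addnn.
rewrite -big_split/=; apply: ler_prod => i _; rewrite q0/=.
have clP Q1 : (1 - rho <= q (~` cl Q1)).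
  by rewrite q_C// lerD2l lerN2 -lee_fin -muE.
have r1 : 0 < 1 - rho by move: rho2; lra.
have aq Q1 : 1 <= a * q (~` cl Q1).
  by rewrite /a mulrC ler_pdivlMr// mul1r.
have sub (u : arrangement) Q1 : i \in codom (val u.2) -> slot Q1 u i `<=` cl Q1.
  by move=> /codomP[k ->]; rewrite slot_img; exact: bx_sub.
rewrite /e; case: (boolP (i \in codom (val t.2))) => it;
  case: (boolP (i \in codom (val t'.2))) => it'; rewrite ?expr0 ?expr1 ?mul1r ?mulr1.
- rewrite (_ : _ `&` _ = set0).
    by rewrite {1}/q measure0 mulr_ge0// mulr_ge0// (le_trans ler01).
  apply/seteqP; split => // x [x1 x2]; move/eqP : QQ'; apply.
  by apply: (cl_disj (sub _ _ it _ x1) (sub _ _ it' _ x2)).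
- apply: (@le_trans _ _ (q (slot Q t i))).
    by apply: q_sub; [apply: measurableI; exact: mslot|exact: mslot|exact: subIsetl].
  by rewrite (slot_out Q' it') mulrCA ler_peMr.
- apply: (@le_trans _ _ (q (slot Q' t' i))).
    by apply: q_sub; [apply: measurableI; exact: mslot|exact: mslot|exact: subIsetr].
  by rewrite (slot_out Q it) mulrA ler_peMl.
- rewrite (slot_out Q it) (slot_out Q' it') -setCU q_C; last exact: measurableU.
  rewrite !q_C//.
  have -> : q (cl Q `|` cl Q') = q (cl Q) + q (cl Q').
    apply: EFin_inj; rewrite EFinD -!muE//; last exact: measurableU.
    rewrite measureU//; apply/seteqP; split => // x [x1 x2]; move/eqP: QQ'; apply.
    exact: cl_disj x1 x2.
  have := mulr_ge0 (q0 (cl Q)) (q0 (cl Q')); nra.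
Qed.

Definition arrangements_mean : R := mean_count P arranged.

Lemma arrangements_mean_ge :
  #|C|%:R * (#|V|%:R * (n ^_ m)%:R) * (pi0 * (1 - rho) ^+ n) <= arrangements_mean.
Proof.
rewrite /arrangements_mean /mean_count.
have -> : #|C|%:R * (#|V|%:R * (n ^_ m)%:R) * (pi0 * (1 - rho) ^+ n) =
    \sum_(Q : C) \sum_(t : arrangement) (pi0 * (1 - rho) ^+ n).
  rewrite !sumr_const -!mulrnA -[RHS]mulr_natl natrM; congr (_ * _).
  rewrite mulrC; congr (_ * _).
  rewrite card_prod natrM; congr (_ * _%:R).
  rewrite card_sig -{1}(card_ord n) -{1}(card_ord m) -card_inj_ffuns -cardsE.
  by apply: eq_card => f; rewrite !inE.
apply: ler_sum => Q _; apply: ler_sum => t _; rewrite arrE/=.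
have r1 : 0 <= 1 - rho by move: rho2; lra.
have r2 : 1 - rho <= 1 by rewrite gerBl.
rewrite (bigID (fun i => i \in codom (val t.2)))/=.
apply: ler_pM; [by []|exact: exprn_ge0| |].
  have -> : \prod_(i | i \in codom (val t.2)) q (slot Q t i) = \prod_k q (bx Q t.1 k).
    rewrite -(@big_uniq _ _ _ _ (codom (val t.2)))/=; last first.
      by apply/injectiveP; exact: arr_inj.
    by rewrite /codom /image_mem big_map big_enum/=; apply: eq_bigr => k _; rewrite slot_img.
  have := bx_ge Q t.1.
  rewrite (eq_bigr (fun k => (q (bx Q t.1 k))%:E)) => [|k _]; last exact: muE.
  by rewrite prodEFin lee_fin.
apply: (@le_trans _ _ (\prod_(i | i \notin codom (val t.2)) (1 - rho))).
  rewrite prodr_const ler_wiXn2l//.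
  by rewrite (leq_trans (max_card _))// card_ord.
apply: ler_prod => i it; rewrite r1/= (slot_out Q it) q_C// lerD2l lerN2.
by rewrite -lee_fin -muE.
Qed.

Lemma arrangements_tail : 0 < arrangements_mean ->
  (P [set w | (count R arranged w <= arrangements_mean / 2)%R] <=
   (4 * (m ^ m)%:R / arrangements_mean + 4 * (a ^+ (2 * m) - 1))%:E)%E.
Proof.
move=> b0; apply: count_lower_tail => //.
- exact: measurable_arranged.
- exact: exprn_ege1.
- exact: arranged_indep.
- exact: arranged_mult.
Qed.

Lemma count_le_occupied w :
  count R arranged w <= (m ^ m)%:R * #|[pred Q | `[< exists t, arranged Q t w >]]|%:R :> R.
Proof.
rewrite -sum1_card natr_sum mulr_sumr [leRHS]big_mkcond/=; apply: ler_sum => Q _.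
case: ifPn => [_|]; first by rewrite mulr1; exact: arranged_mult.
rewrite unfold_in/= => /asboolP H; rewrite big1// => t _; rewrite indicE memNset// => Et.
by apply: H; exists t.
Qed.

End occupancy.

(** * Dyadic cells and configurations of points *)

Local Close Scope classical_set_scope.

Section dyadic_boxes.
Context (R : realType) (d : nat) (s : 'I_d -> nat).
Implicit Types (Q : cell s) (u : 'rV[R]_d) (w : R).

Lemma natr_floor_uniq (a b : nat) (t : R) :
  a%:R <= t < a%:R + 1 -> b%:R <= t < b%:R + 1 -> a = b.
Proof.
rewrite !natr1 => /andP[a1 a2] /andP[b1 b2]; apply/eqP.
rewrite eqn_leq; apply/andP; split; rewrite -ltnS -(ltr_nat R).
- exact: le_lt_trans a1 b2.
- exact: le_lt_trans b1 a2.
Qed.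

Lemma side_gt0 j : 0 < @side R d s j.
Proof. by rewrite /side invr_gt0 exprn_gt0. Qed.

Let pow2 j : 0 < 2 ^+ s j :> R. Proof. exact: exprn_gt0. Qed.

Lemma in_cell_coord Q (z : 'rV[R]_d) j : in_cell Q z ->
  ((Q j)%:R <= z 0 j * 2 ^+ s j < (Q j)%:R + 1) \/
  (z 0 j = 1 /\ (Q j).+1 = (2 ^ s j)%N).
Proof.
move=> /forallP/(_ j) /andP[c1 /orP[c2|/andP[/eqP ? /eqP ?]]]; [left|by right].
move: c1 c2; rewrite /corner /side -[X in _ < _ + X]mul1r -mulrDl.
by rewrite ler_pdivrMr// ltr_pdivlMr// => -> ->.
Qed.

(** Up to scaling, the index of the interval is the integer part of the
    coordinate, except for the last interval, which also contains 1. *)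
Lemma cell_uniq Q Q' (z : 'rV[R]_d) : in_cell Q z -> in_cell Q' z -> Q = Q'.
Proof.
move=> zQ zQ'; apply/ffunP => j; apply/val_inj => /=.
have last (T : cell s) : z 0 j = 1 ->
    (T j)%:R <= z 0 j * 2 ^+ s j < (T j)%:R + 1 -> False.
  move=> -> ; rewrite mul1r -natrX => H.
  have E : (T j : nat) = (2 ^ s j)%N.
    by apply: (natr_floor_uniq H); rewrite lexx ltrDl ltr01.
  by have := ltn_ord (T j); rewrite E ltnn.
case: (in_cell_coord j zQ) => [H|[z1 e]]; case: (in_cell_coord j zQ') => [H'|[z1' e']].
- exact: natr_floor_uniq H H'.
- by case: (last Q z1').
- by case: (last Q' z1).
- by apply: succn_inj; rewrite e e'.
Qed.

Definition cell_set Q : set (Rd R d) := [set x | in_cell Q (pt x)]%classic.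

(** The box with lower corner u and side w in the local coordinates of Q. *)
Definition lbox Q u w : set (Rd R d) :=
  [set x | forall j, `[corner R Q j + @side R d s j * u 0 j,
                      corner R Q j + side R s j * (u 0 j + w)[%classic (tnth x j)]%classic.

Definition lcoord Q (x : 'rV[R]_d) : 'rV[R]_d :=
  \row_j ((x 0 j - corner R Q j) / side R s j).

Lemma lbox_lcoord Q u w x : lbox Q u w x ->
  forall j, u 0 j <= lcoord Q (pt x) 0 j < u 0 j + w.
Proof.
move=> H j; have := H j; rewrite /= in_itv/= !mxE => /andP[h1 h2].
rewrite ler_pdivlMr ?side_gt0// ltr_pdivrMr ?side_gt0//.
by rewrite lerBrDl ltrBlDl mulrC h1 mulrC.
Qed.

Lemma lbox_sub Q u w : (forall j, 0 <= u 0 j /\ u 0 j + w <= 1) ->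
  (lbox Q u w `<=` cell_set Q)%classic.
Proof.
move=> hu x H; apply/forallP => j; have := H j; rewrite /= in_itv/= => /andP[h1 h2].
have [u0 uw] := hu j; rewrite mxE; apply/andP; split.
  by apply: le_trans h1; rewrite lerDl mulr_ge0// ltW// side_gt0.
apply/orP; left; apply: (lt_le_trans h2); rewrite lerD2l.
by rewrite -[leRHS]mulr1; apply: ler_wpM2l => //; rewrite ltW// side_gt0.
Qed.

Lemma measurable_lbox Q u w : measurable (lbox Q u w).
Proof.
have -> : lbox Q u w = (\bigcap_(j in [set: 'I_d])
    ((fun x : Rd R d => tnth x j) @^-1` `[corner R Q j + side R s j * u 0 j,
                      corner R Q j + side R s j * (u 0 j + w)[))%classic.
  by apply/seteqP; split => x /= H j; [move=> _|]; exact: H.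
apply: fin_bigcap_measurable; first exact: finite_finset.
by move=> i _; rewrite -[X in measurable X]setTI; apply: measurable_tnth.
Qed.

Lemma prod_side : \prod_j @side R d s j = (2 ^+ (\sum_j s j)%N)^-1.
Proof. by rewrite /side prodfV -expr_sum. Qed.

Lemma leb_lbox Q u w : 0 <= w ->
  leb R d (lbox Q u w) = (w ^+ d / 2 ^+ (\sum_j s j)%N)%:E.
Proof.
move=> w0; pose B j : set (measurableTypeR R) :=
  `[corner R Q j + side R s j * u 0 j, corner R Q j + side R s j * (u 0 j + w)[%classic.
rewrite -[lbox Q u w]/[set x | forall j, B j (tnth x j)]%classic.
rewrite leb_box; last by move=> j; exact: measurable_itv.
transitivity (\prod_(j < d) (side R s j * w)%:E)%E.
  apply: eq_bigr => j _; rewrite /B lebesgue_measure_itv/= lte_fin ltrD2l.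
  rewrite -EFinD; have [|] := ltP.
    by move=> _; congr (_%:E); ring.
  rewrite ler_pM2l ?side_gt0// => uw; have -> : w = 0 by apply/eqP; rewrite eq_le w0 andbT; lra.
  by rewrite mulr0.
rewrite prodEFin big_split/= prod_side prodr_const card_ord mulrC.
by [].
Qed.

Lemma measurable_cell_set Q : measurable (cell_set Q).
Proof.
have -> : cell_set Q = (\bigcap_(j in [set: 'I_d])
   ((fun x : Rd R d => tnth x j) @^-1` [set t : R | (corner R Q j <= t) &&
     ((t < corner R Q j + side R s j) || (t == 1) && ((Q j).+1 == 2 ^ s j)%N)]))%classic.
  apply/seteqP; split => x.
    by move=> /forallP H j _ /=; have := H j; rewrite mxE.
  by move=> H; apply/forallP => j; have := H j I; rewrite /= mxE.
apply: fin_bigcap_measurable; first exact: finite_finset.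
move=> j _; rewrite -[X in measurable X]setTI; apply: measurable_tnth => //.
have -> : [set t : R | (corner R Q j <= t) &&
     ((t < corner R Q j + side R s j) || (t == 1) && ((Q j).+1 == 2 ^ s j)%N)]%classic =
  (`[corner R Q j, corner R Q j + side R s j[ `|`
    (if (corner R Q j <= 1) && ((Q j).+1 == 2 ^ s j)%N then [set 1] else set0))%classic.
  apply/seteqP; split => t /=; rewrite in_itv/=.
    move=> /andP[c1 /orP[c2|/andP[/eqP t1 e]]]; first by left; rewrite c1.
    by right; rewrite -t1 c1 e.
  case=> [/andP[-> ->]//|]; case: ifP => // /andP[c1 e] /= ->.
  by rewrite c1 e eqxx orbT.
apply: measurableU; first exact: measurable_itv.
by case: ifP => _; [exact: measurable_set1|exact: measurable0].
Qed.

Lemma leb_cell_set Q : (leb R d (cell_set Q) <= (2 ^+ (\sum_j s j)%N)^-1%:E)%E.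
Proof.
have sub : (cell_set Q `<=` [set x | forall j, `[corner R Q j, corner R Q j + side R s j]%classic (tnth x j)])%classic.
  move=> x /forallP H j; have /andP[h1 h2] := H j; rewrite /= in_itv/=.
  rewrite mxE in h1 h2; rewrite h1/=; move: h2 => /orP[/ltW//|/andP[/eqP -> /eqP e]].
  rewrite /corner /side -[X in _ + X]mul1r -mulrDl natr1 e natrX divff// gt_eqF//.
pose B j : set (measurableTypeR R) := `[corner R Q j, corner R Q j + side R s j]%classic.
have mB j : measurable (B j) by exact: measurable_itv.
apply: (@le_trans _ _ (leb R d [set x | forall j, B j (tnth x j)]%classic)).
  apply: le_measure; rewrite ?inE//; first exact: measurable_cell_set.
  have -> : [set x : Rd R d | forall j, B j (tnth x j)]%classic =
     (\bigcap_(j in [set: 'I_d]) ((fun x : Rd R d => tnth x j) @^-1` B j))%classic.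
    by apply/seteqP; split => x /= H j; [move=> _|]; exact: H.
  apply: fin_bigcap_measurable; first exact: finite_finset.
  by move=> i _; rewrite -[X in measurable X]setTI; apply: measurable_tnth.
rewrite leb_box// (eq_bigr (fun j => (side R s j)%:E)) => [|j _].
  by rewrite prodEFin prod_side.
rewrite /B lebesgue_measure_itv/= lte_fin ltrDl side_gt0.
by rewrite -EFinD; congr (_%:E); ring.
Qed.

End dyadic_boxes.

Section occupied_cells.
Context (R : realType) (d ell : nat).
Variables (psi : 'I_(qdim d ell) -> mpoly.mpoly d R) (s : 'I_d -> nat).
Variables (m0 : nat) (u : 'I_m0 -> 'rV[R]_d) (eta k0 L h : R) (K : nat).
Hypotheses (qm : (qdim d ell <= m0)%N) (eta_gt0 : 0 < eta) (k0_gt0 : 0 < k0)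
  (u_in : forall a j, 0 <= u a 0 j /\ u a 0 j + eta <= 1)
  (u_low : forall u' : 'I_m0 -> 'rV[R]_d, (forall a, unit_cube (u' a)) ->
        (forall a, `|u a - u' a| <= eta) ->
        forall c, k0 * dotp c c <= \sum_a dotp c (feat psi (u' a)) ^+ 2)
  (L0 : 0 <= L)
  (L_lip : forall u u', unit_cube u -> unit_cube u' ->
     dotp (feat psi u - feat psi u') (feat psi u - feat psi u') <= L ^+ 2 * `|u - u'| ^+ 2)
  (eta1 : eta <= 1) (eta_small : L ^+ 2 * eta ^+ 2 <= k0)
  (K_gt0 : (0 < K)%N) (Kh : 1 <= K%:R * h).

(** An anchor box for each of the m0 anchors, and twice the same small box, so
    that the last two points of a configuration are at distance at most h. *)
Definition config_box (Q : cell s) (v : {ffun 'I_d -> 'I_K}) (k : 'I_(m0 + 2)) :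
    set (Rd R d) :=
  match fintype.split k with
  | inl a => lbox Q (u a) eta
  | inr _ => lbox Q (\row_j (eta / K%:R * (v j)%:R)) (eta / K%:R)
  end.

Let K0 : 0 < K%:R :> R. Proof. by rewrite ltr0n. Qed.
Let etaK0 : 0 < eta / K%:R. Proof. exact: divr_gt0. Qed.

Lemma measurable_config_box Q v k : measurable (config_box Q v k).
Proof. by rewrite /config_box; case: (fintype.split k) => a; exact: measurable_lbox. Qed.

Lemma config_box_sub Q v k : (config_box Q v k `<=` cell_set Q)%classic.
Proof.
rewrite /config_box; case: (fintype.split k) => a; apply: lbox_sub => // j.
rewrite mxE; split; first by rewrite mulr_ge0// ltW.
rewrite -[X in _ + X]mulr1 -mulrDr natr1 mulrAC ler_pdivrMr// mul1r.
rewrite -[leRHS]mul1r; apply: ler_pM => //; first exact: ltW.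
by rewrite ler_nat.
Qed.

Lemma config_box_disj Q v v' x : config_box Q v (rshift m0 ord0) x ->
  config_box Q v' (rshift m0 ord0) x -> v = v'.
Proof.
rewrite /config_box (unsplitK (inr ord0)) => H H'; apply/ffunP => j; apply/val_inj => /=.
have E (w : {ffun 'I_d -> 'I_K}) :
    lbox Q (\row_j (eta / K%:R * (w j)%:R)) (eta / K%:R) x ->
    (w j)%:R <= lcoord Q (pt x) 0 j / (eta / K%:R) < (w j)%:R + 1.
  move=> /lbox_lcoord/(_ j); set t := lcoord _ _ _ _; rewrite mxE => /andP[h1 h2].
  by rewrite ler_pdivlMr// ltr_pdivrMr// mulrDl mul1r mulrC h1.
exact: natr_floor_uniq (E _ H) (E _ H').
Qed.

Let lt2 : (1 < 2)%N. Proof. by []. Qed.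
Let ka : 'I_(m0 + 2) := rshift m0 ord0.
Let kb : 'I_(m0 + 2) := rshift m0 (Ordinal lt2).

Lemma lcoord_cube (Q : cell s) (z : 'rV[R]_d) : in_cell Q z -> unit_cube (lcoord Q z).
Proof.
move=> zQ j; rewrite mxE.
have [/andP[h1 h2]|[z1 e]] := in_cell_coord j zQ.
  have s0 : 0 <= side R s j by apply: ltW; exact: side_gt0.
  rewrite divr_ge0 ?subr_ge0//; last first.
    by rewrite /corner ler_pdivrMr// exprn_gt0.
  rewrite ler_pdivrMr ?side_gt0// mul1r lerBlDl /corner /side.
  rewrite -[X in _ + X]mul1r -mulrDl ler_pdivlMr ?exprn_gt0//.
  exact: ltW.
have p0 : 0 < 2 ^+ s j :> R by exact: exprn_gt0.
have -> : z 0 j - corner R Q j = side R s j.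
  rewrite z1 /corner /side; have -> : (Q j)%:R = 2 ^+ s j - 1 :> R.
    by rewrite -natrX -[in RHS]e -natr1 addrK.
  by field; rewrite gt_eqF.
by rewrite divff ?gt_eqF ?side_gt0// ler01 lexx.
Qed.

Section one_configuration.
Context (n : nat) (X : 'I_n -> Rd R d) (Q : cell s) (v : {ffun 'I_d -> 'I_K}).
Variable f : 'I_(m0 + 2) -> 'I_n.
Hypotheses (f_inj : injective f) (Xf : forall k, config_box Q v k (X (f k)))
  (f_codom : forall i, (i \in codom f) <-> cell_set Q (X i)).
Let x i := pt (X i).

Let mem i : (i \in members x Q) = (i \in codom f).
Proof.
by rewrite inE; apply/idP/idP => H; apply/f_codom.
Qed.

Let memf k : f k \in members x Q. Proof. by rewrite mem codom_f. Qed.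

Let cardQ : #|members x Q| = (m0 + 2)%N.
Proof. by rewrite (eq_card mem) card_codom// card_ord. Qed.

Let cube i : i \in members x Q -> unit_cube (local_coord x Q i).
Proof. by rewrite inE => H; exact: lcoord_cube. Qed.

Let low c : k0 * dotp c c <= \sum_(i in members x Q) dotp c (cfeat psi x Q i) ^+ 2.
Proof.
apply: (@le_trans _ _ (\sum_a dotp c (cfeat psi x Q (f (lshift 2 a))) ^+ 2)).
  apply: u_low => a; first exact/cube/memf.
  rewrite row_norm_le ?(ltW eta_gt0)// => j; rewrite !mxE.
  have := Xf (lshift 2 a); rewrite /config_box (unsplitK (inl a)) => /lbox_lcoord/(_ j).
  rewrite mxE /x mxE => /andP[h1 h2]; rewrite ler_norml; apply/andP; split; lra.
rewrite (eq_bigl _ _ mem).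
rewrite -(@big_uniq _ _ _ _ (codom f))/=; last exact/injectiveP.
rewrite /codom /image_mem big_map big_enum/= big_split_ord/= lerDl.
by apply: sumr_ge0 => a _; exact: sqr_ge0.
Qed.

Let retained : retained_cell psi (m0 + 2) (k0 / (m0 + 2)%:R) x Q.
Proof.
rewrite /retained_cell cardQ leqnn andbT addn2 ltnS (leq_trans qm)//=.
have N0 : 0 < m0.+2%:R :> R by rewrite ltr0n.
apply/le_lambda_min; first exact: qdim_gt0.
  by rewrite gramE linearZ/= fgram_sym.
move=> c; rewrite gramE -scalemxAr dotpZl dotp_fgram.
by rewrite mulrAC mulrC ler_pM2l ?invr_gt0//; exact: low.
Qed.

Let close : `|local_coord x Q (f ka) - local_coord x Q (f kb)| <= eta / K%:R.
Proof.
rewrite row_norm_le ?(ltW etaK0)// => j.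
have H k : k = ka \/ k = kb -> eta / K%:R * (v j)%:R <= local_coord x Q (f k) 0 j
     < eta / K%:R * (v j)%:R + eta / K%:R.
  move=> kE; have := Xf k.
  have -> : config_box Q v k = lbox Q (\row_j (eta / K%:R * (v j)%:R)) (eta / K%:R).
    case: kE => ->; rewrite /config_box /ka /kb; first by rewrite (unsplitK (inr ord0)).
    by rewrite (unsplitK (inr (Ordinal lt2))).
  by move=> /lbox_lcoord/(_ j); rewrite [(\row_j _) _ _]mxE.
have /andP[a1 a2] := H ka (or_introl erefl).
have /andP[b1 b2] := H kb (or_intror erefl).
by rewrite !mxE in a1 a2 b1 b2 *; rewrite ler_norml; apply/andP; split; lra.
Qed.

Let etaKh : eta / K%:R <= h.
Proof.
rewrite ler_pdivrMr// mulrC; exact: le_trans eta1 Kh.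
Qed.

Let good i1 i2 : i1 \in members x Q -> i2 \in members x Q -> (i1 < i2)%N ->
  `|local_coord x Q i1 - local_coord x Q i2| <= eta / K%:R ->
  (Q, (i1, i2)) \in edges psi s (m0 + 2) (k0 / (m0 + 2)%:R) 1 h x.
Proof.
move=> i1Q i2Q i12 cl.
rewrite inE/= retained i1Q i2Q i12 (le_trans cl etaKh)/= pair_vE//.
have dd : dotp (delta (cfeat psi x Q) i1 i2) (delta (cfeat psi x Q) i1 i2) <=
    (L * eta) ^+ 2.
  apply: le_trans (L_lip (cube i1Q) (cube i2Q)) _.
  rewrite exprMn; apply: ler_wpM2l; first exact: sqr_ge0.
  rewrite lerXn2r ?nnegrE// ?(ltW eta_gt0)//; apply: le_trans cl _.
  by rewrite ler_pdivrMr// ler_peMr ?(ltW eta_gt0)// ler1n.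
have i12' : i1 != i2 by apply: contraTneq i12 => ->; rewrite ltnn.
have Le0 : 0 <= L * eta by rewrite mulr_ge0// ltW.
have := resid_sq_ge k0_gt0 low Le0 i12' dd; apply: le_trans.
have : (L * eta) ^+ 2 / k0 <= 1 by rewrite ler_pdivrMr// mul1r exprMn.
by move: (_ / k0) => t; lra.
Qed.

(** The anchors bound the Gram matrix of the cell from below, and the two twin
    points are at distance at most h and have nearly equal features, so that
    their contrast keeps a residual variance of at least 1. *)
Lemma configuration_edge :
  exists i, (Q, i) \in edges psi s (m0 + 2) (k0 / (m0 + 2)%:R) 1 h x.
Proof.
have nab : f ka != f kb.
  by apply/eqP => /f_inj /rshift_inj /(congr1 val).
have [ab|ab] : (f ka < f kb)%N \/ (f kb < f ka)%N.
  by move: nab; rewrite -val_eqE/= neq_ltn => /orP[]; [left|right].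
- by exists (f ka, f kb); apply: good => //; exact: close.
- exists (f kb, f ka); apply: good => //.
  by rewrite -normrN opprB; exact: close.
Qed.

End one_configuration.

End occupied_cells.

Local Open Scope classical_set_scope.
Local Open Scope ring_scope.

Section dyadic_measurability.
Context (R : realType) (d : nat).

Lemma cell_exists (s : 'I_d -> nat) (z : 'rV[R]_d) : unit_cube z ->
  exists Q : cell s, in_cell Q z.
Proof.
move=> cz; pose t j := Num.truncn (z 0 j * 2 ^+ s j).
have lt j : (minn (t j) (2 ^ s j).-1 < 2 ^ s j)%N.
  by rewrite (leq_ltn_trans (geq_minr _ _))// prednK// expn_gt0.
pose Q : cell s := [ffun j => Ordinal (lt j)].
exists Q; apply/forallP => j; have /andP[z0 z1] := cz j.
have p0 : 0 < 2 ^+ s j :> R by exact: exprn_gt0.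
have zp : 0 <= z 0 j * 2 ^+ s j by rewrite mulr_ge0// ltW.
rewrite /corner /side ffunE/= -[X in _ < _ + X]mul1r -mulrDl ler_pdivrMr// ltr_pdivlMr//.
have /andP[t1 t2] := truncn_itv zp; rewrite -/(t j) in t1 t2.
have [tl|tg] := leqP (t j) (2 ^ s j).-1.
  by rewrite t1/= natr1 t2.
have {}tg : 2 ^+ s j <= z 0 j * 2 ^+ s j.
  apply: le_trans t1; rewrite -natrX ler_nat.
  by rewrite -(prednK (expn_gt0 2 (s j))).
have -> : z 0 j = 1.
  by apply/eqP; rewrite eq_le z1/= -(ler_pM2r p0) mul1r.
rewrite mul1r eqxx prednK ?expn_gt0// eqxx orbT andbT -natrX ler_nat.
exact: leq_pred.
Qed.

Lemma measurable_cube : measurable (@cube_Rd R d).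
Proof.
have -> : @cube_Rd R d = \bigcap_(j in [set: 'I_d])
    ((fun x : Rd R d => tnth x j) @^-1` `[0, 1]).
  apply/seteqP; split => x H j.
    by move=> _; have := H j; rewrite /= mxE in_itv.
  by have := H j I; rewrite /= in_itv mxE.
apply: fin_bigcap_measurable; first exact: finite_finset.
move=> i _; rewrite -[X in measurable X]setTI; exact: measurable_tnth.
Qed.

(** A function continuous at the points of the cube is there the limit of the
    step functions that take its values at the corners of the dyadic cells. *)
Lemma measurable_on_cube (g : 'rV[R]_d -> R) :
  (forall x, unit_cube x -> {for x, continuous g}) ->
  measurable_fun (@cube_Rd R d) (fun x => g (pt x)).
Proof.
move=> cg; pose c k (Q : cell (fun _ : 'I_d => k)) : 'rV[R]_d := \row_j corner R Q j.
pose h k (x : Rd R d) := \sum_(Q : cell (fun _ : 'I_d => k)) \1_(cell_set Q) x * g (c k Q).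
apply: (@measurable_fun_cvg _ _ _ _ h) => [k|x cx].
  apply: measurable_sum => Q; apply: measurable_funM; last exact: measurable_cst.
  apply: measurable_funTS; apply: measurable_indic; exact: measurable_cell_set.
have hE k : exists2 y : 'rV[R]_d, h k x = g y & `|pt x - y| <= 2 ^- k.
  have [Q xQ] := cell_exists (fun=> k) cx; exists (c k Q).
    rewrite /h (bigD1 Q)//= big1 ?addr0 => [|Q' QQ'].
      by rewrite indicE mem_set ?mul1r.
    rewrite indicE memNset ?mul0r// => xQ'; move/eqP: QQ'; apply.
    exact: cell_uniq xQ' xQ.
  rewrite row_norm_le ?invr_ge0 ?exprn_ge0// => j; rewrite 2!mxE [(- c k Q) _ _]mxE mxE.
  have := lcoord_cube xQ j; rewrite !mxE.
  have p0 := side_gt0 R (fun=> k) j.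
  rewrite ler_pdivlMr// mul0r ler_pdivrMr// mul1r => /andP[h1 h2].
  by rewrite ger0_norm.
apply/cvgrPdist_lt => e e0.
have /cvgrPdist_lt/(_ _ e0)/nbhs_ballP[r r0 Hr] := cg _ cx.
have := @cvg_geometric R 1 2^-1; rewrite ger0_norm ?invr_ge0// invf_lt1// ltr1n => /(_ isT).
move=> /cvgrPdist_lt/(_ _ r0); apply: filterS => k.
rewrite /geometric/= mul1r sub0r normrN ger0_norm ?exprn_ge0 ?invr_ge0// => kr.
have [y -> xy] := hE k; apply: Hr; rewrite -ball_normE/=.
by apply: le_lt_trans xy _; rewrite -exprVn.
Qed.

End dyadic_measurability.

(** * Lower tail of the number of retained pairs *)

Section cell_number.
Context (R : realType) (lambda0 : R) (l0 : 0 < lambda0).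

Lemma Jn_bounds n : (0 < n)%N ->
  n%:R / (2 * lambda0) <= (Jn lambda0 n)%:R <= (2 / lambda0 + 1) * n%:R.
Proof.
move=> n0; have n0' : 0 < n%:R :> R by rewrite ltr0n.
have q0 : 0 < n%:R / lambda0 by exact: divr_gt0.
pose t := log2 (n%:R / lambda0).
have ln2 : 0 < ln 2 :> R by rewrite ln_gt0// ltr1n.
have E : 2 `^ t = n%:R / lambda0.
  by rewrite /powR pnatr_eq0/= /t /log2 divfK ?gt_eqF// lnK.
have half : 2 `^ 2^-1 <= 2 :> R.
  by rewrite -[leRHS]powRr1// ler_powR ?ler1n// invf_le1// ler1n.
have mn : 2 `^ (- 2^-1) >= 2^-1 :> R.
  by rewrite powRN lef_pV2 ?posrE// powR_gt0.
have f1 : (round t)%:~R <= t + 2^-1 by exact: floor_le.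
have f2 : t - 2^-1 < (round t)%:~R.
  have := floorD1_gt (t + 2^-1); rewrite intrD /round; lra.
rewrite /Jn /rn -/t; have [r0|r0] := leP 0 (round t).
  have Z : (2 ^ `|round t|%N)%:R = 2 `^ ((round t)%:~R) :> R.
    by rewrite natrX -powR_mulrn// natr_absz ger0_norm.
  rewrite Z; apply/andP; split.
    apply: (@le_trans _ _ (2 `^ (t - 2^-1))); last by rewrite ler_powR ?ler1n// ltW.
    rewrite powRD ?pnatr_eq0 ?implybT// E invfM mulrCA mulrC.
    by apply: ler_wpM2l => //; exact: ltW.
  apply: (@le_trans _ _ (2 `^ (t + 2^-1))); first by rewrite ler_powR ?ler1n.
  rewrite powRD ?pnatr_eq0 ?implybT// E mulrDl mul1r.
  apply: (@le_trans _ _ (n%:R / lambda0 * 2)); first by rewrite ler_wpM2l// ltW.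
  by rewrite mulrAC -mulrA mulrC -!mulrA lerDl.
have t0 : t < 2^-1.
  have : (round t)%:~R <= -1 :> R by rewrite -[-1]/((-1)%:~R) ler_int; lia.
  lra.
rewrite /= expn0; have n1 : 1 <= n%:R :> R by rewrite ler1n.
have nl : n%:R / lambda0 <= 2.
  rewrite -E; apply: le_trans half; by rewrite ler_powR ?ler1n// ltW.
apply/andP; split; first by rewrite invfM mulrCA mulrC; lra.
rewrite mulrDl mul1r; have : 0 <= 2 / lambda0 * n%:R by rewrite mulr_ge0// divr_ge0// ltW.
by lra.
Qed.

Lemma Jn_gt0 n : 0 < (Jn lambda0 n)%:R :> R.
Proof. by rewrite ltr0n expn_gt0. Qed.

End cell_number.

Lemma ffact_ge n m : (m <= n)%N -> (n ^ m <= m ^ m * n ^_ m)%N.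
Proof.
move=> mn; rewrite ffact_prod -[X in (X ^ m <= _)%N](card_ord n).
have -> : (m ^ m = \prod_(i < m) m)%N by rewrite prod_nat_const card_ord.
have -> : (#|'I_n| ^ m = \prod_(i < m) n)%N by rewrite prod_nat_const !card_ord.
rewrite -big_split/=; apply: leq_prod => i _.
have im := ltn_ord i; nia.
Qed.

Lemma exp_sub1_le (R : realType) (x : R) : expR x - 1 <= x * expR x.
Proof.
have := expR_ge1Dx (- x); rewrite expRN => H.
have e0 := expR_gt0 x; rewrite lerBlDr -lerBlDl.
have : (1 - x) * expR x <= 1 by rewrite -ler_pdivlMr// mul1r; exact: H.
by rewrite mulrBl mul1r; lra.
Qed.

Lemma mxM_design (R : realType) (d n : nat) d0 (Omega : measurableType d0)
    (P : probability Omega R) (Z : 'I_n -> {RV P >-> (Rd R d * measurableTypeR R)%type}) i :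
  mxM (fun w => pt (Z i w).1).
Proof.
move=> a j; rewrite (_ : (fun _ => _) = fun w => tnth (Z i w).1 j); last first.
  by apply/funext => w; rewrite mxE.
have mt : measurable_fun setT (fun x : Rd R d => tnth x j) by exact: measurable_tnth.
have mZ : measurable_fun setT (fun w => (Z i w).1) by exact: measurableT_comp.
exact: (measurableT_comp mt mZ).
Qed.

Section design_law.
Context (R : realType) (d : nat) (theta : param R d) (plow phigh : R).
Hypotheses (plow0 : 0 <= plow) (phigh0 : 0 <= phigh)
  (mdens : measurable_fun (@cube_Rd R d) (fun x => dens theta (pt x)))
  (bdens : forall x, unit_cube x -> plow <= dens theta x <= phigh).
Context (n : nat) d0 (Omega : measurableType d0) (P : probability Omega R)
  (Z : 'I_n -> {RV P >-> (Rd R d * measurableTypeR R)%type}).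
Hypothesis iid : iid_sample theta Z.

Let mX i : measurable_fun setT (fun w => (Z i w).1).
Proof. by apply: measurableT_comp => //. Qed.

Definition design_rv i : {mfun Omega >-> Rd R d} :=
  HB.pack (fun w => (Z i w).1) (isMeasurableFun.Build _ _ _ _ _ (mX i)).

Lemma design_law i (B : set (Rd R d)) : measurable B ->
  P (design_rv i @^-1` B) =
  (\int[leb R d]_(x in @cube_Rd R d `&` B) (dens theta (pt x))%:E)%E.
Proof.
move=> mB; have -> : design_rv i @^-1` B = Z i @^-1` (B `*` setT).
  by apply/seteqP; split => w //= [].
rewrite iid.2; last exact: measurableX.
rewrite [RHS]integral_mkcondr; apply: eq_integral => x _; rewrite patchE.
case: ifPn => [/set_mem Bx|/negP Bx].
  have -> : [set u | (B `*` setT) (x, reg theta (pt x) + u)] = setT.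
    by apply/seteqP; split.
  by rewrite prob_kernel mule1.
have -> : [set u | (B `*` setT) (x, reg theta (pt x) + u)] = set0.
  by apply/seteqP; split => // u [] /= /mem_set.
by rewrite measure0 mule0.
Qed.

Lemma design_law_le i (B : set (Rd R d)) : measurable B ->
  (P (design_rv i @^-1` B) <= phigh%:E * leb R d B)%E.
Proof.
move=> mB; rewrite design_law//.
have mCB := measurableI _ _ (@measurable_cube R d) mB.
have p0 x : cube_Rd x -> 0 <= dens theta (pt x).
  by move=> cx; have /andP[+ _] := bdens cx; exact: le_trans.
apply: (@le_trans _ _ (\int[leb R d]_(x in @cube_Rd R d `&` B) phigh%:E)%E).
  apply: ge0_le_integral => //.
  - by move=> x [cx _]; rewrite lee_fin p0.
  - apply/measurable_EFinP; apply: measurable_funS mdens => //; exact: measurable_cube.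
  - by move=> x [cx _]; rewrite lee_fin; have /andP[] := bdens cx.
rewrite integral_cst//; apply: lee_pmul => //; apply: le_measure; rewrite ?inE//.
Qed.

Lemma design_law_ge i (B : set (Rd R d)) : measurable B -> B `<=` @cube_Rd R d ->
  (plow%:E * leb R d B <= P (design_rv i @^-1` B))%E.
Proof.
move=> mB Bc; rewrite design_law// setIidr//.
rewrite -integral_cst//; apply: ge0_le_integral => //.
- apply/measurable_EFinP; apply: measurable_funS mdens => //; exact: measurable_cube.
- by move=> x Bx; rewrite lee_fin; have /andP[] := bdens (Bc _ Bx).
Qed.

Lemma design_indep i0 (A : 'I_n -> set (Rd R d)) : (forall i, measurable (A i)) ->
  P [set w | forall i, A i (design_rv i w)] =
  (\prod_i distribution P (design_rv i0) (A i))%E.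
Proof.
move=> mA; transitivity (P [set w | forall i, (A i `*` setT) (Z i w)]).
  by congr (P _); apply/seteqP; split => w /= H i; [split => //; exact: H|case: (H i)].
rewrite (iid.1 (fun i => A i `*` setT)); last by move=> i; exact: measurableX.
apply: eq_bigr => i _.
have -> : Z i @^-1` (A i `*` setT) = design_rv i @^-1` A i.
  by apply/seteqP; split => w //= [].
by rewrite design_law// -(design_law i0).
Qed.

End design_law.

Section numeric_bounds.
Context (R : realType) (d m : nat) (plow phigh eta lambda0 : R).
Hypotheses (plow0 : 0 < plow) (phigh0 : 0 < phigh) (eta0 : 0 < eta) (l0 : 0 < lambda0)
  (m_gt0 : (0 < m)%N).

Let c2 : R := 2 / lambda0 + 1.

(** The mean number of arrangements is at least
    J K^d n^_m ((plow eta^d / J)^m / K^(2d)) (1 - phigh / J)^n, for J cells and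
    K^d configurations; with J of order n and K of order 1 / h this is of order
    n h^d. *)
Definition mean_const : R :=
  (plow * eta ^+ d) ^+ m / (m ^ m)%:R * expR (- (4 * lambda0 * phigh)) / c2 ^+ m.-1 / 2 ^+ d.

Let c2_gt0 : 0 < c2.
Proof. by rewrite /c2 ltr_wpDl// divr_ge0// ltW. Qed.

Let mm0 : 0 < (m ^ m)%:R :> R.
Proof. by rewrite ltr0n expn_gt0 m_gt0. Qed.

Lemma mean_const_gt0 : 0 < mean_const.
Proof. by rewrite /mean_const !(mulr_gt0, invr_gt0, exprn_gt0, expR_gt0). Qed.

Variables (n : nat) (J K h : R).
Hypotheses (mn : (m <= n)%N) (J1 : n%:R / (2 * lambda0) <= J) (J2 : J <= c2 * n%:R)
  (rho2 : phigh / J <= 2^-1) (K0 : 0 < K) (h01 : 0 < h <= 1) (Kh : K * h <= 2).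

Let n0 : 0 < n%:R :> R. Proof. by rewrite ltr0n (leq_trans m_gt0). Qed.
Let J0 : 0 < J.
Proof. by apply: lt_le_trans J1; rewrite divr_gt0// mulr_gt0. Qed.
Let rho0 : 0 <= phigh / J. Proof. by rewrite divr_ge0// ltW. Qed.

Let inv_le : (1 - phigh / J)^-1 <= expR (2 * (phigh / J)).
Proof.
move: rho0 rho2; set t := phigh / J => t0 t2.
apply: le_trans (expR_ge1Dx _).
rewrite -[leLHS]mul1r ler_pdivrMr; last by lra.
nra.
Qed.

Let nJ : n%:R * (phigh / J) <= 2 * lambda0 * phigh.
Proof.
rewrite mulrA ler_pdivrMr// mulrAC; apply: ler_wpM2r; first exact: ltW.
by rewrite -ler_pdivrMl// ?mulr_gt0// mulrC.
Qed.

Lemma mean_numeric : mean_const * (n%:R * h ^+ d) <=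
  J * (K ^+ d * (n ^_ m)%:R) *
    ((plow * (eta ^+ d / J)) ^+ m / (K ^+ d) ^+ 2 * (1 - phigh / J) ^+ n).
Proof.
have [h0 h1] := andP h01.
have E1 : expR (- (4 * lambda0 * phigh)) <= (1 - phigh / J) ^+ n.
  have r1 : 0 < 1 - phigh / J by move: rho2; set t := phigh / J; lra.
  rewrite -[leRHS]invrK expRN lef_pV2 ?posrE ?invr_gt0 ?exprn_gt0 ?expR_gt0//.
  rewrite -exprVn; apply: (@le_trans _ _ (expR (2 * (phigh / J)) ^+ n)).
    by apply: lerXn2r; rewrite ?nnegrE ?invr_ge0 ?expR_ge0// ltW.
  rewrite -expRM_natl ler_expR mulrA mulrAC mulrC.
  move: nJ; set a := _ * _ => H; set b := _ * _; rewrite /b.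
  by rewrite -mulrA; move: H; rewrite /a; lra.
have E2 : n%:R ^+ m / (m ^ m)%:R <= (n ^_ m)%:R :> R.
  by rewrite ler_pdivrMr// -natrX -natrM ler_nat mulnC ffact_ge.
have E3 : n%:R / c2 ^+ m.-1 <= n%:R ^+ m / J ^+ m * J.
  rewrite -(prednK m_gt0) !exprS /= invfM.
  have -> : n%:R * n%:R ^+ m.-1 * (J^-1 * J ^- m.-1) * J = n%:R * (n%:R ^+ m.-1 / J ^+ m.-1).
    by field; rewrite expf_neq0 gt_eqF.
  apply: ler_wpM2l; first exact: ltW.
  rewrite -expr_div_n -exprVn; apply: lerXn2r; rewrite ?nnegrE ?invr_ge0 ?divr_ge0 ?(ltW c2_gt0) ?(ltW n0) ?(ltW J0)//.
  by rewrite ler_pdivlMr// mulrC ler_pdivrMr// mulrC.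
have E4 : h ^+ d / 2 ^+ d <= (K ^+ d)^-1.
  rewrite -expr_div_n -exprVn; apply: lerXn2r; rewrite ?nnegrE ?invr_ge0 ?divr_ge0 ?(ltW h0) ?(ltW K0)//.
  by rewrite ler_pdivrMr// mulrC ler_pdivlMr// mulrC.
have Kd : 0 < K ^+ d by exact: exprn_gt0.
have Jm : 0 < J ^+ m by exact: exprn_gt0.
have -> : J * (K ^+ d * (n ^_ m)%:R) *
    ((plow * (eta ^+ d / J)) ^+ m / (K ^+ d) ^+ 2 * (1 - phigh / J) ^+ n) =
  (plow * eta ^+ d) ^+ m * ((n ^_ m)%:R * (J / J ^+ m)) * (1 - phigh / J) ^+ n * (K ^+ d)^-1.
  have -> : (plow * (eta ^+ d / J)) ^+ m = (plow * eta ^+ d) ^+ m / J ^+ m.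
    by rewrite mulrA expr_div_n.
  field.
  by rewrite !gt_eqF.
have -> : mean_const * (n%:R * h ^+ d) =
  (plow * eta ^+ d) ^+ m * ((m ^ m)%:R^-1 * (n%:R / c2 ^+ m.-1))
     * expR (- (4 * lambda0 * phigh)) * (h ^+ d / 2 ^+ d).
  by rewrite /mean_const; ring.
have pm : 0 <= (plow * eta ^+ d) ^+ m by rewrite exprn_ge0// mulr_ge0 ?exprn_ge0// ltW.
have e0 := expR_ge0 (- (4 * lambda0 * phigh)).
have q0 : 0 <= (m ^ m)%:R^-1 * (n%:R / c2 ^+ m.-1).
  by rewrite !mulr_ge0// ?invr_ge0 ?exprn_ge0// ltW.
apply: ler_pM => //.
- by apply: mulr_ge0 => //; exact: mulr_ge0.
- by rewrite divr_ge0 ?exprn_ge0// ltW.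
apply: ler_pM => //; first exact: mulr_ge0.
apply: ler_wpM2l => //.
apply: (@le_trans _ _ ((m ^ m)%:R^-1 * (n%:R ^+ m / J ^+ m * J))).
  by apply: ler_wpM2l => //; rewrite invr_ge0 ltW.
have -> : (m ^ m)%:R^-1 * (n%:R ^+ m / J ^+ m * J) = (n%:R ^+ m / (m ^ m)%:R) * (J / J ^+ m).
  by ring.
by apply: ler_wpM2r => //; rewrite divr_ge0 ?ltW.
Qed.

Definition tail_const : R :=
  4 * (m ^ m)%:R / mean_const + 4 * (8 * m%:R * phigh * lambda0 * expR (2 * m%:R)).

Lemma tail_const_gt0 : 0 < tail_const.
Proof.
apply: ltr_wpDr.
  apply: mulr_ge0 => //; apply: mulr_ge0; last exact: expR_ge0.
  apply: mulr_ge0; last exact: ltW.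
  apply: mulr_ge0; last exact: ltW.
  exact: mulr_ge0.
apply: divr_gt0; last exact: mean_const_gt0.
exact: mulr_gt0.
Qed.

Lemma tail_numeric b : mean_const * (n%:R * h ^+ d) <= b ->
  4 * (m ^ m)%:R / b + 4 * ((1 - phigh / J)^-1 ^+ (2 * m) - 1) <=
  tail_const / (n%:R * h ^+ d).
Proof.
move=> bb; have [h0 h1] := andP h01; have c0 := mean_const_gt0.
have nh : 0 < n%:R * h ^+ d by rewrite mulr_gt0// exprn_gt0.
have b0 : 0 < b by apply: lt_le_trans bb; exact: mulr_gt0.
rewrite /tail_const [leRHS]mulrDl; apply: lerD.
  rewrite -!mulrA; apply: ler_wpM2l => //; apply: ler_wpM2l; first exact: ltW.
  by rewrite -invfM lef_pV2// posrE; exact: mulr_gt0.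
rewrite -mulrA; apply: ler_wpM2l => //.
have r1 : 0 < 1 - phigh / J by move: rho2; set t := phigh / J; lra.
have H1 : (1 - phigh / J)^-1 ^+ (2 * m) <= expR (4 * m%:R * (phigh / J)).
  apply: (@le_trans _ _ (expR (2 * (phigh / J)) ^+ (2 * m))).
    by apply: lerXn2r; rewrite ?nnegrE ?invr_ge0 ?expR_ge0// ltW.
  by rewrite -expRM_natl ler_expR natrM le_eqVlt; apply/orP; left; apply/eqP; ring.
apply: (@le_trans _ _ (expR (4 * m%:R * (phigh / J)) - 1)); first by rewrite lerD2r.
apply: le_trans (exp_sub1_le _) _.
have m0 : 0 <= m%:R :> R by [].
have H2 : expR (4 * m%:R * (phigh / J)) <= expR (2 * m%:R).
  rewrite ler_expR; move: rho2; set t := phigh / J => t2; nra.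
have H3 : phigh / J <= 2 * lambda0 * phigh / n%:R by rewrite ler_pdivlMr// mulrC.
have H4 : n%:R^-1 <= (n%:R * h ^+ d)^-1.
  rewrite lef_pV2 ?posrE// ger_pMr// exprn_ile1//; exact: ltW.
apply: (@le_trans _ _ (4 * m%:R * (2 * lambda0 * phigh / n%:R) * expR (2 * m%:R))).
  apply: ler_pM => //; [by apply: mulr_ge0 => //; exact: mulr_ge0|].
  by apply: ler_wpM2l => //; exact: mulr_ge0.
have -> : 4 * m%:R * (2 * lambda0 * phigh / n%:R) * expR (2 * m%:R) =
   8 * m%:R * phigh * lambda0 * expR (2 * m%:R) / n%:R by ring.
apply: ler_wpM2l => //; apply: mulr_ge0; last exact: expR_ge0.
apply: mulr_ge0; last exact: ltW.
apply: mulr_ge0; last exact: ltW.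
exact: mulr_ge0.
Qed.

End numeric_bounds.

Section many_edges.
Context (R : realType) (d ell : nat).
Variables (psi : 'I_(qdim d ell) -> mpoly.mpoly d R) (s : 'I_d -> nat).
Variables (m0 : nat) (u : 'I_m0 -> 'rV[R]_d) (eta k0 L h lambda0 plow phigh : R).
Hypotheses (qm : (qdim d ell <= m0)%N) (eta_gt0 : 0 < eta) (k0_gt0 : 0 < k0)
  (u_in : forall a j, 0 <= u a 0 j /\ u a 0 j + eta <= 1)
  (u_low : forall u' : 'I_m0 -> 'rV[R]_d, (forall a, unit_cube (u' a)) ->
        (forall a, `|u a - u' a| <= eta) ->
        forall c, k0 * dotp c c <= \sum_a dotp c (feat psi (u' a)) ^+ 2)
  (L0 : 0 <= L)
  (L_lip : forall u u', unit_cube u -> unit_cube u' ->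
     dotp (feat psi u - feat psi u') (feat psi u - feat psi u') <= L ^+ 2 * `|u - u'| ^+ 2)
  (eta1 : eta <= 1) (eta_small : L ^+ 2 * eta ^+ 2 <= k0)
  (h01 : 0 < h <= 1) (l0 : 0 < lambda0) (plow0 : 0 < plow) (phigh0 : 0 < phigh).
Variable theta : param R d.
Hypotheses
  (mdens : measurable_fun (@cube_Rd R d) (fun x => dens theta (pt x)))
  (bdens : forall x, unit_cube x -> plow <= dens theta x <= phigh).
Context (n : nat) d0 (Omega : measurableType d0) (P : probability Omega R)
  (Z : 'I_n -> {RV P >-> (Rd R d * measurableTypeR R)%type}).
Hypotheses (iid : iid_sample theta Z) (s_sum : (\sum_j s j)%N = rn lambda0 n)
  (mn : (m0 + 2 <= n)%N) (rho2 : phigh / (Jn lambda0 n)%:R <= 2^-1).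

Local Notation m := (m0 + 2)%N.
Let K : nat := (Num.truncn h^-1).+1.
Let n0 : (0 < n)%N. Proof. by apply: leq_trans mn; rewrite addn2. Qed.
Let i0 : 'I_n := Ordinal n0.
Let J : R := (Jn lambda0 n)%:R.
Let Je : 2 ^+ (\sum_j s j)%N = J. Proof. by rewrite s_sum /J /Jn natrX. Qed.
Let J0 : 0 < J. Proof. exact: Jn_gt0. Qed.
Let h0 : 0 < h. Proof. by case/andP: h01. Qed.
Let hinv0 : 0 <= h^-1. Proof. by rewrite invr_ge0 ltW. Qed.
Let K0 : 0 < K%:R :> R. Proof. by rewrite ltr0n. Qed.

Let Kh1 : 1 <= K%:R * h.
Proof.
have /andP[_ H] := truncn_itv hinv0.
by rewrite -ler_pdivrMr// mul1r ltW.
Qed.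

Let Kh2 : K%:R * h <= 2.
Proof.
have /andP[H _] := truncn_itv hinv0; have /andP[_ h1] := h01.
rewrite -ler_pdivlMr// /K -natr1.
have : 1 <= h^-1 by rewrite invf_ge1.
by move: H; set t := h^-1; lra.
Qed.

Let mu := distribution P (design_rv Z i0).
Let X i w := design_rv Z i w.
Let bx := @config_box R d s m0 u eta K.
Let cl := @cell_set R d s.
Let rho : R := phigh / J.
Let pi0 : R := (plow * (eta ^+ d / J)) ^+ m / (K%:R ^+ d) ^+ 2.

Let bx_sub Q v k : bx Q v k `<=` cl Q.
Proof. exact: config_box_sub. Qed.

Let cl_cube Q : cl Q `<=` @cube_Rd R d.
Proof.
move=> x /forallP xQ j; have /andP[h1 h2] := xQ j.
have p0 : 0 < 2 ^+ s j :> R by exact: exprn_gt0.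
have c0 : 0 <= corner R Q j by rewrite /corner divr_ge0// ltW.
rewrite (le_trans c0 h1)/=; move: h2 => /orP[h2|/andP[/eqP -> _]//].
apply: (le_trans (ltW h2)); rewrite /corner /side -[X in _ + X]mul1r -mulrDl.
by rewrite ler_pdivrMr// mul1r natr1 -natrX ler_nat ltn_ord.
Qed.

Let cl_le Q : (mu (cl Q) <= rho%:E)%E.
Proof.
have -> : mu (cl Q) = P (design_rv Z i0 @^-1` cl Q) by [].
have mc : measurable (cl Q) by exact: measurable_cell_set.
apply: le_trans (design_law_le (ltW plow0) (ltW phigh0) mdens bdens iid i0 mc) _.
rewrite /rho EFinM; apply: lee_pmul => //; first by rewrite lee_fin ltW.
by apply: le_trans (leb_cell_set R Q) _; rewrite Je.
Qed.

Let box_ge Q a w : 0 <= w -> lbox Q a w `<=` cl Q ->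
  ((plow * (w ^+ d / J))%:E <= mu (lbox Q a w))%E.
Proof.
move=> w0 sub.
have -> : mu (lbox Q a w) = P (design_rv Z i0 @^-1` lbox Q a w) by [].
have ml : measurable (lbox Q a w) by exact: measurable_lbox.
have lc : lbox Q a w `<=` @cube_Rd R d by move=> x /sub; exact: cl_cube.
have := design_law_ge (ltW plow0) mdens bdens iid i0 ml lc; apply: le_trans.
by rewrite leb_lbox// Je EFinM.
Qed.

Let bx_ge Q v : (pi0%:E <= \prod_k mu (bx Q v k))%E.
Proof.
have mu0 A : (0 <= mu A)%E by exact: measure_ge0.
pose wd (k : 'I_m) : R := if fintype.split k is inl _ then eta else eta / K%:R.
have wd0 k : 0 <= wd k.
  by rewrite /wd; case: (fintype.split k) => _; rewrite ?divr_ge0 ?(ltW eta_gt0)// ltW.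
apply: (@le_trans _ _ (\prod_(k < m) (plow * (wd k ^+ d / J)))%:E); last first.
  rewrite -prodEFin.
  suff [] : ((0 <= \prod_(k < m) (plow * (wd k ^+ d / J))%:E) /\
      (\prod_(k < m) (plow * (wd k ^+ d / J))%:E <= \prod_k mu (bx Q v k)))%E by [].
  apply: (big_ind2 (fun a b => 0 <= a /\ a <= b)%E).
  - by split.
  - move=> a b a' b' [a0 ab] [a'0 ab']; split; first exact: mule_ge0.
    exact: lee_pmul.
  - move=> k _; split.
      by rewrite lee_fin mulr_ge0 ?divr_ge0 ?exprn_ge0// ltW.
    have := @bx_sub Q v k; rewrite /bx /config_box /wd.
    by case: (fintype.split k) => a sub; apply: box_ge => //; rewrite ?divr_ge0// ltW.
rewrite lee_fin big_split_ord/= le_eqVlt; apply/orP; left; apply/eqP.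
rewrite (eq_bigr (fun _ => plow * (eta ^+ d / J))) => [|a _]; last first.
  by rewrite /wd (unsplitK (inl a)).
rewrite [X in _ = _ * X](eq_bigr (fun _ => plow * ((eta / K%:R) ^+ d / J))) => [|a _]; last first.
  by rewrite /wd (unsplitK (inr a)).
rewrite !prodr_const !card_ord /pi0 exprD expr_div_n.
by field; rewrite !gt_eqF// exprn_gt0.
Qed.

Let b := arrangements_mean P X cl bx.

Let mbx Q v k : measurable (bx Q v k).
Proof. exact: measurable_config_box. Qed.
Let mcl Q : measurable (cl Q). Proof. exact: measurable_cell_set. Qed.

Let joint (A : 'I_n -> set (Rd R d)) : (forall i, measurable (A i)) ->
  P [set w | forall i, A i (X i w)] = (\prod_i mu (A i))%E.
Proof. by move=> mA; rewrite (design_indep iid i0). Qed.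

Let rho0 : 0 <= rho. Proof. by rewrite divr_ge0// ltW. Qed.

Let J1 : n%:R / (2 * lambda0) <= J.
Proof. by have /andP[] := @Jn_bounds R lambda0 l0 n n0. Qed.
Let J2 : J <= (2 / lambda0 + 1) * n%:R.
Proof. by have /andP[] := @Jn_bounds R lambda0 l0 n n0. Qed.
Let m_gt0 : (0 < m)%N. Proof. by rewrite addn2. Qed.

Let b_ge : mean_const d m plow phigh eta lambda0 * (n%:R * h ^+ d) <= b.
Proof.
have := mean_numeric d plow0 phigh0 eta_gt0 l0 m_gt0 mn J1 J2 rho2 K0 h01 Kh2.
move=> /le_trans; apply.
have pi00 : 0 <= pi0.
  rewrite /pi0; apply: divr_ge0; last by rewrite !exprn_ge0.
  apply: exprn_ge0; apply: mulr_ge0; first exact: ltW.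
  by apply: divr_ge0; [apply: exprn_ge0; exact: ltW|exact: ltW].
have := arrangements_mean_ge joint mcl mbx rho0 rho2 pi00 cl_le bx_ge.
rewrite -/b; apply: le_trans; rewrite le_eqVlt; apply/orP; left; apply/eqP.
congr (_ * (_ * _) * _).
- rewrite -[LHS]Je -natrX card_dep_ffun/=; congr (_%:R).
  rewrite foldrE big_map big_enum/= expn_sum.
  by apply: eq_bigr => j _; rewrite card_ord.
- by rewrite card_ffun !card_ord natrX.
Qed.

Let edge_count w : count R (arranged X cl bx) w <=
  (m ^ m)%:R * nedges psi s m (k0 / m%:R) 1 h (fun i => pt (Z i w).1).
Proof.
apply: le_trans (count_le_occupied R X bx_sub (k0 := rshift m0 ord0) _ w) _.
  by move=> Q v v' x; exact: config_box_disj.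
apply: ler_wpM2l => //; rewrite /nedges ler_nat.
set E := edges _ _ _ _ _ _ _.
apply: leq_trans (leq_imset_card fst (mem E)).
apply/subset_leq_card/fintype.subsetP => Q; rewrite unfold_in/= => /asboolP[t Et].
have [i iE] := @configuration_edge R d ell psi s m0 u eta k0 L h K qm eta_gt0 k0_gt0 u_low
  L0 L_lip eta1 eta_small isT Kh1 n (fun i => X i w) Q t.1 (val t.2)
  (injectiveP _ (valP t.2))
  (fun k => eq_ind _ (fun A => A (X (val t.2 k) w)) (Et (val t.2 k)) _ (slot_img cl bx Q t k))
  (fun i => arranged_cell bx_sub i Et).
by apply/imsetP; exists (Q, i).
Qed.

(** Each occupied cell holds a retained pair, and the number of occupied cells is
    at least of order n h^d with high probability. *)
Lemma edges_lower_tail :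
  (P [set w | (nedges psi s m (k0 / m%:R) 1 h (fun i => pt (Z i w).1) <=
        mean_const d m plow phigh eta lambda0 / (2 * (m ^ m)%:R) * (n%:R * h ^+ d))%R] <=
   (tail_const d m plow phigh eta lambda0 / (n%:R * h ^+ d))%:E)%E.
Proof.
set c := mean_const _ _ _ _ _ _.
have c0 : 0 < c by exact: mean_const_gt0.
have nh : 0 < n%:R * h ^+ d by rewrite mulr_gt0 ?ltr0n ?exprn_gt0.
have b0 : 0 < b by apply: lt_le_trans b_ge; rewrite mulr_gt0.
have mm0 : 0 < (m ^ m)%:R :> R by rewrite ltr0n expn_gt0 m_gt0.
apply: (@le_trans _ _ (P [set w | (count R (arranged X cl bx) w <= b / 2)%R])).
  apply: le_measure; rewrite ?inE.
  - rewrite -[X in measurable X]setTI.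
    apply: (measurable_fun_ler (f := fun w =>
      nedges psi s m (k0 / m%:R) 1 h (fun i => pt (Z i w).1))) => //.
    apply: measurable_nedges; first exact: ltW.
    exact: mxM_design.
  - rewrite -[X in measurable X]setTI.
    apply: (measurable_fun_ler (f := count R (arranged X cl bx))) => //.
    apply: measurable_count => Q t; exact: measurable_arranged.
  - move=> w /= H; apply: le_trans (edge_count w) _.
    have := ler_wpM2l (ltW mm0) H => {}H; apply: le_trans H _.
    have -> : (m ^ m)%:R * (c / (2 * (m ^ m)%:R) * (n%:R * h ^+ d)) = c * (n%:R * h ^+ d) / 2.
      by field; rewrite gt_eqF.
    by rewrite ler_pM2r ?invr_gt0//; exact: b_ge.
have cdis Q v v' x : bx Q v (rshift m0 ord0) x -> bx Q v' (rshift m0 ord0) x -> v = v'.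
  exact: config_box_disj.
apply: le_trans (arrangements_tail (fun i => _) joint mcl mbx _ bx_sub cdis rho0 rho2 cl_le b0) _.
- by [].
- by move=> Q Q' x; exact: cell_uniq.
rewrite lee_fin; apply: (tail_numeric plow0 phigh0 eta_gt0 l0 m_gt0 mn J1 rho2 h01).
exact: b_ge.
Qed.

End many_edges.

(** * Risk at one parameter *)

Local Close Scope classical_set_scope.

Lemma add_risk_bounds (R : realType) (S1 S2 A X P Q V Z : R) :
  S1 <= A + X -> X <= P * Z -> S2 <= Q * Z -> 0 <= V * Z ->
  2 * S1 + 2 * S2 <= 2 * A + (2 * P + 2 * Q + V) * Z.
Proof.
by rewrite !mulrDl -!mulrA; move: (P * Z) (Q * Z) (V * Z) => p q v; lra.
Qed.

Section error_decomposition.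
Context (R : realType) (d ell n : nat).
Variables (psi : 'I_(qdim d ell) -> mpoly.mpoly d R) (s : 'I_d -> nat).
Variables (Nmax : nat) (kappa lambda h vlow sig2 L C beta H : R).
Variables (f : 'rV[R]_d -> R) (x : 'I_n -> 'rV[R]_d).
Hypotheses (hpsi : polynomial_basis psi) (kappa0 : 0 < kappa) (lambda0 : 0 < lambda)
  (h01 : 0 < h <= 1) (beta1 : 1 < beta) (C0 : 0 <= C) (L0 : 0 <= L) (H01 : 0 < H <= 1)
  (L_bnd : forall u, unit_cube u -> dotp (feat psi u) (feat psi u) <= L ^+ 2)
  (L_lip : forall u u', unit_cube u -> unit_cube u' ->
     dotp (feat psi u - feat psi u') (feat psi u - feat psi u') <= L ^+ 2 * `|u - u'| ^+ 2)
  (taylor : forall b, unit_cube b -> exists2 p, polydeg ell p &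
     forall x, unit_cube x -> `|f x - p x| <= C * `|x - b| `^ beta)
  (side_le : forall j, @side R d s j <= 2 * H)
  (x_cube : forall i, unit_cube (x i)).

Local Notation pair := (cell s * ('I_n * 'I_n))%type.
Local Notation E := (edges psi s Nmax kappa 1 h x).
Local Notation w := (weight psi Nmax kappa 1 lambda h x).
Local Notation v := (pair_v psi x).
Local Notation mem := (members x).

Let h0 : 0 < h. Proof. by case/andP: h01. Qed.
Let H0 : 0 < H. Proof. by case/andP: H01. Qed.

Definition edge_resid (e : pair) (i : 'I_n) : R :=
  if i \in mem e.1 then resid (mem e.1) (cfeat psi x e.1) e.2.1 e.2.2 i else 0.
Local Notation r := edge_resid.

Let edgeP (e : pair) : e \in E ->
  [/\ e.2.1 \in mem e.1, e.2.2 \in mem e.1, `|pair_diff x e| <= h, 1 <= v e &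
   (#|mem e.1| <= Nmax)%N /\ forall c, kappa * dotp c c <=
      \sum_(i in mem e.1) dotp c (cfeat psi x e.1 i) ^+ 2].
Proof.
rewrite inE => /and5P[/andP[/andP[Nq NN] low] e1 e2 _ /andP[dh v1]]; split => //; split => //.
move=> c; move: low; rewrite gramE => /le_lambda_min.
move=> /(_ (qdim_gt0 d ell)) low.
have N0 : 0 < #|mem e.1|%:R :> R by rewrite ltr0n (leq_ltn_trans (leq0n _) Nq).
have := low _ c; rewrite linearZ/= fgram_sym => /(_ erefl).
rewrite -scalemxAr dotpZl dotp_fgram -ler_pdivrMl ?invr_gt0// invrK => lo.
apply: le_trans lo; rewrite ler_peMl// ?ler1n ?(leq_ltn_trans (leq0n _) Nq)//.
by rewrite mulr_ge0 ?dotp_ge0// ltW.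
Qed.

Let sum_r (F : 'I_n -> R) (e : pair) :
  \sum_i r e i * F i = \sum_(i in mem e.1) resid (mem e.1) (cfeat psi x e.1) e.2.1 e.2.2 i * F i.
Proof.
rewrite [RHS]big_mkcond; apply: eq_bigr => i _; rewrite /edge_resid.
by case: ifP => // _; rewrite mul0r.
Qed.

Let vE (e : pair) : e \in E -> v e = \sum_i r e i ^+ 2.
Proof.
move=> /edgeP[]; case: e => Q [i1 i2]/= e1 e2 _ _ [_ low].
rewrite pair_vE// -(resid_sq e1 e2 kappa0 low) [LHS]big_mkcond.
apply: eq_bigr => i _; rewrite /edge_resid/=.
by case: ifP => // _; rewrite expr0n.
Qed.

Let ZE (y : 'I_n -> R) (e : pair) : e \in E ->
  pair_Z psi x y e = (\sum_i r e i * y i) ^+ 2 / v e.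
Proof. by move=> /edgeP[]; case: e => Q [i1 i2]/= e1 e2 *; rewrite pair_ZE// sum_r. Qed.

Let card_gt0 : (0 < #|E|)%N -> 0 < nedges psi s Nmax kappa 1 h x.
Proof. by rewrite /nedges ltr0n. Qed.

Let s_bnd (e : pair) : e \in E -> 0 <= pair_s h x e <= d%:R.
Proof.
move=> /edgeP[_ _ dh _ _]; rewrite /pair_s enorm_sq.
rewrite divr_ge0 ?sqr_ge0 ?sumr_ge0//=; last by move=> j _; exact: sqr_ge0.
rewrite ler_pdivrMr ?exprn_gt0//.
apply: (@le_trans _ _ (\sum_(j < d) h ^+ 2)); last first.
  by rewrite sumr_const card_ord mulr_natl.
apply: ler_sum => j _; rewrite -[leLHS]real_normK ?num_real//.
by rewrite lerXn2r ?nnegrE ?(ltW h0)//; move: dh; rewrite row_norm_le ?(ltW h0)//; exact.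
Qed.

Let sbar_bnd : (0 < #|E|)%N -> 0 <= sbar psi s Nmax kappa 1 h x <= d%:R.
Proof.
move=> M0; have M1 := card_gt0 M0; rewrite /sbar; apply/andP; split.
  rewrite mulr_ge0 ?invr_ge0 ?(ltW M1)// sumr_ge0// => e eE.
  by have /andP[] := s_bnd eE.
rewrite ler_pdivrMl//; apply: (@le_trans _ _ (\sum_(e in E) d%:R)).
  by apply: ler_sum => e eE; have /andP[] := s_bnd eE.
by rewrite sumr_const -[leLHS]mulr_natl.
Qed.

Let sum_dev : (0 < #|E|)%N -> \sum_(e in E) (pair_s h x e - sbar psi s Nmax kappa 1 h x) = 0.
Proof.
move=> M0; have M1 := card_gt0 M0; rewrite sumrB sumr_const -[X in _ - X]mulr_natl.
by rewrite -/(nedges psi s Nmax kappa 1 h x) /sbar mulrA divff ?gt_eqF// mul1r subrr.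
Qed.

Let w1 : (0 < #|E|)%N -> \sum_(e in E) w e = 1.
Proof.
move=> M0; have M1 := card_gt0 M0; rewrite /weight sumrB sumr_const -[X in X - _]mulr_natl.
rewrite -/(nedges psi s Nmax kappa 1 h x) divff ?gt_eqF//.
by rewrite -mulr_suml -mulr_sumr sum_dev// mulr0 mul0r subr0.
Qed.

Definition weight_const : R := 1 + d%:R ^+ 2 / lambda.
Local Notation Cw := weight_const.

Let Cw0 : 0 <= Cw.
Proof. by rewrite /weight_const addr_ge0// divr_ge0 ?sqr_ge0// ltW. Qed.

Let w_le (e : pair) : e \in E -> `|w e| <= Cw / #|E|%:R.
Proof.
move=> eE; have M0 : (0 < #|E|)%N by apply/card_gt0P; exists e.
have M1 := card_gt0 M0; have /andP[b0 b1] := sbar_bnd M0; have /andP[s0 s1] := s_bnd eE.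
rewrite /weight -/(nedges psi s Nmax kappa 1 h x).
set M := nedges _ _ _ _ _ _ _ in M1 *; set b := sbar _ _ _ _ _ _ _ in b0 b1 *.
have S0 : 0 <= Ssum psi s Nmax kappa 1 h x by apply: sumr_ge0 => e' _; exact: sqr_ge0.
set S := Ssum _ _ _ _ _ _ _ in S0 *.
have lM : 0 < lambda * M by rewrite mulr_gt0.
apply: le_trans (ler_normB _ _) _; rewrite mulrDl mul1r; apply: lerD.
  by rewrite ger0_norm// invr_ge0 ltW.
rewrite normrM normfV (ger0_norm (_ : 0 <= S + lambda * M)); last first.
  by rewrite addr_ge0// ltW.
rewrite -[leRHS]mulrA -invfM; apply: ler_pM => //.
- by rewrite invr_ge0 addr_ge0// ltW.
- rewrite normrM expr2; apply: ler_pM => //; first by rewrite ger0_norm.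
  by rewrite ler_norml; apply/andP; split; lra.
- by rewrite lef_pV2 ?posrE ?lerDr// ltr_wpDl.
Qed.

Let multi i : (#|[set e in E | r e i != 0%R]| <= Nmax ^ 2)%N.
Proof.
have [->|/set0Pn[e0]] := eqVneq [set e in E | r e i != 0%R] finset.set0.
  by rewrite cards0.
have in_mem (e : pair) : r e i != 0 -> in_cell e.1 (x i).
  by rewrite /edge_resid inE; case: ifP => //; rewrite eqxx.
rewrite inE => /andP[e0E /in_mem e0i].
have [_ _ _ _ [N0 _]] := edgeP e0E.
pose F (p : 'I_n * 'I_n) : pair := (e0.1, p).
apply: (@leq_trans #|F @: finset.setX (mem e0.1) (mem e0.1)|).
  apply/subset_leq_card/fintype.subsetP => e; rewrite inE => /andP[eE /in_mem ei].
  have e1 : e.1 = e0.1 by exact: cell_uniq ei e0i.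
  apply/imsetP; exists e.2; last by rewrite /F -e1; case: (e).
  by have [a b _ _ _] := edgeP eE; rewrite -e1 inE a b.
by apply: (leq_trans (leq_imset_card _ _)); rewrite cardsX -mulnn leq_mul.
Qed.

(** The bias of a pair is at most bias_const times H^beta h. The remainder of
    Taylor's formula about the second point of the pair is of order (H h)^beta
    at the first point, and of order H^beta at the other points of the cell,
    where the residual vector is of order h. *)
Definition bias_const : R := C * 2 `^ beta * (1 + Nmax%:R * (L ^+ 2 / kappa)).

Let bias_le (e : pair) : e \in E ->
  `|bias r (fun i => f (x i)) e| <= bias_const * (H `^ beta * h).
Proof.
move=> /edgeP[]; case: e => Q [i1 i2]/= e1 e2 dh _ [NN low].
rewrite /bias sum_r/=.
have [p pdeg pT] := taylor (x_cube i2).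
have p2 : f (x i2) = p (x i2).
  apply/eqP; rewrite -subr_eq0 -normr_le0; apply: le_trans (pT _ (x_cube i2)) _.
  by rewrite subrr normr0 powR0 ?mulr0// gt_eqF// (lt_trans ltr01).
have [c pc] : exists c, forall i, p (x i) = dotp c (cfeat psi x Q i).
  have : polydeg ell (fun u => p (\row_j (corner R Q j + side R s j * u 0 j))).
    apply: (polydeg_comp pdeg) => j; apply: polydegD; first exact: polydeg_cst.
    exact/polydegZ/polydeg_coord.
  case=> q qs qE; have [c [cq _]] := hpsi.2 q qs.
  exists c => i; rewrite /cfeat dotp_feat -cq -qE; congr p; apply/rowP => j; rewrite !mxE.
  by rewrite mulrC divfK ?gt_eqF ?side_gt0// subrKC.
have cube i : i \in mem Q -> unit_cube (local_coord x Q i).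
  by rewrite inE => Hi; exact: lcoord_cube.
have dist i : i \in mem Q -> `|x i - x i2| <= 2 * H * `|local_coord x Q i - local_coord x Q i2|.
  move=> iQ; rewrite row_norm_le ?mulr_ge0 ?(ltW H0)// => j.
  have -> : (x i - x i2) 0 j = side R s j * (local_coord x Q i - local_coord x Q i2) 0 j.
    by rewrite !mxE -mulrBl mulrC divfK ?gt_eqF ?side_gt0//; ring.
  rewrite normrM (ger0_norm (ltW (side_gt0 _ _ _))); apply: ler_pM => //.
    by rewrite ltW// side_gt0.
  exact: coord_norm_le.
have dist1 i : i \in mem Q -> `|local_coord x Q i - local_coord x Q i2| <= 1.
  move=> iQ; rewrite row_norm_le// => j.
  have -> : (local_coord x Q i - local_coord x Q i2) 0 j =
    local_coord x Q i 0 j - local_coord x Q i2 0 j by rewrite !mxE.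
  have /andP[a1 a2] := cube _ iQ j; have /andP[b1 b2] := cube _ e2 j.
  by rewrite ler_norml; apply/andP; split; lra.
have b0 : 0 <= beta by apply: ltW; exact: lt_trans ltr01 beta1.
have H20 : 0 <= 2 * H by rewrite mulr_ge0// ltW.
pose e := C * (2 * H) `^ beta.
have e_ge0 : 0 <= e by rewrite mulr_ge0// powR_ge0.
have fe i : i \in mem Q -> `|f (x i) - dotp c (cfeat psi x Q i)| <= e.
  move=> iQ; rewrite -pc; apply: le_trans (pT _ (x_cube i)) _; apply: ler_wpM2l => //.
  apply: ge0_ler_powR; rewrite ?nnegrE//; apply: le_trans (dist _ iQ) _.
  by rewrite ger_pMr ?dist1//; rewrite mulr_gt0.
have f1 : `|f (x i1) - dotp c (cfeat psi x Q i1)| <= e * h.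
  rewrite -pc; apply: le_trans (pT _ (x_cube i1)) _; rewrite /e -mulrA; apply: ler_wpM2l => //.
  apply: (@le_trans _ _ ((2 * H * h) `^ beta)).
    apply: ge0_ler_powR; rewrite ?nnegrE ?(mulr_ge0 H20 (ltW h0))//.
    apply: le_trans (dist _ e1) _; apply: ler_wpM2l => //; exact: dh.
  rewrite powRM ?(ltW h0)//; apply: ler_wpM2l; first exact: powR_ge0.
  rewrite -[leRHS]powRr1 ?(ltW h0)//.
  by apply: ger_powR => //; exact: ltW.
have dd : dotp (delta (cfeat psi x Q) i1 i2) (delta (cfeat psi x Q) i1 i2) <= (L * h) ^+ 2.
  apply: le_trans (L_lip (cube _ e1) (cube _ e2)) _; rewrite exprMn.
  apply: ler_wpM2l; first exact: sqr_ge0.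
  by rewrite lerXn2r ?nnegrE ?(ltW h0).
have Lh0 : 0 <= L * h by rewrite mulr_ge0// ltW.
have NR : #|mem Q|%:R <= Nmax%:R :> R by rewrite ler_nat.
have := resid_bias e1 e2 kappa0 low Lh0 L0 e_ge0 NR dd (fun i iQ => L_bnd (cube i iQ)) fe
  (etrans p2 (pc i2)).
move=> /le_trans; apply.
apply: (@le_trans _ _ (e * h + Nmax%:R * (L * h * L / kappa) * e)); first by rewrite lerD2r.
rewrite le_eqVlt; apply/orP; left; apply/eqP.
rewrite /e /bias_const powRM ?(ltW H0)//.
by field; rewrite gt_eqF.
Qed.

(** The noises for j = 0, their centered squares for j = 1. *)
Definition noise_stat (j : 'I_2) (t : R) : R := if j == ord0 then t else t ^+ 2 - sig2.

(** When no pair is retained the error is the constant vlow - sig2. *)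
Definition chaos_coef (j : 'I_2) (B : {set 'I_n}) : R :=
  if (0 < #|E|)%N then
    if j == ord0 then coefT E w v r (fun i => f (x i)) B
    else \sum_i (if B == [set i] then coefB E w v r i else 0)
  else if (j == ord0) && (B == finset.set0) then vlow - sig2 else 0.

Let sum_single (c : 'I_n -> R) (F : {set 'I_n} -> R) :
  \sum_B (\sum_i (if B == [set i] then c i else 0)) * F B = \sum_i c i * F [set i].
Proof.
under eq_bigr do rewrite mulr_suml.
rewrite exchange_big/=; apply: eq_bigr => i _.
rewrite (bigD1 [set i])//= eqxx big1 ?addr0// => B /negbTE ->.
by rewrite mul0r.
Qed.

Lemma error_chaos (y : 'I_n -> R) :
  (sigma2_unclipped psi s Nmax kappa 1 lambda h vlow x y - sig2) ^+ 2 <=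
  \sum_(j < 2) 2 * (\sum_B chaos_coef j B *
     \prod_(i in B) noise_stat j (y i - f (x i))) ^+ 2.
Proof.
rewrite big_ord_recl big_ord1 /sigma2_unclipped /chaos_coef.
case: ifPn => M0 /=.
  have := chaos_decomposition (fun i => f (x i)) y sig2 (w1 M0) vE ltr01
    (fun e eE => let: And5 _ _ _ v1 _ := edgeP eE in v1).
  rewrite (eq_bigr (fun e => w e * pair_Z psi x y e)) => [|e eE]; last by rewrite ZE.
  move=> ->.
  rewrite (sum_single _ (fun B => \prod_(i in B) noise_stat (lift ord0 ord0) (y i - f (x i)))).
  under [X in _ <= _ + 2 * X ^+ 2]eq_bigr do rewrite big_set1.
  rewrite /noise_stat /=.
  set a := \sum_T _; set b := \sum_i _.
  have := sqr_ge0 (a - b); nra.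
rewrite (bigD1 finset.set0)//= eqxx big_set0 mulr1 big1 ?addr0; last first.
  by move=> B /negbTE ->; rewrite mul0r.
set a := \sum_B _; have := sqr_ge0 a; have := sqr_ge0 (vlow - sig2); lra.
Qed.

Variables (vhigh M4 : R).
Hypotheses (sig_bnd : 0 < sig2 <= vhigh) (vlow_bnd : 0 < vlow <= vhigh) (M40 : 0 <= M4).

Definition noise_var (j : 'I_2) : R := if j == ord0 then vhigh else M4.

Definition bias_risk_const : R := 2 * (Cw * bias_const ^+ 2) ^+ 2.
Definition variance_risk_const : R :=
  2 * ((Nmax ^ 2)%:R * (4 * vhigh * bias_const ^+ 2 + 2 * vhigh ^+ 2) * Cw ^+ 2) +
  2 * (M4 * ((Nmax ^ 2)%:R * Cw ^+ 2)) + 2 * vhigh ^+ 2.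

(** The squared bias contributes the fourth power of H^beta h, and the noise
    the inverse of the number of pairs; the latter is compared with t, or with 1
    when there are at most t pairs. *)
Lemma chaos_coef_le (t : R) : 0 < t ->
  \sum_(j < 2) 2 * \sum_(B : {set 'I_n}) noise_var j ^+ #|B| * chaos_coef j B ^+ 2 <=
  bias_risk_const * (H `^ beta * h) ^+ 4 +
  variance_risk_const * ((nedges psi s Nmax kappa 1 h x <= t)%R%:R + t^-1).
Proof.
move=> t0; have t1 : 0 < t^-1 by rewrite invr_gt0.
have [sg0 sg1] := andP sig_bnd; have [vl0 vl1] := andP vlow_bnd.
have vh0 : 0 <= vhigh by apply: (le_trans (ltW sg0)).
pose ind : R := (nedges psi s Nmax kappa 1 h x <= t)%R%:R; rewrite -/ind.
pose m : R := (Nmax ^ 2)%:R; have m0 : 0 <= m by [].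
have sq0 (a : R) : 0 <= a ^+ 2 by exact: sqr_ge0.
have K0 : 0 <= 4 * vhigh * bias_const ^+ 2 + 2 * vhigh ^+ 2.
  apply: addr_ge0; last exact: mulr_ge0.
  by apply: mulr_ge0 => //; exact: mulr_ge0.
have K1 : 0 <= 2 * (m * (4 * vhigh * bias_const ^+ 2 + 2 * vhigh ^+ 2) * Cw ^+ 2).
  by apply: mulr_ge0 => //; apply: mulr_ge0 => //; exact: mulr_ge0.
have K2 : 0 <= 2 * (M4 * (m * Cw ^+ 2)).
  by apply: mulr_ge0 => //; apply: mulr_ge0 => //; exact: mulr_ge0.
have K3 : 0 <= 2 * vhigh ^+ 2 by exact: mulr_ge0.
have Hb : 0 <= H `^ beta * h <= 1.
  have Hp : 0 <= H `^ beta by exact: powR_ge0.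
  have [_ H1] := andP H01; have [_ h1] := andP h01.
  rewrite mulr_ge0 ?(ltW h0)//=; apply: mulr_ile1 => //; first exact: ltW.
  rewrite -[leRHS](powRr0 H); apply: ger_powR; first exact: H01.
  exact: ltW (lt_trans ltr01 beta1).
have Cb0 : 0 <= bias_const.
  apply: mulr_ge0; first by apply: mulr_ge0 => //; exact: powR_ge0.
  apply: addr_ge0 => //; apply: mulr_ge0 => //; apply: divr_ge0 => //; exact: ltW.
have G0 : 0 <= bias_risk_const * (H `^ beta * h) ^+ 4.
  apply: mulr_ge0; first exact: mulr_ge0.
  by apply: exprn_ge0; have /andP[] := Hb.
rewrite big_ord_recl big_ord1 /chaos_coef /noise_var /=.
have [M0|M0] := ltnP 0 #|E|; last first.
  have ind1 : ind = 1.
    rewrite /ind /nedges; have -> : #|E| = 0%N by apply/eqP; rewrite -leqn0.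
    by rewrite ltW.
  rewrite ind1 (bigD1 finset.set0)//= eqxx cards0 expr0 mul1r big1 ?addr0; last first.
    by move=> B /negbTE ->; rewrite expr0n mulr0.
  rewrite big1 ?mulr0 ?addr0 => [|B _]; last by rewrite expr0n mulr0.
  have sq : (vlow - sig2) ^+ 2 <= vhigh ^+ 2 by nra.
  apply: (@le_trans _ _ (2 * vhigh ^+ 2)); first by rewrite ler_pM2l.
  apply: (@le_trans _ _ (variance_risk_const * (1 + t^-1))); last by rewrite lerDr.
  apply: (@le_trans _ _ variance_risk_const); first by rewrite /variance_risk_const lerDr addr_ge0.
  by rewrite ler_peMr ?lerDl ?(ltW t1)// /variance_risk_const !addr_ge0.
have M1 := card_gt0 M0.
have Mle : (#|E|%:R : R)^-1 <= ind + t^-1.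
  have [Mt|Mt] := leP (#|E|%:R : R) t.
    have -> : ind = 1 by rewrite /ind /nedges Mt.
    apply: (@le_trans _ _ 1); last by rewrite lerDl ltW.
    by rewrite invf_le1// ler1n.
  apply: (@le_trans _ _ t^-1); last by rewrite lerDr.
  by rewrite lef_pV2 ?posrE//; exact: ltW.
have v_ge e : e \in E -> 1 <= v e by move=> /edgeP[].
have b0 : 0 <= bias_const * (H `^ beta * h) by rewrite mulr_ge0//; have /andP[] := Hb.
have T1 := coefT_le vE ltr01 v_ge multi w_le M0 bias_le vh0 b0.
have T2 := coefB_le vE ltr01 v_ge multi w_le M0.
rewrite -/m in T1 T2.
have E2 : \sum_(B : {set 'I_n}) M4 ^+ #|B| * (\sum_i (if B == [set i] then coefB E w v r i else 0)) ^+ 2 =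
    M4 * \sum_i coefB E w v r i ^+ 2.
  under eq_bigr do rewrite expr2 mulrCA.
  rewrite (sum_single _ (fun B => M4 ^+ #|B| * (\sum_i (if B == [set i] then coefB E w v r i else 0)))).
  rewrite mulr_sumr; apply: eq_bigr => i _; rewrite cards1 expr1.
  have -> : \sum_(i0 < n) (if [set i] == [set i0] then coefB E w v r i0 else 0) = coefB E w v r i.
    rewrite (bigD1 i)//= eqxx big1 ?addr0// => j ji.
    by case: eqP => // /finset.set1_inj ij; rewrite ij eqxx in ji.
  by rewrite mulrCA -expr2.
rewrite E2.
move: T1 T2; rewrite !divr1.
set S1 := \sum_(T : {set 'I_n}) _; set S2 := \sum_i _; move=> T1 T2.
move: Mle G0; rewrite /bias_risk_const /variance_risk_const.
have -> : 2 * (Cw * bias_const ^+ 2) ^+ 2 * (H `^ beta * h) ^+ 4 =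
   2 * (Cw * (bias_const * (H `^ beta * h)) ^+ 2) ^+ 2 by ring.
move=> Mle G0.
have Bq : (bias_const * (H `^ beta * h)) ^+ 2 <= bias_const ^+ 2.
  rewrite lerXn2r ?nnegrE// ler_piMr//; by have /andP[] := Hb.
have X1 : m * (4 * vhigh * (bias_const * (H `^ beta * h)) ^+ 2 + 2 * vhigh ^+ 2) *
    (Cw ^+ 2 / #|E|%:R) <=
    (m * (4 * vhigh * bias_const ^+ 2 + 2 * vhigh ^+ 2) * Cw ^+ 2) * (ind + t^-1).
  rewrite mulrA; apply: ler_pM => //; last first.
  - apply: ler_wpM2r; first exact: sqr_ge0.
    apply: ler_wpM2l => //; rewrite lerD2r; apply: ler_wpM2l => //.
    by rewrite mulr_ge0.
  - apply: mulr_ge0 => //; apply: mulr_ge0 => //; apply: addr_ge0; last exact: mulr_ge0.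
    by apply: mulr_ge0 => //; exact: mulr_ge0.
have X2 : M4 * S2 <= M4 * (m * Cw ^+ 2) * (ind + t^-1).
  rewrite -mulrA; apply: ler_wpM2l => //; apply: le_trans T2 _.
  apply: ler_wpM2l => //; by rewrite mulr_ge0 ?sqr_ge0.
have X3 : 0 <= 2 * vhigh ^+ 2 * (ind + t^-1).
  apply: mulr_ge0 => //; rewrite addr_ge0 ?(ltW t1)//.
exact: add_risk_bounds T1 X1 X2 X3.
Qed.

End error_decomposition.

Local Open Scope classical_set_scope.
Local Open Scope ring_scope.

Lemma variance_risk_const_ge0 (R : realType) (d Nmax : nat) (kappa lambda L C beta vhigh M4 : R) :
  0 <= vhigh -> 0 <= M4 ->
  0 <= variance_risk_const d Nmax kappa lambda L C beta vhigh M4.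
Proof.
move=> vh M40; have sq0 (a : R) : 0 <= a ^+ 2 by exact: sqr_ge0.
rewrite /variance_risk_const; apply: addr_ge0; last exact: mulr_ge0.
apply: addr_ge0; apply: mulr_ge0 => //.
  apply: mulr_ge0 => //; apply: mulr_ge0 => //; apply: addr_ge0; last exact: mulr_ge0.
  by apply: mulr_ge0 => //; exact: mulr_ge0.
by apply: mulr_ge0 => //; exact: mulr_ge0.
Qed.

Section risk_of_one_parameter.
Context (R : realType) (d ell n : nat).
Variables (psi : 'I_(qdim d ell) -> mpoly.mpoly d R) (s : 'I_d -> nat).
Variables (Nmax : nat) (kappa lambda h vlow L C beta H vhigh M4 t tau : R).
Variable theta : param R d.
Hypotheses (hpsi : polynomial_basis psi) (kappa0 : 0 < kappa) (lambda0 : 0 < lambda)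
  (h01 : 0 < h <= 1) (beta1 : 1 < beta) (C0 : 0 <= C) (L0 : 0 <= L) (H01 : 0 < H <= 1)
  (L_bnd : forall u, unit_cube u -> dotp (feat psi u) (feat psi u) <= L ^+ 2)
  (L_lip : forall u u', unit_cube u -> unit_cube u' ->
     dotp (feat psi u - feat psi u') (feat psi u - feat psi u') <= L ^+ 2 * `|u - u'| ^+ 2)
  (side_le : forall j, @side R d s j <= 2 * H)
  (vlow0 : 0 < vlow) (vlow_le : vlow <= vhigh) (M40 : 0 <= M4) (t0 : 0 < t).
Hypotheses (taylor : forall b, unit_cube b -> exists2 p, polydeg ell p &
     forall x, unit_cube x -> `|reg theta x - p x| <= C * `|x - b| `^ beta)
  (mdens : measurable_fun (@cube_Rd R d) (fun x => dens theta (pt x)))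
  (dens0 : forall x, unit_cube x -> 0 <= dens theta x)
  (mreg : measurable_fun (@cube_Rd R d) (fun x => reg theta (pt x)))
  (var_bnd : vlow <= var theta <= vhigh)
  (noise_ae : density_ae (dens theta) (fun x =>
          [/\ (\int[noise theta x]_u u%:E = 0)%E,
              (\int[noise theta x]_u (u ^+ 2)%:E = (var theta)%:E)%E &
              (\int[noise theta x]_u (u ^+ 4)%:E <= M4%:E)%E])).
Context d0 (Omega : measurableType d0) (P : probability Omega R)
  (Z : 'I_n -> {RV P >-> (Rd R d * measurableTypeR R)%type}).
Hypothesis iid : iid_sample theta Z.
Let x w i := pt (Z i w).1.
Hypothesis tail : (P [set w | (nedges psi s Nmax kappa 1 h (x w) <= t)%R] <= tau%:E)%E.

(** Outside the cube, where the regression function is arbitrary, it is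
    replaced by 0, to make it measurable. *)
Let f (z : 'rV[R]_d) : R := if z \in @unit_cube R d then reg theta z else 0.
Let f0 (z : Rd R d) : R := f (pt z).

Let fE z : unit_cube z -> f z = reg theta z.
Proof. by move=> cz; rewrite /f mem_set. Qed.

Let mf0 : measurable_fun setT f0.
Proof.
have := (measurable_restrictT _ (@measurable_cube R d)).1 mreg.
by rewrite (_ : _ \_ _ = f0)//; apply/funext => z; rewrite patchE /f0 /f.
Qed.

Let var0 : 0 < var theta.
Proof. by have /andP[+ _] := var_bnd; exact: lt_le_trans. Qed.

Let T : measurableType _ := (Rd R d * measurableTypeR R)%type.
Let xz (z : n.-tuple T) i := pt (xs z i).
Let yz (z : n.-tuple T) i : R := (tnth z i).2.

Let est := sigma2_unclipped psi s Nmax kappa 1 lambda h vlow (n := n).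
Let Brisk := bias_risk_const d Nmax kappa lambda L C beta.
Let Vrisk := variance_risk_const d Nmax kappa lambda L C beta vhigh M4.

Let h0 : 0 <= h. Proof. by case/andP: h01 => /ltW. Qed.

Let mxs j : measurable_fun setT (fun z : n.-tuple T => xs z j).
Proof.
have mt : measurable_fun setT (fun z : n.-tuple T => tnth z j) by exact: measurable_tnth.
exact: (measurableT_comp (@measurable_fst _ _ (Rd R d) (measurableTypeR R)) mt).
Qed.

Let mxz i : mxM (fun z : n.-tuple T => xz z i).
Proof.
move=> a j; rewrite (_ : (fun _ => _) = fun z : n.-tuple T => tnth (xs z i) j); last first.
  by apply/funext => z; rewrite mxE.
have mt : measurable_fun setT (fun x : Rd R d => tnth x j) by exact: measurable_tnth.
exact: (measurableT_comp mt (mxs i)).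
Qed.

Let myz i : measurable_fun setT (fun z : n.-tuple T => yz z i).
Proof.
have mt : measurable_fun setT (fun z : n.-tuple T => tnth z i) by exact: measurable_tnth.
exact: (measurableT_comp (@measurable_snd _ _ (Rd R d) (measurableTypeR R)) mt).
Qed.

Let mest : measurable_fun setT (fun z : n.-tuple T => est (xz z) (yz z)).
Proof. exact: measurable_sigma2. Qed.

Let mnedges : measurable_fun setT (fun z : n.-tuple T => nedges psi s Nmax kappa 1 h (xz z)).
Proof. exact: measurable_nedges. Qed.

Let Brisk0 : 0 <= Brisk.
Proof. by rewrite /Brisk /bias_risk_const mulr_ge0// sqr_ge0. Qed.

Let Vrisk0 : 0 <= Vrisk.
Proof. by apply: variance_risk_const_ge0 => //; exact: le_trans (ltW vlow0) vlow_le. Qed.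

Let bnd (z : n.-tuple T) : R := Brisk * (H `^ beta * h) ^+ 4 +
  Vrisk * ((nedges psi s Nmax kappa 1 h (xz z) <= t)%R%:R + t^-1).

Let mind : measurable_fun setT
  (fun z : n.-tuple T => (nedges psi s Nmax kappa 1 h (xz z) <= t)%R%:R : R).
Proof. by apply: measurable_b2r; exact: measurable_fun_ler. Qed.

Let Hh0 : 0 <= Brisk * (H `^ beta * h) ^+ 4.
Proof. by apply: mulr_ge0 => //; apply: exprn_ge0; apply: mulr_ge0 => //; exact: powR_ge0. Qed.

Let bnd0 z : 0 <= bnd z.
Proof.
apply: addr_ge0 => //; apply: mulr_ge0 => //.
by apply: addr_ge0 => //; rewrite invr_ge0 ltW.
Qed.

Let sampleE w : xz (sample Z w) = x w /\ yz (sample Z w) = fun i => (Z i w).2.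
Proof. by split; apply/funext => i; rewrite /xz /xs /yz tnth_mktuple. Qed.

(** Integrate the bound on the coefficients against the law of the design, where
    the event of at most t pairs has probability at most tau. *)
Lemma risk_le :
  (\int[P]_w ((est (x w) (fun i => (Z i w).2) - var theta) ^+ 2)%:E
   <= (Brisk * (H `^ beta * h) ^+ 4 + Vrisk * (tau + t^-1))%:E)%E.
Proof.
have [N [mN N0 Nae]] := noise_ae.
pose G := @cube_Rd R d `\` N.
have mC := @measurable_cube R d.
have mG : measurable G by exact: measurableD.
have law i (A : set (Rd R d * measurableTypeR R)) : measurable A ->
    P (Z i @^-1` A) = (\int[leb R d]_(x in @cube_Rd R d)
      ((dens theta (pt x))%:E * noise theta x [set u | A (x, (f0 x + u)%R)]))%E.
  move=> mA; rewrite iid.2//; apply: eq_integral => z /set_mem cz.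
  by rewrite /f0 fE.
have vb : 0 < var theta <= vhigh by rewrite var0; case/andP: var_bnd.
have GN z : G z -> [/\ (\int[noise theta z]_u u%:E = 0)%E,
              (\int[noise theta z]_u (u ^+ 2)%:E = (var theta)%:E)%E &
              (\int[noise theta z]_u (u ^+ 4)%:E <= M4%:E)%E].
  by move=> [cz Nz]; exact: Nae.
have mom z : G z -> (\int[noise theta z]_u (u ^+ 2 - var theta)%:E = 0)%E /\
    (\int[noise theta z]_u ((u ^+ 2 - var theta) ^+ 2)%:E <= M4%:E)%E.
  move=> /GN[n1 n2 n4]; pose q := pack_probability (prob_kernel (s := noise theta) z).
  exact: (@noise_moments R q).
have mzeta j : measurable_fun setT (noise_stat (var theta) j).
  rewrite /noise_stat; case: (j == ord0); first exact: measurable_id.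
  by apply: measurable_funB => //; exact: measurable_funX.
have zeta1 j z : G z -> (\int[noise theta z]_u (noise_stat (var theta) j u)%:E = 0)%E.
  by move=> Gz; rewrite /noise_stat; case: (j == ord0); [have [] := GN z Gz|have [] := mom z Gz].
have zeta2 j z : G z -> (\int[noise theta z]_u (noise_stat (var theta) j u ^+ 2)%:E <=
    (noise_var vhigh M4 j)%:E)%E.
  move=> Gz; rewrite /noise_stat /noise_var; case: (j == ord0).
    by have [_ -> _] := GN z Gz; rewrite lee_fin; case/andP: vb.
  by have [] := mom z Gz.
have s0 j : 0 <= noise_var vhigh M4 j.
  by rewrite /noise_var; case: ifP => // _; exact: le_trans (ltW vlow0) vlow_le.
have Gae : (\int[leb R d]_(x in @cube_Rd R d `&` ~` G) (dens theta (pt x))%:E = 0)%E.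
  rewrite (_ : _ `&` _ = @cube_Rd R d `&` N)//; apply/seteqP; split => z [cz].
    by move=> /not_andP[//|/contrapT].
  by move=> Nz; split => // -[].
have gcube z i : (forall i, G (xs z i)) -> unit_cube (xz z i) by move=> /(_ i)[].
pose coef j (X : 'I_n -> Rd R d) :=
  chaos_coef psi s Nmax kappa lambda h vlow (var theta) f (fun i => pt (X i)) j.
have mS : measurable_fun setT (fun z : n.-tuple T => (est (xz z) (yz z) - var theta) ^+ 2).
  by apply: measurable_funX; apply: measurable_funB.
have mbnd : measurable_fun setT bnd.
  apply: measurable_funD => //; apply: measurable_funM => //.
  exact: measurable_funD.
have bound_coef z : (forall i, G (xs z i)) ->
    \sum_(j < 2) 2 * \sum_(B : {set 'I_n}) noise_var vhigh M4 j ^+ #|B| * coef j (xs z) B ^+ 2 <= bnd z.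
  move=> Gz; have xc i : unit_cube (xz z i) by exact: gcube.
  have vl : 0 < vlow <= vhigh by rewrite vlow0.
  have tf b : unit_cube b -> exists2 p, polydeg ell p &
     forall x, unit_cube x -> `|f x - p x| <= C * `|x - b| `^ beta.
    move=> cb; have [p pd pT] := taylor cb; exists p => // a ca.
    by rewrite fE//; exact: pT.
  exact: (chaos_coef_le Nmax hpsi kappa0 lambda0 h01 beta1 C0 L0 H01 L_bnd L_lip tf side_le xc vb vl
    M40 t0).
have := chaos_expectation mC mdens (fun z cz => dens0 cz) mf0 iid.1 law mG mzeta s0 Gae zeta1
  zeta2 mS (fun z => sqr_ge0 _) mbnd bnd0
  (fun z Gz => error_chaos psi s Nmax lambda h vlow (var theta) f (xz z) kappa0 (yz z))
  bound_coef.
rewrite (_ : (fun w => _) = (fun w => ((est (x w) (fun i => (Z i w).2) - var theta) ^+ 2)%:E)); last first.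
  by apply/funext => w; have [-> ->] := sampleE w.
move=> /le_trans; apply.
have mx i : mxM (fun w => x w i) by exact: mxM_design.
have mE : measurable [set w | (nedges psi s Nmax kappa 1 h (x w) <= t)%R].
  rewrite -[X in measurable X]setTI.
  apply: (measurable_fun_ler (f := fun w => nedges psi s Nmax kappa 1 h (x w))) => //.
  exact: measurable_nedges.
rewrite (_ : (fun w => _) = (fun w => (Brisk * (H `^ beta * h) ^+ 4 + Vrisk * t^-1)%:E +
   (Vrisk * \1_[set w | (nedges psi s Nmax kappa 1 h (x w) <= t)%R] w)%:E)%E); last first.
  apply/funext => w; rewrite /bnd; have [-> _] := sampleE w.
  rewrite -EFinD indicE; congr (_%:E).
  rewrite -addrA -mulrDr [_ + t^-1]addrC; congr (_ + _ * (_ + (nat_of_bool _)%:R)).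
  by apply/idP/idP => [?|/set_mem]; [rewrite inE|].
set I1 := \1_ _.
have mI : measurable_fun setT (I1 : Omega -> R) by exact: measurable_indic.
have I0 w : 0 <= I1 w by rewrite /I1 indicE.
have c0 : (0 <= (Brisk * (H `^ beta * h) ^+ 4 + Vrisk * t^-1)%:E)%E.
  by rewrite lee_fin addr_ge0// mulr_ge0// invr_ge0 ltW.
have VI0 w : (0 <= (Vrisk * I1 w)%:E)%E by rewrite lee_fin mulr_ge0.
have mVI : measurable_fun setT (fun w => (Vrisk * I1 w)%:E).
  by apply/measurable_EFinP; apply: measurable_funM.
rewrite ge0_integralD//.
have -> : (\int[P]__ (Brisk * (H `^ beta * h) ^+ 4 + Vrisk * t^-1)%:E =
    (Brisk * (H `^ beta * h) ^+ 4 + Vrisk * t^-1)%:E)%E.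
  by rewrite integral_cst// -[RHS]mule1; congr (_ * _)%E; exact: probability_setT.
under eq_integral do rewrite EFinM.
rewrite ge0_integralZl//; last 2 first.
- exact/measurable_EFinP.
- by move=> w _; rewrite lee_fin.
rewrite /I1 integral_indic// setIT.
have -> : Brisk * (H `^ beta * h) ^+ 4 + Vrisk * (tau + t^-1) =
    (Brisk * (H `^ beta * h) ^+ 4 + Vrisk * t^-1) + Vrisk * tau by ring.
rewrite [leRHS]EFinD; apply: leeD2l.
by rewrite EFinM; apply: lee_pmul => //; rewrite lee_fin.
Qed.

End risk_of_one_parameter.

(** * Uniform risk bound and the rate *)

Section scales.
Context (R : realType) (d : nat) (lambda0 : R).
Hypothesis d0 : (0 < d)%N.

Lemma Hn_bounds n : 0 < Hn d lambda0 n <= 1.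
Proof.
rewrite /Hn powR_gt0 ?Jn_gt0//= -[leRHS](powRr0 (Jn lambda0 n)%:R).
by rewrite ler_powR ?oppr_le0 ?invr_ge0// ler1n expn_gt0.
Qed.

(** The exponents of a balanced split differ by at most one from the average
    r / d, so each side is of the order of H. *)
Lemma side_Hn n (s : 'I_d -> nat) j : balanced_split (rn lambda0 n) s ->
  @side R d s j <= 2 * Hn d lambda0 n.
Proof.
move=> [ss sb]; rewrite /side /Hn /Jn natrX -powR_mulrn// -powRrM.
have dR : 0 < d%:R :> R by rewrite ltr0n.
have -> : (2 ^+ s j)^-1 = 2 * 2 `^ (- ((s j).+1%:R)) :> R.
  rewrite powRN powR_mulrn// exprS invfM mulrA divff ?mul1r//.
apply: ler_wpM2l => //; apply: ler_powR; first by rewrite ler1n.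
rewrite mulrN lerN2 ler_pdivrMr// -natrM ler_nat -ss.
apply: (@leq_trans (\sum_(i < d) (s j).+1)); first by apply: leq_sum => i _; exact: sb.
by rewrite sum_nat_const card_ord mulnC.
Qed.

Lemma Hn_le n : 0 < lambda0 -> (0 < n)%N ->
  Hn d lambda0 n <= (2 * lambda0) `^ d%:R^-1 * n%:R `^ (- d%:R^-1).
Proof.
move=> l0 n0; have /andP[J1 _] := Jn_bounds l0 n0.
have n0' : 0 < n%:R :> R by rewrite ltr0n.
have l2 : 0 < 2 * lambda0 by rewrite mulr_gt0.
have q0 : 0 < n%:R / (2 * lambda0) by rewrite divr_gt0.
rewrite /Hn; apply: (@le_trans _ _ ((n%:R / (2 * lambda0)) `^ (- d%:R^-1))).
  rewrite !powRN lef_pV2 ?posrE ?powR_gt0 ?Jn_gt0//.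
  by apply: ge0_ler_powR; rewrite ?nnegrE ?invr_ge0 ?(ltW q0) ?(ltW (Jn_gt0 _ _ _)).
have -> : n%:R `^ (- d%:R^-1) =
    (n%:R / (2 * lambda0)) `^ (- d%:R^-1) * (2 * lambda0) `^ (- d%:R^-1).
  by rewrite -powRM ?(ltW q0) ?(ltW l2)// divfK ?gt_eqF.
by rewrite [X in _ * (_ * X)]powRN mulrCA divff ?mulr1// gt_eqF// powR_gt0.
Qed.

End scales.

Lemma hoelder_ball_measurable (R : realType) (d : nat) (U : set 'rV[R]_d) (s L : R)
    (f g : 'rV[R]_d -> R) : @unit_cube R d `<=` U -> hoelder_ball U s L g ->
  (forall x, unit_cube x -> f x = g x) ->
  measurable_fun (@cube_Rd R d) (fun x => f (pt x)).
Proof.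
move=> cU [[_ cg] _] fg; apply: (eq_measurable_fun (fun x => g (pt x))).
  by move=> x /set_mem cx; rewrite fg.
apply: measurable_on_cube => x cx.
exact: (cg [::] x (leq0n _) (cU _ cx)).
Qed.

Lemma clip_contraction (R : realType) (a b v t : R) : a <= v <= b ->
  (Num.min b (Num.max a t) - v) ^+ 2 <= (t - v) ^+ 2.
Proof.
move=> /andP[av vb]; rewrite /Num.min /Num.max.
have [at_|ta] := ltP a t; case: ltP => H; nra.
Qed.

Lemma absorb_risk_terms (R : realType) (B V T D X Y : R) : 0 <= B -> 0 <= V -> 0 <= D -> T <= D ->
  0 <= X -> 0 <= Y -> B * Y + V * (T * X) <= (B + V * D + 1) * (X + Y).
Proof.
move=> B0 V0 D0 TD X0 Y0.
have H1 : V * (T * X) <= V * D * X.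
  by rewrite -mulrA; apply: ler_wpM2l => //; exact: ler_wpM2r.
have H2 : 0 <= V * D * Y by apply: mulr_ge0 => //; exact: mulr_ge0.
have H3 : 0 <= B * X by exact: mulr_ge0.
by rewrite !mulrDl !mulrDr !mul1r; lra.
Qed.

Section uniform_risk.
Context (R : realType) (d : nat) (betab betag : R)
    (U : set 'rV[R]_d) (plow phigh L vlow vhigh M4 lambda0 : R)
    (psi : 'I_(qdim d (hoelder_ell betab)) -> mpoly.mpoly d R).
Hypotheses (hbetab : 1 < betab) (hd : 4 * betab < d%:R)
    (hcube : @unit_cube R d `<=` U)
    (hplow : 0 < plow < 1) (hphigh : 1 < phigh) (hL : 1 <= L)
    (hvlow : 0 < vlow) (hvhigh : vlow <= vhigh) (hM4 : vhigh ^+ 2 < M4)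
    (hlambda0 : 0 < lambda0) (hpsi : polynomial_basis psi).

Local Notation Th := (Theta U plow phigh L vlow vhigh M4 betab betag).

(** Below the sample size n1, which makes a cell of probability at most 1/2 and
    leaves enough points for a configuration, the risk is bounded by a constant,
    which is at most n1 / (n h^d) times that constant. *)
Lemma uniform_risk : exists (Nmax : nat) (kappa : R),
  [/\ (qdim d (hoelder_ell betab) + 2 <= Nmax)%N, 0 < kappa &
  forall lambda : R, 0 < lambda -> exists C : R, 0 < C /\
  forall n s h, (0 < n)%N -> 0 < h <= 1 -> balanced_split (rn lambda0 n) s ->
  let bound := C * ((n%:R * h ^+ d)^-1 + Hn d lambda0 n `^ (4 * betab) * h ^+ 4) in
  (@worst_risk R d n Th (sigma2_clipped psi s Nmax kappa 1 lambda h vlow vhigh (n := n))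
     <= bound%:E)%E /\
  (@worst_risk R d n Th (sigma2_unclipped psi s Nmax kappa 1 lambda h vlow (n := n))
     <= bound%:E)%E].
Proof.
have d0 : (0 < d)%N.
  by rewrite -(ltr_nat R); apply: lt_trans hd; rewrite mulr_gt0// (lt_trans ltr01).
have [plow0 plow1] := andP hplow.
have phigh0 : 0 < phigh by exact: lt_trans hphigh.
have M40 : 0 <= M4 by apply: le_trans (ltW hM4); exact: sqr_ge0.
have [m0 [u [eta0 [k0 [qm eta00 k00 u_in u_low]]]]] := anchors hpsi.
have [Lp [Lp0 [L_bnd L_lip]]] := feat_lip psi.
have [Ct Ct0 taylor] := hoelder_taylor hbetab (le_trans ler01 hL) hcube.
(* The last bound gives Lp^2 eta^2 <= k0, hence a residual variance at least 1. *)
pose eta := Num.min (Num.min eta0 1) (Num.sqrt k0 / (Lp + 1)).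
have Lp1 : 0 < Lp + 1 by rewrite ltr_wpDl.
have sk0 : 0 < Num.sqrt k0 by rewrite sqrtr_gt0.
have eta_gt0 : 0 < eta by rewrite !lt_min eta00 ltr01 divr_gt0.
have eta1 : eta <= 1 by rewrite !ge_min lexx !orbT.
have eta_le0 : eta <= eta0 by rewrite !ge_min lexx.
have eta_small : Lp ^+ 2 * eta ^+ 2 <= k0.
  rewrite -exprMn -[leRHS]sqr_sqrtr ?(ltW k00)//.
  rewrite lerXn2r ?nnegrE ?mulr_ge0 ?(ltW eta_gt0) ?(ltW sk0)//.
  apply: (@le_trans _ _ ((Lp + 1) * (Num.sqrt k0 / (Lp + 1)))).
    apply: ler_pM => //; first exact: ltW.
      by rewrite lerDl.
    by rewrite /eta ge_min lexx orbT.
  by rewrite mulrC divfK ?gt_eqF.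
have u_in' a j : 0 <= u a 0 j /\ u a 0 j + eta <= 1.
  have [a0 a1] := u_in a j; split => //; apply: le_trans a1; by rewrite lerD2l.
have u_low' u' : (forall a, unit_cube (u' a)) -> (forall a, `|u a - u' a| <= eta) ->
    forall c, k0 * dotp c c <= \sum_a dotp c (feat psi (u' a)) ^+ 2.
  by move=> cu' du; apply: u_low => // a; exact: le_trans (du a) eta_le0.
(* A configuration has m0 anchors and two twin points, hence m points. *)
pose m := (m0 + 2)%N; pose kappa := k0 / m%:R.
have m_gt0 : (0 < m)%N by rewrite /m addn2.
have kappa0 : 0 < kappa by rewrite divr_gt0// ltr0n.
exists m, kappa; split => //; first by rewrite leq_add2r.
move=> lambda lambda_gt0.
pose B := bias_risk_const d m kappa lambda Lp Ct betab.
pose V := variance_risk_const d m kappa lambda Lp Ct betab vhigh M4.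
pose c1 := mean_const d m plow phigh eta lambda0 / (2 * (m ^ m)%:R).
have c10 : 0 < c1.
  by rewrite divr_gt0 ?mean_const_gt0 ?mulr_gt0// ltr0n expn_gt0 m_gt0.
pose tl := tail_const d m plow phigh eta lambda0.
have tl0 : 0 < tl by exact: tail_const_gt0.
pose n1 := (m + Num.bound (4 * lambda0 * phigh))%N.
have B0 : 0 <= B by rewrite /B /bias_risk_const mulr_ge0// sqr_ge0.
have V0 : 0 <= V by apply: variance_risk_const_ge0 => //; exact: le_trans (ltW hvlow) hvhigh.
pose D := tl + c1^-1 + 2 * n1%:R.
have D0 : 0 <= D.
  by apply: addr_ge0; [apply: addr_ge0; [exact: ltW|rewrite invr_ge0 ltW]|exact: mulr_ge0].
exists (B + V * D + 1); split; first by rewrite ltr_wpDl// addr_ge0// mulr_ge0.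
move=> n s h n_gt0 h01 sb bound.
have [h_gt0 h1] := andP h01.
have n0R : 0 < n%:R :> R by rewrite ltr0n.
have hd0 : 0 < h ^+ d by exact: exprn_gt0.
have nh : 0 < n%:R * h ^+ d by exact: mulr_gt0.
pose H := Hn d lambda0 n.
have H01 : 0 < H <= 1 by exact: Hn_bounds.
have Hh : (H `^ betab * h) ^+ 4 = Hn d lambda0 n `^ (4 * betab) * h ^+ 4.
  have -> : Hn d lambda0 n `^ (4 * betab) = (H `^ betab) ^+ 4.
    by rewrite [4 * betab]mulrC powRrM powR_mulrn// powR_ge0.
  exact: exprMn.
have key theta (dd : measure_display) (Omega : measurableType dd) (P : probability Omega R)
    (Z : 'I_n -> {RV P >-> (Rd R d * measurableTypeR R)%type}) :
    Th theta -> iid_sample theta Z ->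
    [/\ forall i, measurable_fun setT (Z i),
      vlow <= var theta <= vhigh &
    (\int[P]_w ((sigma2_unclipped psi s m kappa 1 lambda h vlow (fun i => pt (Z i w).1)
         (fun i => (Z i w).2) - var theta) ^+ 2)%:E <= bound%:E)%E].
  move=> [[dens0 _] var0 [[g1 g1H g1E] bdens] [g2 g2H g2E] [noise_ae var_bnd]] iid.
  split => //.
  have mdens := hoelder_ball_measurable hcube g1H g1E.
  have mreg := hoelder_ball_measurable hcube g2H g2E.
  have tay b : unit_cube b -> exists2 p, polydeg (hoelder_ell betab) p &
     forall x, unit_cube x -> `|reg theta x - p x| <= Ct * `|x - b| `^ betab.
    move=> cb; have [p pd pT] := taylor g2 b g2H cb; exists p => // x cx.
    by rewrite g2E//; exact: pT.
  have sH j : @side R d s j <= 2 * H by exact: side_Hn.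
  have risk t tau : 0 < t ->
      (P [set w | (nedges psi s m kappa 1 h (fun i => pt (Z i w).1) <= t)%R] <= tau%:E)%E ->
      (\int[P]_w ((sigma2_unclipped psi s m kappa 1 lambda h vlow (fun i => pt (Z i w).1)
         (fun i => (Z i w).2) - var theta) ^+ 2)%:E
        <= (B * (H `^ betab * h) ^+ 4 + V * (tau + t^-1))%:E)%E.
    move=> t0 tail.
    exact: (risk_le hpsi kappa0 lambda_gt0 h01 hbetab Ct0 Lp0 H01 L_bnd L_lip
      sH hvlow hvhigh M40 t0 tay mdens dens0 mreg var_bnd noise_ae iid tail).
  have [nn1|nn1] := leqP n1 n.
    have mn : (m <= n)%N by apply: leq_trans nn1; rewrite leq_addr.
    have /andP[J1 _] := Jn_bounds hlambda0 n_gt0.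
    have rho2 : phigh / (Jn lambda0 n)%:R <= 2^-1.
      rewrite ler_pdivrMr ?Jn_gt0// -ler_pdivrMl ?invr_gt0// invrK; apply: le_trans J1.
      rewrite ler_pdivlMr ?mulr_gt0//.
      have : 4 * lambda0 * phigh <= n1%:R.
        have q0 : 0 <= 4 * lambda0 * phigh.
          by apply: mulr_ge0; [apply: mulr_ge0 => //; exact: ltW|exact: ltW].
        by apply: le_trans (ltW (archi_boundP q0)) _; rewrite ler_nat leq_addl.
      have : n1%:R <= n%:R :> R by rewrite ler_nat.
      by set a := n%:R; set b := n1%:R; move=> *; nra.
    have tail := edges_lower_tail qm eta_gt0 k00 u_in' u_low' Lp0 L_lip eta1 eta_small
      h01 hlambda0 plow0 phigh0 mdens bdens iid sb.1 mn rho2.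
    have t0 : 0 < c1 * (n%:R * h ^+ d) by exact: mulr_gt0.
    apply: le_trans (risk _ _ t0 tail) _; rewrite lee_fin -/B -/V -/tl Hh /bound.
    have -> : tl / (n%:R * h ^+ d) + (c1 * (n%:R * h ^+ d))^-1 =
       (tl + c1^-1) * (n%:R * h ^+ d)^-1.
      by rewrite [(c1 * _)^-1]invfM -mulrDl.
    have x0 : 0 <= (n%:R * h ^+ d)^-1 by rewrite invr_ge0 ltW.
    have y0 : 0 <= Hn d lambda0 n `^ (4 * betab) * h ^+ 4.
      by rewrite mulr_ge0 ?powR_ge0 ?exprn_ge0// ltW.
    by apply: absorb_risk_terms => //; rewrite /D lerDl mulr_ge0.
  have t1 : (0 : R) < 1 by [].
  have mE : measurable [set w | (nedges psi s m kappa 1 h (fun i => pt (Z i w).1) <= 1)%R].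
    rewrite -[X in measurable X]setTI.
    apply: (measurable_fun_ler (f := fun w => nedges psi s m kappa 1 h (fun i => pt (Z i w).1))) => //.
    apply: measurable_nedges; first exact: ltW.
    exact: mxM_design.
  apply: le_trans (risk 1 1 t1 (probability_le1 P mE)) _.
  rewrite lee_fin -/B -/V Hh /bound invr1.
  have x1 : 1 <= n1%:R * (n%:R * h ^+ d)^-1.
    rewrite ler_pdivlMr// mul1r; apply: (@le_trans _ _ n%:R); last by rewrite ler_nat ltnW.
    by rewrite ger_pMr// exprn_ile1// ltW.
  have x0 : 0 <= (n%:R * h ^+ d)^-1 by rewrite invr_ge0 ltW.
  have y0 : 0 <= Hn d lambda0 n `^ (4 * betab) * h ^+ 4.
    by rewrite mulr_ge0 ?powR_ge0 ?exprn_ge0// ltW.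
  apply: (@le_trans _ _ (B * (Hn d lambda0 n `^ (4 * betab) * h ^+ 4) +
     V * (2 * n1%:R * (n%:R * h ^+ d)^-1))).
    by rewrite lerD2l; apply: ler_wpM2l => //; rewrite -mulrA; lra.
  apply: absorb_risk_terms => //; rewrite /D lerDr addr_ge0// ?invr_ge0; exact: ltW.
split.
  apply: ge_ereal_sup => _ [theta tT] [dd] [W] [P] [Z] [iid ->].
  have [mZ vb K] := key _ _ _ _ _ tT iid.
  rewrite unlock; apply: le_trans K.
  have mest : measurable_fun setT (fun w => sigma2_unclipped psi s m kappa 1 lambda h vlow
      (fun i => pt (Z i w).1) (fun i => (Z i w).2)).
    apply: measurable_sigma2; first exact: ltW.
      exact: mxM_design.
    by move=> i; exact: measurableT_comp.
  apply: ge0_le_integral => //.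
  - by move=> w _; rewrite lee_fin sqr_ge0.
  - apply/measurable_EFinP; apply: measurable_funX; apply: measurable_funB => //.
    by apply: measurable_minr => //; exact: measurable_maxr.
  - by apply/measurable_EFinP; apply: measurable_funX; exact: measurable_funB.
  - by move=> w _; rewrite lee_fin; exact: clip_contraction.
apply: ge_ereal_sup => _ [theta tT] [dd] [W] [P] [Z] [iid ->].
have [mZ vb K] := key _ _ _ _ _ tT iid.
by rewrite unlock; exact: K.
Qed.

End uniform_risk.

Section rate_arithmetic.
Context (R : realType) (d : nat) (betab lambda0 : R).
Hypotheses (hbetab : 1 < betab) (hd : 4 * betab < d%:R) (hlambda0 : 0 < lambda0).

Let a : R := (d%:R - 4 * betab) / (d%:R * (d%:R + 4)).
Let gamma : R := 4 * (betab + 1) / (d%:R + 4).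

Let dR : 0 < d%:R :> R.
Proof. by apply: lt_trans hd; rewrite mulr_gt0// (lt_trans ltr01). Qed.

Let d4 : d%:R + 4 != 0 :> R.
Proof. by rewrite gt_eqF// addr_gt0. Qed.

(** The bandwidth n^(-a) balances the two terms of the risk bound. *)
Lemma rate_balance (n : nat) (k1 k2 h : R) : (0 < n)%N -> 0 < k1 -> 0 < k2 ->
  k1 * n%:R `^ (- a) <= h -> h <= k2 * n%:R `^ (- a) ->
  (n%:R * h ^+ d)^-1 + Hn d lambda0 n `^ (4 * betab) * h ^+ 4 <=
  ((k1 ^+ d)^-1 + ((2 * lambda0) `^ d%:R^-1) `^ (4 * betab) * k2 ^+ 4) * n%:R `^ (- gamma).
Proof.
move=> n0 k10 k20 h1 h2.
have n0R : 0 < n%:R :> R by rewrite ltr0n.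
have nN : (n%:R != 0 :> R) by rewrite gt_eqF.
have na0 : 0 < n%:R `^ (- a) by exact: powR_gt0.
have kn0 : 0 < k1 * n%:R `^ (- a) by exact: mulr_gt0.
have h0 : 0 < h by exact: lt_le_trans h1.
have b40 : 0 <= 4 * betab by rewrite mulr_ge0// (le_trans ler01)// ltW.
have d0 : (0 < d)%N by rewrite -(ltr_nat R).
rewrite [leRHS]mulrDl; apply: lerD.
  have E : k1 ^+ d * n%:R `^ gamma = n%:R * (k1 * n%:R `^ (- a)) ^+ d.
    rewrite exprMn mulrCA; congr (_ * _).
    rewrite -powR_mulrn ?powR_ge0// -powRrM.
    rewrite -[X in _ = X * _](powRr1 (ltW n0R)) -powRD ?nN ?implybT//.
    congr (_ `^ _); rewrite /a /gamma; field.
    by rewrite d4 gt_eqF.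
  rewrite powRN -invfM E lef_pV2 ?posrE ?mulr_gt0 ?exprn_gt0//.
  apply: ler_wpM2l; first exact: ltW.
  by apply: lerXn2r; rewrite ?nnegrE ?(ltW kn0) ?(ltW h0).
have /andP[H0 _] := Hn_bounds d lambda0 n.
apply: (@le_trans _ _ (((2 * lambda0) `^ d%:R^-1 * n%:R `^ (- d%:R^-1)) `^ (4 * betab) *
    (k2 * n%:R `^ (- a)) ^+ 4)).
  apply: ler_pM; [exact: powR_ge0|by rewrite exprn_ge0 ?ltW| |].
    have bs0 : 0 <= (2 * lambda0) `^ d%:R^-1 * n%:R `^ (- d%:R^-1).
      by apply: mulr_ge0; exact: powR_ge0.
    by apply: ge0_ler_powR; rewrite ?nnegrE ?(ltW H0)//; exact: Hn_le.
  by apply: lerXn2r; rewrite ?nnegrE ?(ltW h0)// mulr_ge0 ?powR_ge0// ltW.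
rewrite powRM ?powR_ge0// exprMn le_eqVlt; apply/orP; left; apply/eqP.
have -> : (n%:R `^ (- d%:R^-1)) `^ (4 * betab) = n%:R `^ (- gamma) * n%:R `^ (4 * a) :> R.
  rewrite -powRrM -powRD ?nN ?implybT//; congr (_ `^ _); rewrite /a /gamma; field.
  by rewrite d4 gt_eqF.
have -> : (n%:R `^ (- a)) ^+ 4 = (n%:R `^ (4 * a))^-1 :> R.
  by rewrite -powR_mulrn ?powR_ge0// -powRrM -powRN; congr (_ `^ _); ring.
field.
by rewrite gt_eqF// powR_gt0.
Qed.

End rate_arithmetic.

Theorem propositionB1 (R : realType) (d : nat) (betab betag : R)
    (U : set 'rV[R]_d) (plow phigh L vlow vhigh M4 lambda0 : R)
    (psi : 'I_(qdim d (hoelder_ell betab)) -> mpoly.mpoly d R)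
    (hbetab : 1 < betab) (hbetag : 0 < betag) (hd : 4 * betab < d%:R)
    (hU : open U) (hcube : @unit_cube R d `<=` U)
    (hplow : 0 < plow < 1) (hphigh : 1 < phigh) (hL : 1 <= L)
    (hvlow : 0 < vlow) (hvhigh : vlow <= vhigh) (hM4 : vhigh ^+ 2 < M4)
    (hlambda0 : 0 < lambda0) (hpsi : polynomial_basis psi) :
  exists (Nmax : nat) (kappa v0 : R),
    [/\ (qdim d (hoelder_ell betab) + 2 <= Nmax)%N, 0 < kappa, 0 < v0 &
    forall lambda : R, 0 < lambda ->
    let Th := Theta U plow phigh L vlow vhigh M4 betab betag in
    let unclipped_risk n s (h : R) := @worst_risk R d n Th
      (sigma2_unclipped psi s Nmax kappa v0 lambda h vlow (n := n)) in
    let clipped_risk n s (h : R) := @worst_risk R d n Th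
      (sigma2_clipped psi s Nmax kappa v0 lambda h vlow vhigh (n := n)) in
    (forall h : nat -> R,
       (forall n, 0 < h n <= 1) -> h @ \oo --> 0 ->
       (fun n => n%:R * h n ^+ d) @ \oo --> +oo ->
       exists C c : R, [/\ 0 < C, 0 < c &
         forall n s, (0 < n)%N -> balanced_split (rn lambda0 n) s ->
         let bound := C * ((n%:R * h n ^+ d)^-1
           + Hn d lambda0 n `^ (4 * betab) * h n ^+ 4
           + expR (- c * (n%:R * h n ^+ d))) in
         (clipped_risk n s (h n) <= bound%:E)%E /\
         (unclipped_risk n s (h n) <= bound%:E)%E]) /\
    (forall h : nat -> R,
       (forall n, 0 < h n <= 1) ->
       h =Theta_\oo (fun n : nat => n%:R
         `^ (- ((d%:R - 4 * betab) / (d%:R * (d%:R + 4))))) ->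
       exists C : R, 0 < C /\
         forall n s, (0 < n)%N -> balanced_split (rn lambda0 n) s ->
         let bound := C * n%:R `^ (- (4 * (betab + 1) / (d%:R + 4))) in
         (clipped_risk n s (h n) <= bound%:E)%E /\
         (unclipped_risk n s (h n) <= bound%:E)%E)].
Proof.
have [Nmax [kappa [qN kappa0 risk]]] := uniform_risk betag hbetab hd hcube hplow hphigh hL
  hvlow hvhigh hM4 hlambda0 hpsi.
exists Nmax, kappa, 1; split => // lambda lambda_gt0 Th urisk crisk.
have [C [C0 riskC]] := risk lambda lambda_gt0.
split => [h h01 _ _|h h01 hT].
  exists C, 1; split => // n s n0 sb bound.
  have [r1 r2] := riskC n s (h n) n0 (h01 n) sb.
  have le : C * ((n%:R * h n ^+ d)^-1 + Hn d lambda0 n `^ (4 * betab) * h n ^+ 4) <= bound.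
    by rewrite /bound; apply: ler_wpM2l; [exact: ltW|rewrite lerDl expR_ge0].
  by split; [apply: le_trans r1 _|apply: le_trans r2 _]; rewrite lee_fin.
pose a : R := (d%:R - 4 * betab) / (d%:R * (d%:R + 4)).
pose gamma : R := 4 * (betab + 1) / (d%:R + 4).
have [k1 [k2 [k10 k20 [N _ hN]]]] : exists k1 k2 : R, [/\ 0 < k1, 0 < k2 &
    \forall n \near \oo, k1 * n%:R `^ (- a) <= h n /\ h n <= k2 * n%:R `^ (- a)].
  move: hT; rewrite eqThetaE qualifE => /asboolP[[k1 k2] /andP[/= k10 k20] hk].
  exists k1, k2; split => //; apply: filterS hk => n.
  have /andP[/ltW hn _] := h01 n.
  by rewrite !ger0_norm ?powR_ge0.
pose D : R := (k1 ^+ d)^-1 + ((2 * lambda0) `^ d%:R^-1) `^ (4 * betab) * k2 ^+ 4.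
(* The finitely many sample sizes before the asymptotic regime. *)
pose S : R := \sum_(i < N) ((i%:R * h i ^+ d)^-1 + Hn d lambda0 i `^ (4 * betab) * h i ^+ 4)
   * i%:R `^ gamma.
have term0 i : 0 <= (i%:R * h i ^+ d)^-1 + Hn d lambda0 i `^ (4 * betab) * h i ^+ 4.
  have /andP[hi _] := h01 i.
  rewrite addr_ge0 ?invr_ge0 ?mulr_ge0 ?powR_ge0 ?exprn_ge0//; exact: ltW.
have S0 : 0 <= S by apply: sumr_ge0 => i _; rewrite mulr_ge0 ?powR_ge0.
have D0 : 0 < D.
  by rewrite ltr_wpDr ?invr_gt0 ?exprn_gt0// mulr_ge0 ?powR_ge0 ?exprn_ge0// ltW.
exists (C * (D + S)); split; first by rewrite mulr_gt0// ltr_wpDr.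
move=> n s n0 sb bound.
have n0R : 0 < n%:R :> R by rewrite ltr0n.
have [r1 r2] := riskC n s (h n) n0 (h01 n) sb.
have le : C * ((n%:R * h n ^+ d)^-1 + Hn d lambda0 n `^ (4 * betab) * h n ^+ 4) <= bound.
  rewrite /bound -/gamma -[leRHS]mulrA; apply: ler_wpM2l; first exact: ltW.
  have [nN|nN] := leqP N n.
    have [hn1 hn2] := hN n nN.
    apply: le_trans (rate_balance hbetab hd hlambda0 n0 k10 k20 hn1 hn2) _.
    by apply: ler_wpM2r; [exact: powR_ge0|rewrite lerDl].
  rewrite powRN ler_pdivlMr ?powR_gt0//.
  rewrite /S (bigD1 (Ordinal nN))//= addrCA lerDl addr_ge0 ?(ltW D0)//.
  by apply: sumr_ge0 => i _; rewrite mulr_ge0 ?powR_ge0.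
by split; [apply: le_trans r1 _|apply: le_trans r2 _]; rewrite lee_fin.
Qed.
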